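(* (ZF) Let $\lambda$ be a rank Berkeley cardinal. For every ordinal $\gamma$ above $\lambda$ (that is, $\gamma>\lambda$) and every well-founded ultrafilter $U$ on a well-ordered set $X$, there is a surjection from ${}^{\gamma}\gamma$ (the set of all functions from $\gamma$ to $\gamma$) onto $j_U(\gamma):=\mathrm{otp}(\gamma^X/U)$.
   Context: The base theory is ZF (no choice). A cardinal $\lambda$ is rank Berkeley if for all ordinals $\eta>\lambda$ and $\alpha<\lambda$ there is an elementary embedding $j:V_\eta\to V_\eta$ with $\alpha<\mathrm{cp}(j)<\lambda$, where $\mathrm{cp}(j)$ is the critical point. For an ultrafilter $U$ on a set $X$ and functions $f,g$ with domain $X$, write $f=_U g$ if $\{x\in X: f(x)=g(x)\}\in U$; $\gamma^X/U$ denotes the set of $=_U$-equivalence classes of functions $X\to\gamma$. $U$ is well-founded if for every ordinal $\gamma$ the relation $[f]_U\in_U[g]_U\iff\{x: f(x)\in g(x)\}\in U$ is a well-order of $\gamma^X/U$; $\mathrm{otp}(\gamma^X/U)$ is its order type. *)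

(* Defs.v *)
(* Provability in ZF is rendered semantically: a theorem of ZF is a sentence
   true in every model of the first-order theory ZF.  The schemas range over
   first-order formulas with parameters, not over all Rocq predicates (the
   latter would import the choice principles of the metatheory into the models).
   Every notion below is a first-order formula over the model: it quantifies
   only over elements of the model, and set-theoretic terms such as (x, y),
   omega or V_eta are rendered by their defining predicates. *)

Record structure : Type := Structure {
  carrier :> Type;
  mem : carrier -> carrier -> Prop }.
Arguments mem {_} _ _.

Notation "x ∈ y" := (mem x y) (at level 70, no associativity).
Notation "x ∉ y" := (~ mem x y) (at level 70, no associativity).

(* De Bruijn indices; FEx binds index 0. *)
Inductive formula : Type :=
| FMem (m n : nat)
| FEq (m n : nat)
| FNot (p : formula)
| FAnd (p q : formula)
| FEx (p : formula).

Definition scons {T : Type} (a : T) (e : nat -> T) (n : nat) : T :=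
  match n with O => a | S k => e k end.

Fixpoint holds {V : structure} (e : nat -> V) (p : formula) : Prop :=
  match p with
  | FMem m n => e m ∈ e n
  | FEq m n => e m = e n
  | FNot q => ~ holds e q
  | FAnd q r => holds e q /\ holds e r
  | FEx q => exists a : V, holds (scons a e) q
  end.

Definition nonempty {V : structure} (a : V) : Prop := exists x : V, x ∈ a.

Definition subset {V : structure} (a b : V) : Prop :=
  forall x : V, x ∈ a -> x ∈ b.

Definition is_succ {V : structure} (a b : V) : Prop :=
  forall x : V, x ∈ b <-> (x ∈ a \/ x = a).

Definition inductive_set {V : structure} (w : V) : Prop :=
  (exists z : V, z ∈ w /\ ~ nonempty z) /\
  (forall a b : V, a ∈ w -> is_succ a b -> b ∈ w).

Record ZF (V : structure) : Prop := {
  zf_extensionality : forall a b : V, (forall x : V, x ∈ a <-> x ∈ b) -> a = b;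
  zf_foundation : forall a : V, nonempty a ->
    exists x : V, x ∈ a /\ forall y : V, y ∈ x -> y ∉ a;
  zf_pairing : forall a b : V, exists c : V,
    forall x : V, x ∈ c <-> (x = a \/ x = b);
  zf_union : forall a : V, exists b : V,
    forall x : V, x ∈ b <-> exists y : V, y ∈ a /\ x ∈ y;
  zf_power : forall a : V, exists b : V, forall x : V, x ∈ b <-> subset x a;
  zf_infinity : exists w : V, inductive_set w;
  zf_separation : forall (p : formula) (e : nat -> V) (a : V), exists b : V,
    forall x : V, x ∈ b <-> (x ∈ a /\ holds (scons x e) p);
  zf_replacement : forall (p : formula) (e : nat -> V) (a : V),
    (forall x y z : V, x ∈ a -> holds (scons x (scons y e)) p ->
       holds (scons x (scons z e)) p -> y = z) ->
    exists b : V, forall y : V,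
      y ∈ b <-> exists x : V, x ∈ a /\ holds (scons x (scons y e)) p }.

Definition is_upair {V : structure} (a b c : V) : Prop :=
  forall x : V, x ∈ c <-> (x = a \/ x = b).

(* p = (a, b), as a Kuratowski pair *)
Definition is_pair {V : structure} (a b p : V) : Prop :=
  forall x : V, x ∈ p <-> (is_upair a a x \/ is_upair a b x).

(* (x, y) ∈ r; when r is a function this says r(x) = y *)
Definition related {V : structure} (r x y : V) : Prop :=
  exists p : V, is_pair x y p /\ p ∈ r.

Definition is_function {V : structure} (f a b : V) : Prop :=
  (forall p : V, p ∈ f -> exists x y : V, x ∈ a /\ y ∈ b /\ is_pair x y p) /\
  (forall x : V, x ∈ a -> exists y : V, related f x y) /\
  (forall x y z : V, related f x y -> related f x z -> y = z).

Definition is_surjection {V : structure} (f a b : V) : Prop :=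
  is_function f a b /\
  forall y : V, y ∈ b -> exists x : V, x ∈ a /\ related f x y.

Definition is_bijection {V : structure} (f a b : V) : Prop :=
  is_surjection f a b /\
  forall x x' y : V, related f x y -> related f x' y -> x = x'.

(* F is the set of all functions from a to b *)
Definition is_funspace {V : structure} (a b F : V) : Prop :=
  forall f : V, f ∈ F <-> is_function f a b.

(* R is a strict well-order of (the elements of) a *)
Definition well_orders {V : structure} (R : V -> V -> Prop) (a : V) : Prop :=
  (forall x : V, x ∈ a -> ~ R x x) /\
  (forall x y z : V, x ∈ a -> y ∈ a -> z ∈ a -> R x y -> R y z -> R x z) /\
  (forall x y : V, x ∈ a -> y ∈ a -> R x y \/ x = y \/ R y x) /\
  (forall s : V, subset s a -> nonempty s ->
     exists m : V, m ∈ s /\ forall x : V, x ∈ s -> x <> m -> R m x).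

Definition is_ordinal {V : structure} (a : V) : Prop :=
  (forall x : V, x ∈ a -> subset x a) /\ well_orders mem a.

Definition is_cardinal {V : structure} (k : V) : Prop :=
  is_ordinal k /\
  forall a : V, a ∈ k -> ~ exists f : V, is_bijection f a k.

(* d is the order type of the well-order R of a *)
Definition is_otp {V : structure} (R : V -> V -> Prop) (a d : V) : Prop :=
  is_ordinal d /\
  exists h : V, is_bijection h a d /\
    forall x y x' y' : V, related h x x' -> related h y y' ->
      (R x y <-> x' ∈ y').

(* v = V_eta: h is the recursion V_xi = union of P(V_zeta) over zeta < xi,
   on an ordinal containing eta *)
Definition is_rank_initial_segment {V : structure} (eta v : V) : Prop :=
  exists h d r : V,
    is_ordinal d /\ eta ∈ d /\ is_function h d r /\ related h eta v /\
    forall xi y : V, related h xi y ->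
      forall x : V,
        x ∈ y <-> exists zeta w : V, zeta ∈ xi /\ related h zeta w /\ subset x w.

Definition is_natural {V : structure} (i : V) : Prop :=
  forall w : V, inductive_set w -> i ∈ w.

Definition is_omega {V : structure} (w : V) : Prop :=
  forall i : V, i ∈ w <-> is_natural i.

Fixpoint is_numeral {V : structure} (n : nat) (x : V) : Prop :=
  match n with
  | O => ~ nonempty x
  | S k => exists y : V, is_numeral k y /\ is_succ y x
  end.

(* Elementarity between set-sized structures is internal to the model: formulas
   are coded by sets of the model, with variables indexed by its own omega. *)

(* c = (n, (a, b)) *)
Definition is_tagged {V : structure} (n : nat) (a b c : V) : Prop :=
  exists t q : V, is_numeral n t /\ is_pair a b q /\ is_pair t q c.

Definition code_mem {V : structure} (i j c : V) : Prop := is_tagged 0 i j c.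
Definition code_eq {V : structure} (i j c : V) : Prop := is_tagged 1 i j c.
Definition code_not {V : structure} (p c : V) : Prop := is_tagged 2 p p c.
Definition code_and {V : structure} (p q c : V) : Prop := is_tagged 3 p q c.
Definition code_ex {V : structure} (i p c : V) : Prop := is_tagged 4 i p c.

Definition formula_closed {V : structure} (F : V) : Prop :=
  (forall i j c : V, is_natural i -> is_natural j -> code_mem i j c -> c ∈ F) /\
  (forall i j c : V, is_natural i -> is_natural j -> code_eq i j c -> c ∈ F) /\
  (forall p c : V, p ∈ F -> code_not p c -> c ∈ F) /\
  (forall p q c : V, p ∈ F -> q ∈ F -> code_and p q c -> c ∈ F) /\
  (forall i p c : V, is_natural i -> p ∈ F -> code_ex i p c -> c ∈ F).

(* Sets F as below exist (V_omega is one), so this is the least one. *)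
Definition is_formula_code {V : structure} (c : V) : Prop :=
  forall F : V, formula_closed F -> c ∈ F.

Definition is_assignment {V : structure} (A s : V) : Prop :=
  exists w : V, is_omega w /\ is_function s w A.

(* t = s[i := a] *)
Definition is_update {V : structure} (s i a t : V) : Prop :=
  related t i a /\ forall k b : V, k <> i -> (related t k b <-> related s k b).

(* T contains (c, s) exactly when (A, ∈) satisfies the formula coded by c under
   the assignment s: Tarski's clauses *)
Definition is_satisfaction {V : structure} (A T : V) : Prop :=
  forall s : V, is_assignment A s ->
  (forall i j c : V, is_natural i -> is_natural j -> code_mem i j c ->
     (related T c s <->
      exists a b : V, related s i a /\ related s j b /\ a ∈ b)) /\
  (forall i j c : V, is_natural i -> is_natural j -> code_eq i j c ->
     (related T c s <-> exists a : V, related s i a /\ related s j a)) /\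
  (forall p c : V, is_formula_code p -> code_not p c ->
     (related T c s <-> ~ related T p s)) /\
  (forall p q c : V, is_formula_code p -> is_formula_code q -> code_and p q c ->
     (related T c s <-> (related T p s /\ related T q s))) /\
  (forall i p c : V, is_natural i -> is_formula_code p -> code_ex i p c ->
     (related T c s <->
      exists a t : V,
        a ∈ A /\ is_assignment A t /\ is_update s i a t /\ related T p t)).

Definition satisfies {V : structure} (A c s : V) : Prop :=
  exists T : V, is_satisfaction A T /\ related T c s.

(* t = j ∘ s, where s and t are assignments *)
Definition is_image_assignment {V : structure} (j s t : V) : Prop :=
  forall i a b : V, related s i a -> related t i b -> related j a b.

(* j is an elementary embedding from (A, ∈) to (B, ∈) *)
Definition is_elementary_embedding {V : structure} (j A B : V) : Prop :=
  is_function j A B /\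
  forall c s t : V,
    is_formula_code c -> is_assignment A s -> is_assignment B t ->
    is_image_assignment j s t ->
    (satisfies A c s <-> satisfies B c t).

(* k is the least ordinal moved by j *)
Definition is_critical_point {V : structure} (j k : V) : Prop :=
  is_ordinal k /\
  (exists y : V, related j k y /\ y <> k) /\
  (forall x : V, x ∈ k -> related j x x).

(* Cardinals are taken to be nonzero: for lambda = 0 the embedding condition
   would be vacuous. *)
Definition rank_Berkeley {V : structure} (lambda : V) : Prop :=
  is_cardinal lambda /\ nonempty lambda /\
  forall eta alpha : V, is_ordinal eta -> lambda ∈ eta -> alpha ∈ lambda ->
    exists v j k : V,
      is_rank_initial_segment eta v /\ is_elementary_embedding j v v /\
      is_critical_point j k /\ alpha ∈ k /\ k ∈ lambda.

Definition is_ultrafilter {V : structure} (X U : V) : Prop :=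
  (forall a : V, a ∈ U -> subset a X) /\
  X ∈ U /\
  (forall a : V, a ∈ U -> nonempty a) /\
  (forall a b : V, a ∈ U -> subset a b -> subset b X -> b ∈ U) /\
  (forall a b c : V, a ∈ U -> b ∈ U ->
     (forall x : V, x ∈ c <-> (x ∈ a /\ x ∈ b)) -> c ∈ U) /\
  (forall a b : V, subset a X ->
     (forall x : V, x ∈ b <-> (x ∈ X /\ x ∉ a)) -> a ∈ U \/ b ∈ U).

(* f =_U g *)
Definition eqU {V : structure} (X U f g : V) : Prop :=
  exists u : V, u ∈ U /\
    forall x : V,
      x ∈ u <-> (x ∈ X /\ exists a : V, related f x a /\ related g x a).

(* {x ∈ X : f(x) ∈ g(x)} ∈ U *)
Definition memU {V : structure} (X U f g : V) : Prop :=
  exists u : V, u ∈ U /\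
    forall x : V,
      x ∈ u <->
      (x ∈ X /\ exists a b : V, related f x a /\ related g x b /\ a ∈ b).

(* c = [f]_U, among functions from X to gamma *)
Definition is_classU {V : structure} (X U gamma f c : V) : Prop :=
  forall g : V, g ∈ c <-> (is_function g X gamma /\ eqU X U f g).

(* Q = gamma^X / U *)
Definition is_ultrapower {V : structure} (X U gamma Q : V) : Prop :=
  forall c : V,
    c ∈ Q <-> exists f : V, is_function f X gamma /\ is_classU X U gamma f c.

(* The relation ∈_U on gamma^X / U, through representatives *)
Definition class_memU {V : structure} (X U c d : V) : Prop :=
  exists f g : V, f ∈ c /\ g ∈ d /\ memU X U f g.

Definition well_founded_ultrafilter {V : structure} (X U : V) : Prop :=
  is_ultrafilter X U /\
  forall gamma Q : V, is_ordinal gamma -> is_ultrapower X U gamma Q ->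
    well_orders (class_memU X U) Q.

(* d = j_U(gamma) *)
Definition is_jU {V : structure} (X U gamma d : V) : Prop :=
  exists Q : V, is_ultrapower X U gamma Q /\ is_otp (class_memU X U) Q d.

(* Main.v *)
From Stdlib Require Import Classical Lia PeanoNat Compare_dec List.
Require Import Defs.

(** The argument never chooses representatives.  It shows that every function
    X -> gamma is, modulo U, a composition h o b with h : gamma -> gamma and b in
    a set of generators which has fewer than gamma classes; a function from gamma
    to gamma can code both h and the position of b.

    Generators.  Call b : X -> gamma a generator if it is not modulo U of the form
    h o c with c <_U b.  As <_U is well-founded, every function is generated by a
    generator (generators_generate).  To see that there are few of them, suppose
    that j : V_eta -> V_eta is elementary with critical point k in gamma, fixes
    gamma, X and U, and that U-almost every point of X is fixed by j.  Then j(f) is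
    modulo U the composition of j | gamma with f, for each f : X -> gamma
    (image_value).  If b is a generator, so is j(b), and j(b) being generated from b
    excludes b <_U j(b); hence j(b) =_U b (generator_fixed).  The rank of b among
    the generators is definable, so it is fixed by j.  The ranks form an initial
    segment of the ordinals that does not contain the moved ordinal k, and so they
    are all less than k.  Finally k is not in the range of j, so a function H on gamma can be prescribed to satisfy
    H o j = h and to have at k the rank of b (enumeration_exists).

    Fixing U.  For ultrafilters on an ordinal X the Ketonen order puts U below W if
    U is the W-limit of ultrafilters E(a) such that a belongs to E(a) for W-almost
    all a.  It is well-founded on the well-founded ultrafilters, without any choice
    (ketonen_well_founded).  If the theorem fails, take gamma least, among the
    ordinals below which embeddings V_eta -> V_eta have critical points for all large
    eta (has_embeddings), then an ordinal X least, then U Ketonen-minimal among the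
    counterexamples.  These conditions are first-order without parameters, so j fixes
    gamma and X, and W = j(U) is minimal as well.  Let D(a) be the set of A with a in j(A).  Since A is in U exactly when
    j(A) is in W, U is the W-limit of the D(a), and a is in D(a) when a < j(a).  By
    minimality of W it is not the case that W-almost all points are moved up by j;
    so W-almost all points are fixed, and then U = W (fixed_ultrafilter).

    Using j.  Rank Berkeleyness speaks of elementarity for satisfaction inside the
    model.  Choosing eta such that V_eta reflects a given finite list of formulas,
    and relating internal satisfaction of standard formulas to truth, one gets a j
    that preserves these formulas in the whole model (preserving_embedding). *)

Existing Class ZF.

(** * Definability over a structure *)

Section Definability.
Context {V : structure}.

Definition up (r : nat -> nat) (n : nat) : nat :=
  match n with O => O | S k => S (r k) end.

Fixpoint rename (r : nat -> nat) (p : formula) : formula :=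
  match p with
  | FMem m n => FMem (r m) (r n)
  | FEq m n => FEq (r m) (r n)
  | FNot q => FNot (rename r q)
  | FAnd q q' => FAnd (rename r q) (rename r q')
  | FEx q => FEx (rename (up r) q)
  end.

Lemma holds_ext (p : formula) :
  forall e e' : nat -> V, (forall n, e n = e' n) -> (holds e p <-> holds e' p).
Proof.
  induction p as [m n|m n|q IH|q IH q' IH'|q IH]; intros e e' H; simpl.
  - rewrite !H; tauto.
  - rewrite !H; tauto.
  - rewrite (IH _ _ H); tauto.
  - rewrite (IH _ _ H), (IH' _ _ H); tauto.
  - split; intros [a Ha]; exists a; revert Ha; apply IH; intros [|n]; simpl; auto.
Qed.

Lemma holds_rename (p : formula) :
  forall (r : nat -> nat) (e : nat -> V),
    holds e (rename r p) <-> holds (fun n => e (r n)) p.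
Proof.
  induction p as [m n|m n|q IH|q IH q' IH'|q IH]; intros r e; simpl; try tauto.
  - rewrite IH; tauto.
  - rewrite IH, IH'; tauto.
  - split; intros [a Ha]; exists a.
    + rewrite IH in Ha; revert Ha; apply holds_ext; intros [|n]; reflexivity.
    + rewrite IH; revert Ha; apply holds_ext; intros [|n]; reflexivity.
Qed.

Definition value (e : nat -> V) (t : nat + V) : V :=
  match t with inl n => e n | inr c => c end.

(** The index C bounds the parameters: with every element allowed, these are the
    predicates to which separation and replacement apply; with none allowed, those
    that an elementary embedding preserves.  The substitution t sends variables to
    variables or parameters, which makes the closure properties below free of any
    bookkeeping on free variables. *)
Definition definable (C : V -> Prop) (P : (nat -> V) -> Prop) : Prop :=
  exists (p : formula) (t : nat -> nat + V),
    (forall i c, t i = inr c -> C c) /\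
    forall e, P e <-> holds (fun i => value e (t i)) p.

Definition term (C : V -> Prop) (s : (nat -> V) -> V) : Prop :=
  exists t : nat + V, (forall c, t = inr c -> C c) /\ forall e, s e = value e t.

Lemma term_var C n : term C (fun e => e n).
Proof. exists (inl n); split; [discriminate|reflexivity]. Qed.

Lemma term_const (C : V -> Prop) c : C c -> term C (fun _ => c).
Proof. intros H; exists (inr c); split; [intros d [= <-]; exact H|reflexivity]. Qed.

Lemma term_shift C (s : (nat -> V) -> V) (k : nat -> nat) :
  term C s -> term C (fun e => s (fun n => e (k n))).
Proof.
  intros [[n|c] [H H']].
  - exists (inl (k n)); split; [discriminate|]; intros e; apply (H' (fun n => e (k n))).
  - exists (inr c); split; [exact H|]; intros e; apply (H' (fun n => e (k n))).
Qed.

Lemma definable_mem C s t : term C s -> term C t -> definable C (fun e => s e ∈ t e).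
Proof.
  intros [a [Ha Ha']] [b [Hb Hb']].
  exists (FMem 0 1), (fun i => match i with O => a | _ => b end); split.
  - intros [|i] c; auto.
  - intros e; simpl; rewrite Ha', Hb'; tauto.
Qed.

Lemma definable_eq C s t : term C s -> term C t -> definable C (fun e => s e = t e).
Proof.
  intros [a [Ha Ha']] [b [Hb Hb']].
  exists (FEq 0 1), (fun i => match i with O => a | _ => b end); split.
  - intros [|i] c; auto.
  - intros e; simpl; rewrite Ha', Hb'; tauto.
Qed.

Lemma definable_iff_pred C (P Q : (nat -> V) -> Prop) :
  (forall e, P e <-> Q e) -> definable C P -> definable C Q.
Proof.
  intros H (p & t & Ht & Hp); exists p, t; split; [exact Ht|].
  intros e; rewrite <- H; apply Hp.
Qed.

Lemma definable_not C P : definable C P -> definable C (fun e => ~ P e).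
Proof.
  intros (p & t & Ht & Hp); exists (FNot p), t; split; [exact Ht|].
  intros e; simpl; rewrite Hp; tauto.
Qed.

(** The variables of the two formulas are kept apart by parity, so that both
    substitutions survive. *)
Lemma definable_and C P Q :
  definable C P -> definable C Q -> definable C (fun e => P e /\ Q e).
Proof.
  intros (p & t & Ht & Hp) (q & u & Hu & Hq).
  exists (FAnd (rename (fun n => 2 * n) p) (rename (fun n => S (2 * n)) q)),
    (fun i => if Nat.even i then t (Nat.div2 i) else u (Nat.div2 i)); split.
  - intros i c; destruct (Nat.even i); eauto.
  - intros e; cbn [holds]; rewrite !holds_rename, Hp, Hq.
    assert (E1 : forall n, Nat.even (2 * n) = true)
      by (intros n; rewrite Nat.even_mul; reflexivity).
    assert (E2 : forall n, Nat.even (S (2 * n)) = false)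
      by (intros n; rewrite Nat.even_succ, <- Nat.negb_even, E1; reflexivity).
    split; intros [H1 H2]; split.
    + revert H1; apply holds_ext; intros n; cbv beta.
      rewrite E1, Nat.div2_double; reflexivity.
    + revert H2; apply holds_ext; intros n; cbv beta.
      rewrite E2, Nat.div2_succ_double; reflexivity.
    + revert H1; apply holds_ext; intros n; cbv beta.
      rewrite E1, Nat.div2_double; reflexivity.
    + revert H2; apply holds_ext; intros n; cbv beta.
      rewrite E2, Nat.div2_succ_double; reflexivity.
Qed.

(** Variable 0 of the body becomes the bound variable; parameters of the body are
    untouched by the shift. *)
Lemma definable_ex C (Q : (nat -> V) -> V -> Prop) :
  definable C (fun e => Q (fun n => e (S n)) (e O)) ->
  definable C (fun e => exists x, Q e x).
Proof.
  intros (p & t & Ht & Hp).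
  exists (FEx (rename (fun i => match t i with inl O => O | _ => S i end) p)),
    (fun i => match t i with inl (S n) => inl n | x => x end); split.
  - intros i c; destruct (t i) as [[|n]|d] eqn:E; try discriminate.
    intros [= ->]; apply (Ht i _ E).
  - intros e; cbn [holds].
    split; intros [a Ha]; exists a.
    + rewrite holds_rename.
      apply (Hp (scons a e)) in Ha; revert Ha; apply holds_ext.
      intros n; destruct (t n) as [[|m]|d] eqn:E; simpl; rewrite ?E; reflexivity.
    + apply (Hp (scons a e)).
      rewrite holds_rename in Ha; revert Ha; apply holds_ext.
      intros n; destruct (t n) as [[|m]|d] eqn:E; simpl; rewrite ?E; reflexivity.
Qed.

(** A proposition that does not mention the environment is true or false, and so it is
    equivalent to a trivial formula, whatever it speaks of. *)
Lemma definable_const C (P : Prop) : definable C (fun _ => P).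
Proof.
  destruct (classic P) as [H|H].
  - exists (FEq 0 0), inl; split; [discriminate|]; simpl; tauto.
  - exists (FNot (FEq 0 0)), inl; split; [discriminate|]; simpl; tauto.
Qed.

Lemma definable_imp C P Q :
  definable C P -> definable C Q -> definable C (fun e => P e -> Q e).
Proof.
  intros HP HQ.
  apply definable_iff_pred with (fun e => ~ (P e /\ ~ Q e)).
  - intros e; destruct (classic (Q e)); tauto.
  - apply definable_not, definable_and, definable_not; assumption.
Qed.

Lemma definable_or C P Q :
  definable C P -> definable C Q -> definable C (fun e => P e \/ Q e).
Proof.
  intros HP HQ.
  apply definable_iff_pred with (fun e => ~ P e -> Q e).
  - intros e; destruct (classic (P e)); tauto.
  - apply definable_imp; [apply definable_not|]; assumption.
Qed.

Lemma definable_iff C P Q :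
  definable C P -> definable C Q -> definable C (fun e => P e <-> Q e).
Proof. intros HP HQ; apply definable_and; apply definable_imp; assumption. Qed.

Lemma definable_all C (Q : (nat -> V) -> V -> Prop) :
  definable C (fun e => Q (fun n => e (S n)) (e O)) ->
  definable C (fun e => forall x, Q e x).
Proof.
  intros H.
  apply definable_iff_pred with (fun e => ~ exists x, ~ Q e x).
  - intros e; split.
    + intros H' x; apply NNPP; intros H''; apply H'; exists x; exact H''.
    + intros H' [x Hx]; apply Hx, H'.
  - apply definable_not, (definable_ex C (fun e x => ~ Q e x)), definable_not, H.
Qed.

Lemma definable_holds (p : formula) C : definable C (fun e => holds e p).
Proof. exists p, inl; split; [discriminate|]; intros e; apply holds_ext; reflexivity. Qed.

Lemma lightface (P : (nat -> V) -> Prop) :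
  definable (fun _ => False) P -> exists p, forall e, P e <-> holds e p.
Proof.
  intros (p & t & Ht & Hp).
  exists (rename (fun i => match t i with inl n => n | _ => O end) p).
  intros e; rewrite Hp, holds_rename; apply holds_ext.
  intros n; destruct (t n) eqn:E; [reflexivity|]; destruct (Ht _ _ E).
Qed.

End Definability.

Definition any {V : structure} (_ : V) : Prop := True.
Definition none {V : structure} (_ : V) : Prop := False.

(** The arguments range over terms rather than variables, so that an instance can be
    used under binders and with parameters alike. *)
Class Definable1 {V : structure} C (P : V -> Prop) : Prop :=
  definable1 : forall a, term C a -> definable C (fun e => P (a e)).
Class Definable2 {V : structure} C (P : V -> V -> Prop) : Prop :=
  definable2 : forall a b, term C a -> term C b ->
    definable C (fun e => P (a e) (b e)).
Class Definable3 {V : structure} C (P : V -> V -> V -> Prop) : Prop :=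
  definable3 : forall a b c, term C a -> term C b -> term C c ->
    definable C (fun e => P (a e) (b e) (c e)).
Class Definable4 {V : structure} C (P : V -> V -> V -> V -> Prop) : Prop :=
  definable4 : forall a b c d, term C a -> term C b -> term C c -> term C d ->
    definable C (fun e => P (a e) (b e) (c e) (d e)).
Class Definable5 {V : structure} C (P : V -> V -> V -> V -> V -> Prop) : Prop :=
  definable5 : forall a b c d f,
    term C a -> term C b -> term C c -> term C d -> term C f ->
    definable C (fun e => P (a e) (b e) (c e) (d e) (f e)).

Ltac solve_term :=
  cbv beta;
  first
    [ eassumption
    | apply term_var
    | apply term_const; solve [exact I | assumption]
    | apply term_shift; eassumption ].

(* Larger arities first: a predicate with some arguments constant is also a predicate
   of fewer arguments. *)
Ltac definable_predicate :=
  match goal with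
  | |- definable ?C (fun e => ?R (@?a e) (@?b e) (@?c e) (@?d e) (@?f e)) =>
      let H := constr:(_ : Definable5 C R) in apply (H a b c d f)
  | |- definable ?C (fun e => ?R (@?a e) (@?b e) (@?c e) (@?d e)) =>
      let H := constr:(_ : Definable4 C R) in apply (H a b c d)
  | |- definable ?C (fun e => ?R (@?a e) (@?b e) (@?c e)) =>
      let H := constr:(_ : Definable3 C R) in apply (H a b c)
  | |- definable ?C (fun e => ?R (@?a e) (@?b e)) =>
      let H := constr:(_ : Definable2 C R) in apply (H a b)
  | |- definable ?C (fun e => ?R (@?a e)) =>
      let H := constr:(_ : Definable1 C R) in apply (H a)
  end; solve_term.

Ltac unfold_binding_notion := fail.

Ltac definability_step :=
  cbv beta;
  lazymatch goal with
  | |- definable _ (fun _ => ?P) => apply definable_const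
  | |- definable _ (fun e => @mem _ (@?a e) (@?b e)) =>
      apply definable_mem; solve_term
  | |- definable _ (fun e => @eq (carrier _) (@?a e) (@?b e)) =>
      apply definable_eq; solve_term
  | |- definable _ (fun e => (@?P e) /\ (@?Q e)) => apply (definable_and _ P Q)
  | |- definable _ (fun e => (@?P e) \/ (@?Q e)) => apply (definable_or _ P Q)
  | |- definable _ (fun e => (@?P e) <-> (@?Q e)) => apply (definable_iff _ P Q)
  | |- definable _ (fun e => ~ (@?P e)) => apply (definable_not _ P)
  | |- definable _ (fun e => exists x : carrier _, @?Q e x) =>
      apply (definable_ex _ Q)
  | |- definable _ (fun e => forall x : carrier _, @?Q e x) =>
      apply (definable_all _ Q)
  | |- definable _ (fun e => (@?P e) -> (@?Q e)) => apply (definable_imp _ P Q)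
  | |- _ => first [ definable_predicate | unfold_binding_notion ]
  end.

Ltac definability :=
  unfold Definable1, Definable2, Definable3, Definable4, Definable5; intros;
  repeat definability_step.

Section BasicNotions.
Context {V : structure} (C : V -> Prop).
#[export] Instance mem_definable : Definable2 C mem.
Proof. definability. Qed.
#[export] Instance nonempty_definable : Definable1 C nonempty.
Proof. unfold nonempty; definability. Qed.
#[export] Instance subset_definable : Definable2 C subset.
Proof. unfold subset; definability. Qed.
#[export] Instance is_succ_definable : Definable2 C is_succ.
Proof. unfold is_succ; definability. Qed.
#[export] Instance is_upair_definable : Definable3 C is_upair.
Proof. unfold is_upair; definability. Qed.
#[export] Instance is_pair_definable : Definable3 C is_pair.
Proof. unfold is_pair; definability. Qed.
#[export] Instance inductive_set_definable : Definable1 C inductive_set.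
Proof. unfold inductive_set; definability. Qed.
#[export] Instance related_definable : Definable3 C related.
Proof. unfold related; definability. Qed.
#[export] Instance is_natural_definable : Definable1 C is_natural.
Proof. unfold is_natural; definability. Qed.
#[export] Instance is_function_definable : Definable3 C is_function.
Proof. unfold is_function; definability. Qed.
#[export] Instance is_omega_definable : Definable1 C is_omega.
Proof. unfold is_omega; definability. Qed.
#[export] Instance is_update_definable : Definable4 C is_update.
Proof. unfold is_update; definability. Qed.
#[export] Instance memU_definable : Definable4 C memU.
Proof. unfold memU; definability. Qed.
#[export] Instance eqU_definable : Definable4 C eqU.
Proof. unfold eqU; definability. Qed.
#[export] Instance is_classU_definable : Definable5 C is_classU.
Proof. unfold is_classU; definability. Qed.
#[export] Instance class_memU_definable : Definable4 C class_memU.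
Proof. unfold class_memU; definability. Qed.
#[export] Instance is_ultrafilter_definable : Definable2 C is_ultrafilter.
Proof. unfold is_ultrafilter; definability. Qed.
End BasicNotions.

#[export] Instance definable1_apply {V : structure} (P : V -> V -> Prop) x :
  Definable2 any P -> Definable1 any (P x).
Proof. intros H; definability. Qed.
#[export] Instance definable2_apply {V : structure} (P : V -> V -> V -> Prop) x :
  Definable3 any P -> Definable2 any (P x).
Proof. intros H; definability. Qed.
#[export] Instance definable3_apply {V : structure} (P : V -> V -> V -> V -> Prop) x :
  Definable4 any P -> Definable3 any (P x).
Proof. intros H; definability. Qed.
#[export] Instance definable4_apply {V : structure}
    (P : V -> V -> V -> V -> V -> Prop) x :
  Definable5 any P -> Definable4 any (P x).
Proof. intros H; definability. Qed.

Ltac definable_lambda P :=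
  lazymatch P with fun x => @?b x => definability end.
(* Only abstractions are attacked by the tactic: it looks up instances for named
   predicates itself, and would loop on a name that has none. *)
#[export] Hint Extern 5 (Definable1 _ ?P) => definable_lambda P : typeclass_instances.
#[export] Hint Extern 5 (Definable2 _ ?P) => definable_lambda P : typeclass_instances.
#[export] Hint Extern 5 (Definable3 _ ?P) => definable_lambda P : typeclass_instances.

(** * Sets, pairs and functions *)

Section Sets.
Context {V : structure} {HZF : ZF V}.
Implicit Types a b c d f g p s t u v w x y z : V.

Lemma ext a b : (forall x, x ∈ a <-> x ∈ b) -> a = b.
Proof. apply (zf_extensionality V HZF). Qed.

Lemma minimal_element a :
  nonempty a -> exists x, x ∈ a /\ forall y, y ∈ x -> y ∉ a.
Proof. apply (zf_foundation V HZF). Qed.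

(** The axiom takes all parameters from one environment, whereas the formula behind P
    may have its variables and parameters in any order; renaming sorts them. *)
Lemma separation (P : V -> Prop) {H : Definable1 any P} a :
  exists b, forall x, x ∈ b <-> x ∈ a /\ P x.
Proof.
  destruct (H (fun e => e O) (term_var _ _)) as (p & t & _ & Hp).
  destruct (zf_separation V HZF
    (rename (fun i => match t i with inl _ => O | inr _ => S i end) p)
    (fun i => match t i with inr c => c | inl _ => a end) a) as [b Hb].
  exists b; intros x; rewrite Hb, holds_rename, (Hp (fun _ => x)).
  apply and_iff_compat_l, holds_ext; intros n.
  destruct (t n) eqn:E; simpl; rewrite ?E; reflexivity.
Qed.

Lemma replacement (P : V -> V -> Prop) {H : Definable2 any P} a :
  (forall x y z, x ∈ a -> P x y -> P x z -> y = z) ->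
  exists b, forall y, y ∈ b <-> exists x, x ∈ a /\ P x y.
Proof.
  intros Hf.
  destruct (H (fun e => e O) (fun e => e 1) (term_var _ _) (term_var _ _))
    as (p & t & _ & Hp).
  set (q := rename (fun i => match t i with
                             | inl O => O | inl _ => 1 | inr _ => S (S i) end) p).
  set (e := fun i => match t i with inr c => c | inl _ => a end).
  assert (E : forall x y, holds (scons x (scons y e)) q <-> P x y).
  { intros x y; unfold q; rewrite holds_rename.
    rewrite (Hp (fun n => match n with O => x | _ => y end)).
    apply holds_ext; intros n; unfold e.
    destruct (t n) as [[|m]|c] eqn:E'; simpl; rewrite ?E'; reflexivity. }
  destruct (zf_replacement V HZF q e a) as [b Hb].
  - intros x y z Hx Hy Hz; rewrite E in Hy, Hz; eauto.
  - exists b; intros y; rewrite Hb; split; intros [x [Hx Hxy]]; exists x;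
      (split; [exact Hx|]); apply E; exact Hxy.
Qed.

Lemma upair_exists a b : exists c, is_upair a b c.
Proof. apply (zf_pairing V HZF). Qed.

Lemma union_exists a : exists b, forall x, x ∈ b <-> exists y, y ∈ a /\ x ∈ y.
Proof. apply (zf_union V HZF). Qed.

Lemma power_exists a : exists b, forall x, x ∈ b <-> subset x a.
Proof. apply (zf_power V HZF). Qed.

Lemma union2_exists a b : exists c, forall x, x ∈ c <-> x ∈ a \/ x ∈ b.
Proof.
  destruct (upair_exists a b) as [p Hp], (union_exists p) as [c Hc].
  exists c; intros x; rewrite Hc; split.
  - intros [y [Hy Hx]]; apply Hp in Hy as [-> | ->]; auto.
  - intros [Hx|Hx]; [exists a|exists b]; (split; [apply Hp|]); auto.
Qed.

Lemma succ_exists a : exists b, is_succ a b.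
Proof.
  destruct (upair_exists a a) as [p Hp], (union2_exists a p) as [c Hc].
  exists c; intros x; rewrite Hc, (Hp x); tauto.
Qed.

Lemma not_mem_self a : a ∉ a.
Proof.
  intros H; destruct (upair_exists a a) as [p Hp].
  destruct (minimal_element p) as [x [Hx Hm]].
  - exists a; apply Hp; auto.
  - assert (x = a) as -> by (apply Hp in Hx; tauto).
    apply (Hm a H), Hp; auto.
Qed.

Lemma not_mem_cycle a b : a ∈ b -> b ∉ a.
Proof.
  intros H H'; destruct (upair_exists a b) as [p Hp].
  destruct (minimal_element p) as [x [Hx Hm]].
  - exists a; apply Hp; auto.
  - apply Hp in Hx as [-> | ->].
    + apply (Hm b H'), Hp; auto.
    + apply (Hm a H), Hp; auto.
Qed.

Lemma upair_unique a b c d : is_upair a b c -> is_upair a b d -> c = d.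
Proof. intros H H'; apply ext; intros x; rewrite (H x), (H' x); tauto. Qed.

Lemma upair_injective a b c d p :
  is_upair a b p -> is_upair c d p -> a = c /\ b = d \/ a = d /\ b = c.
Proof.
  intros H H'.
  assert (A : a = c \/ a = d) by (apply H', H; auto).
  assert (B : b = c \/ b = d) by (apply H', H; auto).
  assert (C : c = a \/ c = b) by (apply H, H'; auto).
  assert (D : d = a \/ d = b) by (apply H, H'; auto).
  destruct A as [->| ->], B as [->| ->], C as [E|E], D as [E'|E']; subst; auto.
Qed.

Lemma pair_exists a b : exists p, is_pair a b p.
Proof.
  destruct (upair_exists a a) as [c Hc], (upair_exists a b) as [d Hd].
  destruct (upair_exists c d) as [p Hp]; exists p; intros x; rewrite (Hp x).
  split; intros [H|H].
  - subst; auto.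
  - subst; auto.
  - left; eapply upair_unique; eassumption.
  - right; eapply upair_unique; eassumption.
Qed.

Lemma pair_unique a b p q : is_pair a b p -> is_pair a b q -> p = q.
Proof. intros H H'; apply ext; intros x; rewrite (H x), (H' x); tauto. Qed.

Lemma pair_injective a b c d p : is_pair a b p -> is_pair c d p -> a = c /\ b = d.
Proof.
  intros H H'.
  destruct (upair_exists a a) as [s Hs], (upair_exists a b) as [t Ht].
  destruct (upair_exists c c) as [u Hu], (upair_exists c d) as [v Hv].
  assert (S : is_upair c c s \/ is_upair c d s) by (apply H', H; auto).
  assert (T : is_upair c c t \/ is_upair c d t) by (apply H', H; auto).
  assert (U : is_upair a a u \/ is_upair a b u) by (apply H, H'; auto).
  assert (W : is_upair a a v \/ is_upair a b v) by (apply H, H'; auto).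
  destruct S as [S|S], T as [T|T], U as [U|U], W as [W|W];
    repeat match goal with
    | A : is_upair _ _ ?s, B : is_upair _ _ ?s |- _ =>
        pose proof (upair_injective _ _ _ _ _ A B); clear A
    end; intuition congruence.
Qed.

Lemma related_graph (P : V -> V -> Prop) {H : Definable2 any P} a :
  (forall x y z, x ∈ a -> P x y -> P x z -> y = z) ->
  exists f, (forall p, p ∈ f -> exists x y, x ∈ a /\ P x y /\ is_pair x y p) /\
    forall x y, related f x y <-> x ∈ a /\ P x y.
Proof.
  intros Hf.
  destruct (replacement (fun x p => exists y, P x y /\ is_pair x y p) a)
    as [f Hf'].
  - intros x p q Hx [y [Hy Hp]] [z [Hz Hq]].
    rewrite (Hf _ _ _ Hx Hy Hz) in Hp; eapply pair_unique; eassumption.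
  - exists f; split.
    + intros p Hp; apply Hf' in Hp as (x & Hx & y & Hy & Hp); eauto.
    + intros x y; split.
      * intros (p & Hp & Hpf); apply Hf' in Hpf as (x' & Hx & y' & Hy & Hp').
        destruct (pair_injective _ _ _ _ _ Hp Hp') as [-> ->]; auto.
      * intros [Hx Hy]; destruct (pair_exists x y) as [p Hp].
        exists p; split; [exact Hp|]; apply Hf'; eauto.
Qed.

Lemma function_exists (P : V -> V -> Prop) {H : Definable2 any P} a b :
  (forall x y z, x ∈ a -> P x y -> P x z -> y = z) ->
  (forall x, x ∈ a -> exists y, y ∈ b /\ P x y) ->
  exists f, is_function f a b /\ forall x y, related f x y <-> x ∈ a /\ P x y.
Proof.
  intros Hf Ht; destruct (related_graph P a Hf) as (f & Hf1 & Hf2).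
  exists f; split; [|exact Hf2]; split; [|split].
  - intros p Hp; destruct (Hf1 p Hp) as (x & y & Hx & Hy & Hp').
    exists x, y; split; [|split]; auto.
    destruct (Ht x Hx) as (y' & Hy' & Hxy'); rewrite (Hf x y y' Hx Hy Hxy'); auto.
  - intros x Hx; destruct (Ht x Hx) as (y & Hy & Hxy); exists y; apply Hf2; auto.
  - intros x y z Hy Hz; apply Hf2 in Hy as [Hx Hy], Hz as [_ Hz]; eauto.
Qed.

Lemma function_total f a b x :
  is_function f a b -> x ∈ a -> exists y, y ∈ b /\ related f x y.
Proof.
  intros (H1 & H2 & H3) Hx; destruct (H2 x Hx) as (y & p & Hp & Hpf).
  destruct (H1 p Hpf) as (x' & y' & Hx' & Hy' & Hp').
  destruct (pair_injective _ _ _ _ _ Hp Hp') as [-> ->].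
  exists y'; split; [|exists p]; auto.
Qed.

Lemma function_values f a b x y :
  is_function f a b -> related f x y -> x ∈ a /\ y ∈ b.
Proof.
  intros (H1 & H2 & H3) (p & Hp & Hpf).
  destruct (H1 p Hpf) as (x' & y' & Hx' & Hy' & Hp').
  destruct (pair_injective _ _ _ _ _ Hp Hp') as [-> ->]; auto.
Qed.

Lemma function_unique f a b x y z :
  is_function f a b -> related f x y -> related f x z -> y = z.
Proof. intros (H1 & H2 & H3); eauto. Qed.

Lemma product_exists a b :
  exists c, forall p, p ∈ c <-> exists x y, x ∈ a /\ y ∈ b /\ is_pair x y p.
Proof.
  destruct (union2_exists a b) as [u Hu], (power_exists u) as [u' Hu'].
  destruct (power_exists u') as [u'' Hu''].
  destruct (separation (fun p => exists x y, x ∈ a /\ y ∈ b /\ is_pair x y p) u'')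
    as [c Hc].
  exists c; intros p; rewrite Hc; split; [tauto|].
  intros H; split; [|exact H]; destruct H as (x & y & Hx & Hy & Hp).
  apply Hu''; intros z Hz; apply Hu'; intros w Hw; apply Hu.
  apply Hp in Hz as [Hz|Hz]; apply Hz in Hw as [-> | ->]; auto.
Qed.

Lemma funspace_exists a b : exists F, is_funspace a b F.
Proof.
  destruct (product_exists a b) as [c Hc], (power_exists c) as [d Hd].
  destruct (separation (fun f => is_function f a b) d) as [F HF].
  exists F; intros f; rewrite HF; split; [tauto|]; intros Hf; split; [|exact Hf].
  apply Hd; intros p Hp; apply Hc; apply Hf, Hp.
Qed.

Lemma compose_exists f g a b c :
  is_function f a b -> is_function g b c ->
  exists h, is_function h a c /\
    forall x z, related h x z <-> exists y, related f x y /\ related g y z.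
Proof.
  intros Hf Hg.
  destruct (function_exists (fun x z => exists y, related f x y /\ related g y z) a c)
    as (h & Hh & Hh').
  - intros x y z _ (u & Hu & Hu') (v & Hv & Hv').
    rewrite (function_unique _ _ _ _ _ _ Hf Hu Hv) in Hu'.
    eapply function_unique; eassumption.
  - intros x Hx; destruct (function_total _ _ _ _ Hf Hx) as (y & Hy & Hxy).
    destruct (function_total _ _ _ _ Hg Hy) as (z & Hz & Hyz); eauto.
  - exists h; split; [exact Hh|]; intros x z; rewrite Hh'; split; [tauto|].
    intros H; split; [|exact H]; destruct H as (y & Hy & _).
    apply (function_values _ _ _ _ _ Hf Hy).
Qed.

End Sets.

(** * Ordinals *)

Definition transitive {V : structure} (a : V) : Prop := forall x, x ∈ a -> subset x a.
(** By foundation, well-ordering by membership comes for free; see is_ordinal_iff. *)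
Definition ordinal {V : structure} (a : V) : Prop :=
  transitive a /\ forall x, x ∈ a -> transitive x.

#[export] Instance transitive_definable {V : structure} C :
  Definable1 C (@transitive V).
Proof. unfold transitive; definability. Qed.
#[export] Instance ordinal_definable {V : structure} C :
  Definable1 C (@ordinal V).
Proof. unfold ordinal; definability. Qed.

Section Ordinals.
Context {V : structure} {HZF : ZF V}.
Implicit Types a b c d f g p s t u v w x y z : V.

Lemma ordinal_mem a b : ordinal a -> b ∈ a -> ordinal b.
Proof.
  intros [H H'] Hb; split; [auto|].
  intros x Hx; apply H'; apply (H b Hb), Hx.
Qed.

Lemma ordinal_trans a b c : ordinal a -> c ∈ b -> b ∈ a -> c ∈ a.
Proof. intros [H _] Hc Hb; apply (H b Hb), Hc. Qed.

Lemma ordinal_succ a b : ordinal a -> is_succ a b -> ordinal b.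
Proof.
  intros Ha Hb; split.
  - intros x Hx y Hy; apply Hb; apply Hb in Hx as [Hx| ->]; left; [|exact Hy].
    eapply ordinal_trans; eassumption.
  - intros x Hx; apply Hb in Hx as [Hx| ->]; [apply (proj2 Ha), Hx|apply (proj1 Ha)].
Qed.

Lemma ordinal_union a b :
  (forall x, x ∈ a -> ordinal x) ->
  (forall x, x ∈ b <-> exists y, y ∈ a /\ x ∈ y) -> ordinal b.
Proof.
  intros Ha Hb; split.
  - intros x Hx y Hy; apply Hb in Hx as (z & Hz & Hx); apply Hb; exists z.
    split; [exact Hz|]; apply (ordinal_trans _ _ _ (Ha z Hz) Hy Hx).
  - intros x Hx; apply Hb in Hx as (z & Hz & Hx); apply (Ha z Hz), Hx.
Qed.

Definition comparable a b : Prop := a ∈ b \/ a = b \/ b ∈ a.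

#[export] Instance comparable_definable : Definable2 any comparable.
Proof. unfold comparable; definability. Qed.

(** Take x minimal with some incomparable y up to b, and then y minimal for that x.
    Elements of x are comparable with y and elements of y with x, which forces x and
    y to have the same elements. *)
Lemma ordinal_trichotomy a b : ordinal a -> ordinal b -> comparable a b.
Proof.
  intros Ha Hb; apply NNPP; intros Hab.
  destruct (succ_exists a) as [a' Ha'], (succ_exists b) as [b' Hb'].
  pose proof (ordinal_succ _ _ Ha Ha') as Oa; pose proof (ordinal_succ _ _ Hb Hb') as Ob.
  destruct (separation (fun x => exists y, y ∈ b' /\ ~ comparable x y) a') as [s Hs].
  destruct (minimal_element s) as (x & Hx & Hmx).
  { exists a; apply Hs; split; [apply Ha'; auto|]; exists b; split; [apply Hb'|]; auto. }
  apply Hs in Hx as [Hx Hxs].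
  destruct (separation (fun y => ~ comparable x y) b') as [t Ht].
  destruct (minimal_element t) as (y & Hy & Hmy).
  { destruct Hxs as (y & Hy & Hxy); exists y; apply Ht; auto. }
  apply Ht in Hy as [Hy Hxy]; apply Hxy; right; left.
  apply ext; intros z; split; intros Hz.
  - destruct (classic (comparable z y)) as [[H|[H|H]]|H].
    + exact H.
    + subst z; destruct Hxy; right; right; exact Hz.
    + destruct Hxy; right; right.
      eapply ordinal_trans; [eapply ordinal_mem; [exact Oa|exact Hx]|exact H|exact Hz].
    + destruct (Hmx z Hz); apply Hs; split; [eapply ordinal_trans; eassumption|].
      exists y; auto.
  - destruct (classic (comparable x z)) as [[H|[H|H]]|H].
    + destruct Hxy; left.
      eapply ordinal_trans; [eapply ordinal_mem; [exact Ob|exact Hy]|exact H|exact Hz].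
    + subst z; destruct Hxy; left; exact Hz.
    + exact H.
    + destruct (Hmy z Hz); apply Ht; split; [eapply ordinal_trans; eassumption|auto].
Qed.

Lemma is_ordinal_iff a : is_ordinal a <-> ordinal a.
Proof.
  split.
  - intros (H1 & H2 & H3 & H4 & H5); split; [exact H1|].
    intros x Hx y Hy z Hz.
    pose proof (H1 x Hx y Hy); pose proof (H1 y H z Hz); eauto.
  - intros Ha; split; [exact (proj1 Ha)|]; split; [|split; [|split]].
    + intros x _; apply not_mem_self.
    + intros x y z Hx Hy Hz Hxy Hyz.
      apply (ordinal_trans _ _ _ (ordinal_mem _ _ Ha Hz) Hxy Hyz).
    + intros x y Hx Hy; apply ordinal_trichotomy; eapply ordinal_mem; eassumption.
    + intros s Hs Hn; destruct (minimal_element s Hn) as (m & Hm & Hm').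
      exists m; split; [exact Hm|]; intros x Hx Hxm.
      destruct (ordinal_trichotomy m x) as [H|[H|H]]; try congruence.
      * eapply ordinal_mem; [exact Ha|apply Hs, Hm].
      * eapply ordinal_mem; [exact Ha|apply Hs, Hx].
      * destruct (Hm' x H Hx).
Qed.

Lemma ordinal_subset a b : ordinal a -> ordinal b -> subset a b -> a ∈ b \/ a = b.
Proof.
  intros Ha Hb H; destruct (ordinal_trichotomy a b Ha Hb) as [H'|[H'|H']]; auto.
  destruct (not_mem_self b); auto.
Qed.

Lemma least_ordinal (P : V -> Prop) {HP : Definable1 any P} :
  (exists a, ordinal a /\ P a) ->
  exists a, ordinal a /\ P a /\ forall b, b ∈ a -> ~ P b.
Proof.
  intros (a & Ha & HPa); destruct (succ_exists a) as [a' Ha'].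
  destruct (separation P a') as [s Hs].
  destruct (minimal_element s) as (x & Hx & Hmx).
  { exists a; apply Hs; split; [apply Ha'|]; auto. }
  apply Hs in Hx as [Hx HPx]; pose proof (ordinal_succ _ _ Ha Ha') as Oa.
  exists x; split; [eapply ordinal_mem; eassumption|]; split; [exact HPx|].
  intros b Hb HPb; apply (Hmx b Hb), Hs; split; [|exact HPb].
  eapply ordinal_trans; eassumption.
Qed.

Lemma least_ordinal_unique (P : V -> Prop) a b :
  ordinal a -> ordinal b -> P a -> P b ->
  (forall x, x ∈ a -> ~ P x) -> (forall x, x ∈ b -> ~ P x) -> a = b.
Proof.
  intros Oa Ob Pa Pb La Lb.
  destruct (ordinal_trichotomy a b Oa Ob) as [H|[H|H]]; [|exact H|].
  - destruct (Lb a H Pa).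
  - destruct (La b H Pb).
Qed.

Lemma ordinal_bound s :
  (forall x, x ∈ s -> ordinal x) -> exists b, ordinal b /\ forall x, x ∈ s -> x ∈ b.
Proof.
  intros Hs; destruct (union_exists s) as [u Hu], (succ_exists u) as [b Hb].
  pose proof (ordinal_union s u Hs Hu) as Ou.
  exists b; split; [eapply ordinal_succ; eassumption|].
  intros x Hx; apply Hb, ordinal_subset; auto.
  intros y Hy; apply Hu; eauto.
Qed.

(** Least witnesses make replacement applicable. *)
Lemma ordinal_collection (P : V -> V -> Prop) {HP : Definable2 any P} a :
  (forall x, x ∈ a -> exists b, ordinal b /\ P x b) ->
  exists c, ordinal c /\ forall x, x ∈ a -> exists b, b ∈ c /\ ordinal b /\ P x b.
Proof.
  intros H.
  destruct (replacement
    (fun x b => ordinal b /\ P x b /\ forall b', b' ∈ b -> ~ P x b') a) as [s Hs].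
  - intros x y z _ (O1 & P1 & L1) (O2 & P2 & L2).
    apply (least_ordinal_unique (P x)); auto.
  - destruct (ordinal_bound s) as (c & Oc & Hc).
    { intros b Hb; apply Hs in Hb as (x & _ & Hb & _); exact Hb. }
    exists c; split; [exact Oc|]; intros x Hx.
    destruct (least_ordinal (P x)) as (b & Ob & Pb & Lb); [auto|].
    exists b; split; [apply Hc, Hs; exists x|]; auto.
Qed.

End Ordinals.

(** * Recursion along well-founded relations *)

Definition well_founded_on {V : structure} (K : V) (R : V -> V -> Prop) : Prop :=
  forall s, subset s K -> nonempty s ->
    exists m, m ∈ s /\ forall y, y ∈ s -> ~ R y m.

(** The value at z may depend on z and on the set s of values at the R-predecessors
    of z.  Attempts are single-valued and agree with each other, by induction along R. *)
Definition attempt {V : structure} (K : V) (R : V -> V -> Prop)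
    (G : V -> V -> V -> Prop) (g : V) : Prop :=
  forall z v, related g z v -> z ∈ K /\
    exists s,
      (forall u, u ∈ s <-> exists y, y ∈ K /\ R y z /\ related g y u) /\
      (forall y, y ∈ K -> R y z -> exists u, related g y u) /\ G z s v.

Definition recursive_value {V : structure} (K : V) (R : V -> V -> Prop)
    (G : V -> V -> V -> Prop) (z v : V) : Prop :=
  exists g, attempt K R G g /\ related g z v.

(** The Mostowski collapse.  It serves as a rank function: on a transitive relation its
    values are ordinals, and they form an initial segment of the ordinals. *)
Definition collapse {V : structure} (K : V) (R : V -> V -> Prop) (z v : V) : Prop :=
  recursive_value K R (fun _ s v => v = s) z v.

Section Recursion.
Context {V : structure} {HZF : ZF V}.
Context (K : V) (R : V -> V -> Prop) (G : V -> V -> V -> Prop).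
Context {HR : Definable2 any R} {HG : Definable3 any G}.
Context (Hwf : well_founded_on K R).
Context (Gf : forall z s v v', z ∈ K -> G z s v -> G z s v' -> v = v').
Context (Gt : forall z s, z ∈ K -> exists v, G z s v).

#[export] Instance recursive_value_definable : Definable2 any (recursive_value K R G).
Proof. unfold recursive_value, attempt; definability. Qed.

Lemma recursive_value_domain z v : recursive_value K R G z v -> z ∈ K.
Proof. intros (g & Hg & Hz); apply (Hg z v Hz). Qed.

Lemma recursive_value_unique z v v' :
  recursive_value K R G z v -> recursive_value K R G z v' -> v = v'.
Proof.
  intros H1 H2; apply NNPP; intros Hn.
  destruct (separation (fun z => exists v v', recursive_value K R G z v /\
     recursive_value K R G z v' /\ v <> v') K) as [s Hs].
  destruct (Hwf s) as (m & Hm & Hmin).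
  { intros x Hx; apply Hs, Hx. }
  { exists z; apply Hs; split; [eapply recursive_value_domain; eassumption|].
    exists v, v'; auto. }
  apply Hs in Hm as [HmK (w & w' & (g & Hg & Hw) & (g' & Hg' & Hw') & Hww)].
  apply Hww.
  destruct (Hg _ _ Hw) as (_ & t & Ht & Ht1 & HG1).
  destruct (Hg' _ _ Hw') as (_ & t' & Ht' & Ht1' & HG1').
  assert (E : forall y u u', y ∈ K -> R y m -> related g y u -> related g' y u' -> u = u').
  { intros y u u' Hy HRy Hu Hu'; apply NNPP; intros Huu.
    apply (Hmin y); [|exact HRy]; apply Hs; split; [exact Hy|].
    exists u, u'; split; [exists g|split; [exists g'|]]; auto. }
  assert (t = t') as <-.
  { apply ext; intros u; rewrite Ht, Ht'; split; intros (y & Hy & HRy & Hu);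
      exists y; (split; [exact Hy|split; [exact HRy|]]).
    - destruct (Ht1' y Hy HRy) as [u' Hu']; rewrite (E _ _ _ Hy HRy Hu Hu'); auto.
    - destruct (Ht1 y Hy HRy) as [u' Hu']; rewrite <- (E _ _ _ Hy HRy Hu' Hu); auto. }
  eapply Gf; eassumption.
Qed.

Lemma recursive_value_equation z v :
  recursive_value K R G z v ->
  exists s, (forall u, u ∈ s <-> exists y, y ∈ K /\ R y z /\ recursive_value K R G y u) /\
    G z s v.
Proof.
  intros (g & Hg & Hz); destruct (Hg z v Hz) as (HzK & s & Hs & Ht & HGz).
  exists s; split; [|exact HGz]; intros u; rewrite Hs.
  split; intros (y & Hy & HRy & Hu); exists y; (split; [exact Hy|split; [exact HRy|]]).
  - exists g; auto.
  - destruct (Ht y Hy HRy) as [u' Hu'].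
    rewrite (recursive_value_unique y u u'); auto; exists g; auto.
Qed.

(** At an R-minimal point m without value, the values at the predecessors form a set t
    by replacement, and adding the pair (m, v) with G m t v to the function collecting
    all values yields an attempt defined at m. *)
Lemma recursive_value_exists z : z ∈ K -> exists v, recursive_value K R G z v.
Proof.
  intros HzK; apply NNPP; intros Hn.
  destruct (separation (fun z => ~ exists v, recursive_value K R G z v) K) as [s Hs].
  destruct (Hwf s) as (m & Hm & Hmin).
  { intros x Hx; apply Hs, Hx. }
  { exists z; apply Hs; auto. }
  apply Hs in Hm as [HmK Hm].
  assert (Hex : forall y, y ∈ K -> R y m -> exists u, recursive_value K R G y u).
  { intros y Hy HRy; apply NNPP; intros H; apply (Hmin y); [apply Hs|]; auto. }
  destruct (replacement (fun y u => R y m /\ recursive_value K R G y u) K) as [t Ht].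
  { intros x u u' _ [_ Hu] [_ Hu']; eapply recursive_value_unique; eassumption. }
  destruct (Gt m t HmK) as [v Hv].
  destruct (related_graph
    (fun y u => recursive_value K R G y u \/ y = m /\ u = v) K) as (g & _ & Hg).
  { intros x u u' _ [Hu|[-> ->]] [Hu'|[E ->]]; subst.
    - eapply recursive_value_unique; eassumption.
    - destruct Hm; eauto.
    - destruct Hm; eauto.
    - reflexivity. }
  apply Hm; exists v, g; split; [|apply Hg; auto].
  intros y u Hyu; apply Hg in Hyu as [Hy [Hu|[-> ->]]]; (split; [exact Hy|]).
  - destruct Hu as (g0 & Hg0 & Hu).
    destruct (Hg0 y u Hu) as (_ & s0 & Hs0 & Ht0 & HG0).
    exists s0; split; [|split; [|exact HG0]].
    + intros w; rewrite Hs0; split; intros (y' & Hy' & HRy' & Hw); exists y';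
        (split; [exact Hy'|split; [exact HRy'|]]).
      * apply Hg; split; [exact Hy'|]; left; exists g0; auto.
      * destruct (Ht0 y' Hy' HRy') as [w' Hw'].
        apply Hg in Hw as [_ [Hw|[-> ->]]].
        -- rewrite (recursive_value_unique y' w w'); auto; exists g0; auto.
        -- destruct Hm; exists w', g0; auto.
    + intros y' Hy' HRy'; destruct (Ht0 y' Hy' HRy') as [w' Hw']; exists w'.
      apply Hg; split; [exact Hy'|]; left; exists g0; auto.
  - exists t; split; [|split; [|exact Hv]].
    + intros w; rewrite Ht; split; intros (y' & Hy' & HRy' & Hw); exists y';
        (split; [exact Hy'|]).
      * split; [exact HRy'|]; apply Hg; auto.
      * apply Hg in Hw as [_ [Hw|[-> ->]]]; [auto|].
        destruct (Hex m Hy' HRy') as [u Hu]; destruct Hm; eauto.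
    + intros y' Hy' HRy'; destruct (Hex y' Hy' HRy') as [u Hu]; exists u.
      apply Hg; auto.
Qed.

Theorem recursion :
  exists r : V -> V -> Prop, Definable2 any r /\
    (forall z v, r z v -> z ∈ K) /\
    (forall z v v', r z v -> r z v' -> v = v') /\
    (forall z, z ∈ K -> exists v, r z v) /\
    forall z v, r z v -> exists s,
      (forall u, u ∈ s <-> exists y, y ∈ K /\ R y z /\ r y u) /\ G z s v.
Proof.
  exists (recursive_value K R G); split; [exact _|].
  split; [exact recursive_value_domain|]; split; [exact recursive_value_unique|].
  split; [exact recursive_value_exists|exact recursive_value_equation].
Qed.

End Recursion.

Section Collapse.
Context {V : structure} {HZF : ZF V}.
Context (K : V) (R : V -> V -> Prop) {HR : Definable2 any R} (Hwf : well_founded_on K R).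

#[export] Instance collapse_definable : Definable2 any (collapse K R).
Proof. unfold collapse, recursive_value, attempt; definability. Qed.

Lemma collapse_domain z v : collapse K R z v -> z ∈ K.
Proof. apply recursive_value_domain. Qed.

Lemma collapse_unique z v v' : collapse K R z v -> collapse K R z v' -> v = v'.
Proof.
  apply (recursive_value_unique K R (fun _ s v => v = s)); auto; intros; congruence.
Qed.

Lemma collapse_exists z : z ∈ K -> exists v, collapse K R z v.
Proof.
  apply (recursive_value_exists K R (fun _ s v => v = s)); auto.
  - intros; congruence.
  - intros; eauto.
Qed.

Lemma collapse_mem z v u :
  collapse K R z v -> (u ∈ v <-> exists y, y ∈ K /\ R y z /\ collapse K R y u).
Proof.
  intros H; destruct (recursive_value_equation K R (fun _ s v => v = s)
    Hwf ltac:(intros; congruence) _ _ H) as (s & Hs & ->).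
  apply Hs.
Qed.

Context (Htrans : forall x y z, x ∈ K -> y ∈ K -> z ∈ K -> R x y -> R y z -> R x z).

(** Transitivity of R makes each value a transitive set, and elements of values are
    values. *)
Lemma collapse_ordinal z v : collapse K R z v -> ordinal v.
Proof.
  assert (T : forall z v, collapse K R z v -> transitive v).
  { clear z v; intros z v Hv u Hu w Hw.
    pose proof (collapse_domain _ _ Hv) as Hz.
    apply (collapse_mem _ _ _ Hv) in Hu as (y & Hy & HRy & Hu).
    apply (collapse_mem _ _ _ Hu) in Hw as (x & Hx & HRx & Hw).
    apply (collapse_mem _ _ _ Hv); exists x; split; [|split]; eauto. }
  intros Hv; split; [eauto|].
  intros u Hu; apply (collapse_mem _ _ _ Hv) in Hu as (y & Hy & HRy & Hu); eauto.
Qed.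

Lemma collapse_strict x y u v :
  R x y -> collapse K R x u -> collapse K R y v -> u ∈ v.
Proof.
  intros H Hu Hv; apply (collapse_mem _ _ _ Hv); exists x; split; [|auto].
  eapply collapse_domain; eassumption.
Qed.

End Collapse.

#[export] Instance is_ordinal_definable {V : structure} C :
  Definable1 C (@is_ordinal V).
Proof. unfold is_ordinal, well_orders; definability. Qed.
#[export] Instance is_rank_initial_segment_definable {V : structure} C :
  Definable2 C (@is_rank_initial_segment V).
Proof. unfold is_rank_initial_segment; definability. Qed.

(** * Natural numbers *)

Section Naturals.
Context {V : structure} {HZF : ZF V}.
Implicit Types a b c d f g h i k n p s t u v w x y z : V.

Lemma empty_unique a b : ~ nonempty a -> ~ nonempty b -> a = b.
Proof.
  intros Ha Hb; apply ext; intros x; split; intros Hx;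
    [destruct Ha|destruct Hb]; exists x; exact Hx.
Qed.

Lemma succ_unique a b c : is_succ a b -> is_succ a c -> b = c.
Proof. intros H H'; apply ext; intros x; rewrite (H x), (H' x); tauto. Qed.

Lemma succ_injective a b c : is_succ a c -> is_succ b c -> a = b.
Proof.
  intros Ha Hb.
  assert (H : a ∈ b \/ a = b) by (apply Hb, Ha; auto).
  assert (H' : b ∈ a \/ b = a) by (apply Ha, Hb; auto).
  destruct H as [H|H], H' as [H'|H']; auto.
  destruct (not_mem_cycle a b H H').
Qed.

Lemma natural_zero a : ~ nonempty a -> is_natural a.
Proof.
  intros Ha w [(z & Hz & Hz') _]; rewrite (empty_unique a z Ha Hz'); exact Hz.
Qed.

Lemma natural_succ a b : is_natural a -> is_succ a b -> is_natural b.
Proof. intros Ha Hb w Hw; apply (proj2 Hw a b (Ha w Hw) Hb). Qed.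

Lemma omega_exists : exists w, is_omega w.
Proof.
  destruct (zf_infinity V HZF) as [w Hw].
  destruct (separation is_natural w) as [o Ho].
  exists o; intros i; rewrite Ho; split; [tauto|]; intros Hi; auto.
Qed.

Lemma natural_induction (P : V -> Prop) {HP : Definable1 any P} :
  (forall a, ~ nonempty a -> P a) ->
  (forall a b, is_natural a -> P a -> is_succ a b -> P b) ->
  forall a, is_natural a -> P a.
Proof.
  intros H0 HS a Ha; destruct omega_exists as [w Hw].
  destruct (separation P w) as [s Hs].
  apply (Hs a), Ha; split.
  - destruct (zf_infinity V HZF) as [o [(z & _ & Hz) _]].
    exists z; split; [|exact Hz]; apply Hs; split; [apply Hw, natural_zero|]; auto.
  - intros b c Hb Hc; apply Hs in Hb as [Hb Pb]; apply Hw in Hb.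
    apply Hs; split; [apply Hw; eapply natural_succ|]; eauto.
Qed.

Lemma natural_mem a : is_natural a -> forall b, b ∈ a -> is_natural b.
Proof.
  revert a; apply (natural_induction (fun a => forall b, b ∈ a -> is_natural b)).
  - intros a Ha b Hb; destruct Ha; exists b; exact Hb.
  - intros a b Ha IH Hb c Hc; apply Hb in Hc as [Hc| ->]; auto.
Qed.

Lemma omega_ordinal w : is_omega w -> ordinal w.
Proof.
  intros Hw.
  assert (H : forall a, is_natural a -> ordinal a).
  { apply (natural_induction ordinal).
    - intros a Ha; split; intros x Hx; destruct Ha; exists x; exact Hx.
    - intros a b _ Ha Hb; eapply ordinal_succ; eassumption. }
  split.
  - intros a Ha b Hb; apply Hw; apply Hw in Ha; eapply natural_mem; eassumption.
  - intros a Ha; apply Hw in Ha; exact (proj1 (H a Ha)).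
Qed.

Lemma natural_ordinal a : is_natural a -> ordinal a.
Proof.
  destruct omega_exists as [w Hw]; intros Ha.
  eapply ordinal_mem; [apply omega_ordinal, Hw|]; apply Hw, Ha.
Qed.

Lemma numeral_exists (n : nat) : exists x, is_numeral n x.
Proof.
  induction n as [|n [x Hx]]; simpl.
  - destruct (zf_infinity V HZF) as [o [(z & _ & Hz) _]]; exists z; exact Hz.
  - destruct (succ_exists x) as [y Hy]; eauto.
Qed.

Lemma numeral_unique (n : nat) : forall x y, is_numeral n x -> is_numeral n y -> x = y.
Proof.
  induction n as [|n IH]; intros x y; simpl.
  - apply empty_unique.
  - intros (z & Hz & Hx) (z' & Hz' & Hy); rewrite (IH _ _ Hz Hz') in Hx.
    eapply succ_unique; eassumption.
Qed.

Lemma numeral_injective (m : nat) : forall (n : nat) x, is_numeral m x -> is_numeral n x -> m = n.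
Proof.
  induction m as [|m IH]; intros [|n] x; simpl; auto.
  - intros H (z & _ & Hx); destruct H; exists z; apply Hx; auto.
  - intros (z & _ & Hx) H; destruct H; exists z; apply Hx; auto.
  - intros (z & Hz & Hx) (z' & Hz' & Hx').
    rewrite (succ_injective _ _ _ Hx Hx') in Hz; f_equal; eauto.
Qed.

Lemma numeral_natural (n : nat) : forall x, is_numeral n x -> is_natural x.
Proof.
  induction n as [|n IH]; intros x; simpl.
  - apply natural_zero.
  - intros (z & Hz & Hx); eapply natural_succ; eauto.
Qed.

Lemma mem_well_founded K : well_founded_on K (@mem V).
Proof.
  intros s _ Hs; destruct (minimal_element s Hs) as (m & Hm & Hm').
  exists m; split; [exact Hm|]; intros y Hy Hym; apply (Hm' y Hym Hy).
Qed.

(** Foundation speaks of sets only; induction on membership for definable classes needs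
    a transitive set around x.  It is the union of the recursion on omega which at each
    stage collects the elements of the elements of earlier stages. *)
Lemma transitive_superset x : exists t, transitive t /\ x ∈ t.
Proof.
  destruct omega_exists as [w Hw].
  set (G := fun _ s v : V =>
    forall u, u ∈ v <-> u = x \/ exists y z, y ∈ s /\ z ∈ y /\ u ∈ z).
  assert (HG : Definable3 any G) by (unfold G; definability).
  assert (Gf : forall z s v v', z ∈ w -> G z s v -> G z s v' -> v = v').
  { intros z s v v' _ H H'; apply ext; intros u; rewrite (H u), (H' u); tauto. }
  assert (Gt : forall z s, z ∈ w -> exists v, G z s v).
  { intros n s _; destruct (union_exists s) as [a Ha], (union_exists a) as [b Hb].
    destruct (upair_exists x x) as [c Hc], (union2_exists b c) as [v Hv].
    exists v; intros u; rewrite Hv, Hb, (Hc u); split.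
    - intros [(z & Hz & Hu)|H]; [|tauto]; apply Ha in Hz as (y & Hy & Hz); right; eauto.
    - intros [H|(y & z & Hy & Hz & Hu)]; [tauto|].
      left; exists z; split; [apply Ha|]; eauto. }
  destruct (recursion w mem G (mem_well_founded w) Gf Gt)
    as (r & Dr & _ & Hun & Hval & Heq).
  destruct (replacement r w) as [s Hs]; [eauto|].
  destruct (union_exists s) as [t Ht]; exists t; split.
  - intros y Hy z Hz; apply Ht in Hy as (v & Hv & Hy).
    apply Hs in Hv as (n & Hn & Hv).
    destruct (succ_exists n) as [n' Hn'].
    assert (Hn'w : n' ∈ w) by (apply Hw; apply Hw in Hn; eapply natural_succ; eauto).
    destruct (Hval n' Hn'w) as [v' Hv']; apply Ht; exists v'.
    split; [apply Hs; eauto|].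
    destruct (Heq _ _ Hv') as (s' & Hs' & HG'); apply HG'; right; exists v, y.
    split; [|auto]; apply Hs'; exists n; split; [exact Hn|]; split; [apply Hn'|]; auto.
  - destruct (numeral_exists 0) as [o Ho].
    assert (Ho' : o ∈ w) by (apply Hw, natural_zero, Ho).
    destruct (Hval o Ho') as [v Hv]; apply Ht; exists v; split; [apply Hs; eauto|].
    destruct (Heq _ _ Hv) as (s' & _ & HG'); apply HG'; auto.
Qed.

End Naturals.

(** * The cumulative hierarchy *)

Section Ranks.
Context {V : structure} {HZF : ZF V}.
Implicit Types a b c d f g h i k n p s t u v w x y z : V.

Local Notation level := is_rank_initial_segment.

Lemma level_ordinal a v : level a v -> ordinal a.
Proof.
  intros (h & d & r & Hd & Ha & _); apply is_ordinal_iff in Hd.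
  eapply ordinal_mem; eassumption.
Qed.

(** The function h that witnesses a level witnesses all lower levels too, so facts on
    levels can be read off from one recursion. *)
Lemma level_lower a v :
  level a v ->
  exists h, related h a v /\
    (forall b y, b ∈ a \/ b = a -> related h b y -> level b y) /\
    (forall b, b ∈ a -> exists y, related h b y) /\
    (forall b y, related h b y -> forall x, x ∈ y <->
      exists c w, c ∈ b /\ related h c w /\ subset x w).
Proof.
  intros (h & d & r & Hd & Ha & Hh & Hav & Hrec); pose proof Hd as Od.
  apply is_ordinal_iff in Od; exists h; split; [exact Hav|split; [|split; [|exact Hrec]]].
  - intros b y Hb Hby; exists h, d, r; split; [exact Hd|]; split; [|auto].
    destruct Hb as [Hb| ->]; [eapply ordinal_trans; eassumption|exact Ha].
  - intros b Hb; destruct (function_total _ _ _ b Hh) as (y & _ & Hy); eauto.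
    eapply ordinal_trans; eassumption.
Qed.

Lemma level_unique a v v' : level a v -> level a v' -> v = v'.
Proof.
  intros H H'.
  destruct (level_lower a v H) as (h & Hav & _ & Ht & Hr).
  destruct (level_lower a v' H') as (h' & Hav' & _ & Ht' & Hr').
  pose proof (level_ordinal _ _ H) as Oa.
  destruct (succ_exists a) as [a' Ha'].
  apply NNPP; intros Hn.
  destruct (separation (fun b => exists y y', related h b y /\ related h' b y' /\ y <> y') a')
    as [s Hs].
  destruct (minimal_element s) as (b & Hb & Hmin).
  { exists a; apply Hs; split; [apply Ha'; auto|]; eauto. }
  apply Hs in Hb as (Hb & y & y' & Hy & Hy' & Hyy); apply Hyy.
  assert (Hba : forall c, c ∈ b -> c ∈ a).
  { intros c Hc; apply Ha' in Hb as [Hb| ->]; [eapply ordinal_trans; eassumption|exact Hc]. }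
  assert (E : forall c u u', c ∈ b -> related h c u -> related h' c u' -> u = u').
  { intros c u u' Hc Hu Hu'; apply NNPP; intros Huu.
    apply (Hmin c Hc), Hs; split; [apply Ha'; auto|]; eauto. }
  apply ext; intros x; rewrite (Hr b y Hy), (Hr' b y' Hy').
  split; intros (c & w & Hc & Hw & Hx).
  - destruct (Ht' c (Hba c Hc)) as [w' Hw'].
    rewrite (E c w w' Hc Hw Hw') in Hx; exists c, w'; auto.
  - destruct (Ht c (Hba c Hc)) as [w' Hw'].
    rewrite <- (E c w' w Hc Hw' Hw) in Hx; exists c, w'; auto.
Qed.

Lemma level_mem a v :
  level a v -> forall x, x ∈ v <-> exists b w, b ∈ a /\ level b w /\ subset x w.
Proof.
  intros H x; destruct (level_lower a v H) as (h & Hav & Hl & Ht & Hr).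
  rewrite (Hr a v Hav); split; intros (b & w & Hb & Hw & Hx); exists b.
  - exists w; split; [|split]; auto.
  - destruct (Ht b Hb) as [w' Hw']; exists w'; split; [|split]; auto.
    rewrite (level_unique b w' w); auto.
Qed.

Lemma level_exists a : ordinal a -> exists v, level a v.
Proof.
  intros Oa; destruct (succ_exists a) as [d Hd].
  pose proof (ordinal_succ _ _ Oa Hd) as Od.
  set (G := fun _ s v : V => forall x, x ∈ v <-> exists w, w ∈ s /\ subset x w).
  assert (HG : Definable3 any G) by (unfold G; definability).
  assert (Gf : forall z s v v', z ∈ d -> G z s v -> G z s v' -> v = v').
  { intros z s v v' _ H H'; apply ext; intros u; rewrite (H u), (H' u); tauto. }
  assert (Gt : forall z s, z ∈ d -> exists v, G z s v).
  { intros n s _.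
    destruct (replacement (fun w p => forall x, x ∈ p <-> subset x w) s) as [t Ht].
    { intros w p p' _ Hp Hp'; apply ext; intros x; rewrite Hp, Hp'; tauto. }
    destruct (union_exists t) as [v Hv]; exists v; intros x; rewrite Hv; split.
    - intros (p & Hp & Hx); apply Ht in Hp as (w & Hw & Hp).
      exists w; split; [exact Hw|]; apply Hp, Hx.
    - intros (w & Hw & Hx); destruct (power_exists w) as [p Hp].
      exists p; split; [apply Ht; eauto|]; apply Hp, Hx. }
  destruct (recursion d mem G (mem_well_founded d) Gf Gt)
    as (rec & Drec & _ & Hun & Hval & Heq).
  destruct (replacement rec d) as [r Hr]; [eauto|].
  destruct (function_exists rec d r) as (h & Hh & Hrel); [eauto| |].
  { intros n Hn; destruct (Hval n Hn) as [v Hv]; exists v; split; [apply Hr|]; eauto. }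
  assert (Had : a ∈ d) by (apply Hd; auto).
  destruct (Hval a Had) as [v Hv]; exists v, h, d, r.
  split; [apply is_ordinal_iff, Od|]; split; [exact Had|]; split; [exact Hh|].
  split; [apply Hrel; auto|].
  intros b y Hby x; apply Hrel in Hby as [Hb Hy].
  destruct (Heq b y Hy) as (s & Hs & HGs); rewrite (HGs x); split.
  - intros (w & Hw & Hx); apply Hs in Hw as (c & Hc & Hcb & Hw).
    exists c, w; split; [exact Hcb|]; split; [apply Hrel|]; auto.
  - intros (c & w & Hc & Hw & Hx); apply Hrel in Hw as [Hcd Hw].
    exists w; split; [apply Hs; exists c|]; auto.
Qed.

Lemma level_transitive a v : level a v -> transitive v.
Proof.
  intros H x Hx y Hy; apply (level_mem a v H) in Hx as (b & w & Hb & Hw & Hx).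
  apply Hx in Hy; apply (level_mem b w Hw) in Hy as (c & u & Hc & Hu & Hy).
  apply (level_mem a v H); exists c, u; split; [|auto].
  eapply ordinal_trans; [eapply level_ordinal|..]; eassumption.
Qed.

Lemma level_monotone a b v w : level a v -> level b w -> subset a b -> subset v w.
Proof.
  intros H H' Hab x Hx; apply (level_mem a v H) in Hx as (c & u & Hc & Hu & Hx).
  apply (level_mem b w H'); exists c, u; auto.
Qed.

Definition in_level a x : Prop := exists v, level a v /\ x ∈ v.

#[export] Instance in_level_definable C : Definable2 C in_level.
Proof. unfold in_level; definability. Qed.

Lemma in_level_monotone a b x :
  ordinal b -> subset a b -> in_level a x -> in_level b x.
Proof.
  intros Ob Hab (v & Hv & Hx); destruct (level_exists b Ob) as [w Hw].
  exists w; split; [exact Hw|]; apply (level_monotone a b v w); auto.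
Qed.

(** In a transitive set around x, a membership-minimal set outside the hierarchy would
    have all its elements in the hierarchy, hence, by collection, in a single level. *)
Lemma every_set_in_level x : exists a, ordinal a /\ in_level a x.
Proof.
  destruct (transitive_superset x) as (t & Ht & Hx).
  apply NNPP; intros Hn.
  destruct (separation (fun y => ~ exists a, ordinal a /\ in_level a y) t) as [s Hs].
  destruct (minimal_element s) as (m & Hm & Hmin); [exists x; apply Hs; auto|].
  apply Hs in Hm as [Hm Hm']; apply Hm'.
  destruct (ordinal_collection (fun y a => in_level a y) m) as (c & Oc & Hc).
  { intros y Hy; apply NNPP; intros H; apply (Hmin y Hy), Hs; split; [|exact H].
    apply (Ht m Hm y Hy). }
  destruct (level_exists c Oc) as [v Hv], (succ_exists c) as [d Hd].
  pose proof (ordinal_succ _ _ Oc Hd) as Od.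
  destruct (level_exists d Od) as [w Hw].
  exists d; split; [exact Od|]; exists w; split; [exact Hw|].
  apply (level_mem d w Hw); exists c, v; split; [apply Hd; auto|]; split; [exact Hv|].
  intros y Hy; destruct (Hc y Hy) as (b & Hb & Ob & Hby).
  destruct (in_level_monotone b c y Oc) as (v' & Hv' & Hy'); auto.
  - exact (proj1 Oc b Hb).
  - rewrite (level_unique c v v' Hv Hv'); exact Hy'.
Qed.

Lemma in_level_self a b v : ordinal a -> b ∈ a -> level a v -> b ∈ v.
Proof.
  intros Oa Hb Hv.
  assert (H : forall c, ordinal c -> forall w, level c w -> subset c w).
  { clear dependent a; clear b v; intros c Oc; apply NNPP; intros Hn.
    destruct (least_ordinal (fun c => ~ forall w, level c w -> subset c w))
      as (d & Od & Hd & Hmin); [eauto|].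
    apply Hd; intros w Hw x Hx.
    destruct (level_exists x (ordinal_mem _ _ Od Hx)) as [u Hu].
    apply (level_mem d w Hw); exists x, u; split; [exact Hx|]; split; [exact Hu|].
    apply NNPP; intros H; apply (Hmin x Hx); auto. }
  apply (H a Oa v Hv), Hb.
Qed.

End Ranks.

(** * The reflection theorem *)

Section Reflection.
Context {V : structure} {HZF : ZF V}.

Local Notation level := is_rank_initial_segment.

Fixpoint prepend (n : nat) (f e : nat -> V) : nat -> V :=
  match n with O => e | S m => prepend m f (scons (f m) e) end.

Lemma prepend_high n : forall f e i, prepend n f e (n + i) = e i.
Proof.
  induction n as [|n IH]; intros f e i; [reflexivity|].
  cbn [prepend]; change (S n + i) with (S (n + i)); rewrite <- Nat.add_succ_r.
  apply (IH f (scons (f n) e) (S i)).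
Qed.

Lemma prepend_low n : forall f e i, i < n -> prepend n f e i = f i.
Proof.
  induction n as [|n IH]; intros f e i Hi; [lia|]; cbn [prepend].
  destruct (Nat.eq_dec i n) as [->|Hn]; [|apply IH; lia].
  pose proof (prepend_high n f (scons (f n) e) 0) as H.
  rewrite Nat.add_0_r in H; exact H.
Qed.

Lemma holds_finite_support (p : formula) :
  exists n, forall e e' : nat -> V,
    (forall i, i < n -> e i = e' i) -> (holds e p <-> holds e' p).
Proof.
  induction p as [m n|m n|q [n IH]|q [n IH] q' [n' IH']|q [n IH]].
  - exists (S (m + n)); intros e e' H; simpl; rewrite !H by lia; tauto.
  - exists (S (m + n)); intros e e' H; simpl; rewrite !H by lia; tauto.
  - exists n; intros e e' H; simpl; rewrite (IH e e' H); tauto.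
  - exists (n + n'); intros e e' H; simpl.
    rewrite (IH e e'), (IH' e e'); [tauto| |]; intros i Hi; apply H; lia.
  - exists n; intros e e' H; simpl.
    split; intros [a Ha]; exists a; revert Ha; apply IH;
      intros [|i] Hi; simpl; rewrite ?H by lia; reflexivity.
Qed.

(** Environments are functions on the natural numbers of the metatheory, so quantifying
    over all environments with values in a set is not first-order.  A formula depends on
    finitely many variables only, and this block of quantifiers, bounded by the value of
    variable k, does the same within a formula. *)
Fixpoint forall_bounded (n k : nat) (q : formula) : formula :=
  match n with
  | O => q
  | S m => FNot (FEx (FAnd (FMem 0 (S k)) (FNot (forall_bounded m (S k) q))))
  end.

Lemma holds_forall_bounded n : forall k q (e : nat -> V),
  holds e (forall_bounded n k q) <->
  forall f, (forall i, i < n -> f i ∈ e k) -> holds (prepend n f e) q.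
Proof.
  induction n as [|n IH]; intros k q e.
  - simpl; split; [auto|]; intros H; apply (H e); lia.
  - cbn [forall_bounded holds]; split.
    + intros H f Hf; simpl; apply NNPP; intros Hn; apply H; exists (f n); split.
      * simpl; apply Hf; lia.
      * rewrite IH; intros H'; apply Hn, H'; intros i Hi; simpl; apply Hf; lia.
    + intros H [x [Hx Hn]]; apply Hn, IH; intros f Hf.
      specialize (H (fun i => if Nat.eq_dec i n then x else f i)).
      simpl in H, Hx, Hf; destruct (Nat.eq_dec n n) as [_|]; [|lia].
      assert (Hp : forall m g g' (e' : nat -> V), (forall i, i < m -> g i = g' i) ->
        forall i, prepend m g e' i = prepend m g' e' i).
      { induction m as [|m IHm]; intros g g' e' Hg i; simpl; [reflexivity|].
        rewrite (Hg m) by lia; apply IHm; intros j Hj; apply Hg; lia. }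
      rewrite (holds_ext q _ (prepend n (fun i => if Nat.eq_dec i n then x else f i)
        (scons x e))).
      * apply H; intros i Hi; destruct (Nat.eq_dec i n); [exact Hx|apply Hf; lia].
      * apply Hp; intros i Hi; destruct (Nat.eq_dec i n); [lia|reflexivity].
Qed.

(** Collection for tuples, one variable at a time.  The substitution w marks by inl the
    places of the environment where the bound b is plugged in; monotonicity in b lets the
    bounds found for the different values of a variable be replaced by a common one. *)
Lemma forall_bounded_collection n :
  forall k q v (w : nat -> nat + V),
    w k = inr v ->
    (forall b b', ordinal b -> ordinal b' -> subset b b' -> forall f,
       (forall i, i < n -> f i ∈ v) ->
       holds (prepend n f (fun i => value (fun _ => b) (w i))) q ->
       holds (prepend n f (fun i => value (fun _ => b') (w i))) q) ->
    (forall f, (forall i, i < n -> f i ∈ v) -> exists b, ordinal b /\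
       holds (prepend n f (fun i => value (fun _ => b) (w i))) q) ->
    exists b, ordinal b /\
      holds (fun i => value (fun _ => b) (w i)) (forall_bounded n k q).
Proof.
  induction n as [|n IH]; intros k q v w Hk Hm He.
  - destruct (He (fun _ => v)) as (b & Ob & Hb); [lia|eauto].
  - set (P := fun x b => holds (fun i => value (fun _ => b)
        (match i with O => inr x | S i => w i end)) (forall_bounded n (S k) q)).
    assert (HP : Definable2 any P).
    { intros s t [s' [_ Hs]] [t' [_ Ht]].
      exists (forall_bounded n (S k) q),
        (fun i => match i with O => s' | S i =>
           match w i with inl _ => t' | x => x end end); split; [exact (fun _ _ _ => I)|].
      intros e; apply holds_ext; intros [|i]; simpl; [auto|].
      destruct (w i); simpl; auto. }
    assert (E : forall (f : nat -> V) (x : V),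
      (forall i, i < n -> f i ∈ v) -> x ∈ v ->
      exists f', (forall i, i < S n -> f' i ∈ v) /\ forall (b : V) r,
       (holds (prepend n f (fun i => value (fun _ => b)
         (match i with O => inr x | S i => w i end))) r <->
       holds (prepend (S n) f' (fun i => value (fun _ => b) (w i))) r)).
    { intros f x Hf Hx; exists (fun i => if Nat.eq_dec i n then x else f i); split.
      - intros i Hi; destruct (Nat.eq_dec i n); [exact Hx|apply Hf; lia].
      - intros b' r; apply holds_ext; intros i.
        destruct (le_lt_dec n i) as [Hi|Hi].
        + destruct (Nat.eq_dec i n) as [->|Hin].
          * transitivity x.
            -- pose proof (prepend_high n f (fun i => value (fun _ => b')
                 (match i with O => inr x | S i => w i end)) 0) as H.
               rewrite Nat.add_0_r in H; exact H.
            -- symmetry; rewrite prepend_low by lia.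
               destruct (Nat.eq_dec n n); [reflexivity|lia].
          * assert (E1 : n + S (i - S n) = i) by lia.
            assert (E2 : S n + (i - S n) = i) by lia.
            transitivity (value (fun _ : nat => b') (w (i - S n))).
            -- pose proof (prepend_high n f (fun i => value (fun _ => b')
                 (match i with O => inr x | S i => w i end)) (S (i - S n))) as H.
               rewrite E1 in H; exact H.
            -- symmetry.
               pose proof (prepend_high (S n) (fun i => if Nat.eq_dec i n then x else f i)
                 (fun i => value (fun _ => b') (w i)) (i - S n)) as H.
               rewrite E2 in H; exact H.
        + rewrite !prepend_low by lia; destruct (Nat.eq_dec i n); [lia|reflexivity]. }
    assert (Pm : forall x b b', x ∈ v -> ordinal b -> ordinal b' -> subset b b' ->
      P x b -> P x b').
    { intros x b b' Hx Ob Ob' Hb; unfold P; rewrite !holds_forall_bounded.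
      rewrite Hk; simpl value; intros H f Hf.
      destruct (E f x Hf Hx) as (f' & Hf' & Hff).
      apply Hff, (Hm b b' Ob Ob' Hb f' Hf'), Hff, H, Hf. }
    destruct (ordinal_collection P v) as (c & Oc & Hc).
    + intros x Hx.
      apply (IH (S k) q v (fun i => match i with O => inr x | S i => w i end) Hk).
      * intros b b' Ob Ob' Hb f Hf Hh.
        destruct (E f x Hf Hx) as (f' & Hf' & Hff).
        apply Hff, (Hm b b' Ob Ob' Hb f' Hf'), Hff, Hh.
      * intros f Hf; destruct (E f x Hf Hx) as (f' & Hf' & Hff).
        destruct (He f' Hf') as (b & Ob & Hb); exists b; split; [exact Ob|].
        apply Hff, Hb.
    + exists c; split; [exact Oc|]; cbn [forall_bounded holds].
      intros [x [Hx Hn]]; apply Hn; simpl in Hx; rewrite Hk in Hx; simpl in Hx.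
      destruct (Hc x Hx) as (b & Hb & Ob & HPb).
      assert (HPc : P x c) by (apply (Pm x b c Hx Ob Oc); [exact (proj1 Oc b Hb)|exact HPb]).
      revert HPc; apply holds_ext; intros [|i]; reflexivity.
Qed.

(** The Tarski-Vaught criterion for one existential quantifier. *)
Definition witness_closed (A : V) (p : formula) : Prop :=
  forall e : nat -> V, (forall n, e n ∈ A) ->
    (exists a, holds (scons a e) p) -> exists a, a ∈ A /\ holds (scons a e) p.

Definition witnessed (p : formula) (a b : V) : Prop :=
  forall v, level a v -> forall e : nat -> V, (forall n, e n ∈ v) ->
    (exists x, holds (scons x e) p) -> exists x, in_level b x /\ holds (scons x e) p.

Lemma witnessed_formula p :
  exists n q,
    (forall (f e : nat -> V), holds (prepend n f e) q <->
      ((exists x, holds (scons x f) p) ->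
       exists x, in_level (e 1) x /\ holds (scons x f) p)).
Proof.
  destruct (holds_finite_support p) as [n Hn].
  assert (D : @definable V none (fun e => (exists x, holds (scons x e) p) ->
    exists x, in_level (e (n + 1)) x /\ holds (scons x e) p)).
  { apply definable_imp; [apply (definable_holds (FEx p))|].
    apply (definable_ex none (fun e x => in_level (e (n + 1)) x /\ holds (scons x e) p)).
    apply definable_and; [definability|].
    apply definable_iff_pred with (fun e => holds e p); [|apply definable_holds].
    intros e; apply holds_ext; intros [|i]; reflexivity. }
  apply lightface in D as [q Hq]; exists n, q; intros f e.
  rewrite <- Hq, prepend_high.
  assert (E : forall x, holds (scons x (prepend n f e)) p <-> holds (scons x f) p).
  { intros x; apply Hn; intros [|i] Hi; simpl; [reflexivity|].
    apply prepend_low; lia. }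
  split; intros H [x Hx].
  - destruct H as (y & Hy & Hy'); [exists x; apply E, Hx|].
    exists y; split; [exact Hy|]; apply E, Hy'.
  - destruct H as (y & Hy & Hy'); [exists x; apply E, Hx|].
    exists y; split; [exact Hy|]; apply E, Hy'.
Qed.

(** The quantification over environments becomes a formula.  The nonemptiness guard
    matters when p has no free variable besides the witness: there is no environment
    with values in an empty level. *)
Lemma witnessed_iff p :
  exists n q, (forall a b, witnessed p a b <-> forall v, level a v -> nonempty v ->
    holds (scons v (scons b (fun _ => v))) (forall_bounded n 0 q)) /\
    (forall (f e : nat -> V), holds (prepend n f e) q <->
      ((exists x, holds (scons x f) p) ->
       exists x, in_level (e 1) x /\ holds (scons x f) p)).
Proof.
  destruct (witnessed_formula p) as (n & q & Hq); exists n, q; split; [|exact Hq].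
  intros a b; split; intros H v Hv.
  - intros [x0 Hx0]; apply holds_forall_bounded; intros f Hf; apply Hq; simpl.
    intros [x Hx].
    (* f is constrained below n only; beyond, any element of v will do *)
    set (f' := fun i => if le_lt_dec n i then x0 else f i).
    assert (Hf' : holds (prepend n f' (scons v (scons b (fun _ => v)))) q).
    { apply Hq; apply (H v Hv).
      intros i; unfold f'; destruct (le_lt_dec n i); [exact Hx0|apply Hf; assumption]. }
    assert (E : holds (prepend n f (scons v (scons b (fun _ => v)))) q).
    { revert Hf'; apply holds_ext; intros i; destruct (le_lt_dec n i) as [Hi|Hi].
      - replace i with (n + (i - n)) by lia; rewrite !prepend_high; reflexivity.
      - rewrite !prepend_low by assumption; unfold f'.
        destruct (le_lt_dec n i); [lia|reflexivity]. }
    exact (proj1 (Hq _ _) E (ex_intro _ x Hx)).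
  - intros e He.
    assert (Hn : nonempty v) by (exists (e 0); apply He).
    specialize (H v Hv Hn); rewrite holds_forall_bounded in H.
    exact (proj1 (Hq e _) (H e (fun i _ => He i))).
Qed.

#[export] Instance witnessed_definable p : Definable2 any (witnessed p).
Proof.
  destruct (witnessed_iff p) as (n & q & Hw & _).
  set (phi := fun v b : V =>
    holds (scons v (scons b (fun _ => v))) (forall_bounded n 0 q)) in Hw.
  assert (D : Definable2 any phi).
  { intros s t [s' [_ Hs]] [t' [_ Ht]].
    exists (forall_bounded n 0 q),
      (fun i => match i with O => s' | 1 => t' | _ => s' end); split; [exact (fun _ _ _ => I)|].
    intros e; apply holds_ext; intros [|[|i]]; simpl; auto. }
  intros s t Hs Ht.
  apply definable_iff_pred with (fun e => forall v, level (s e) v -> nonempty v ->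
    phi v (t e)); [intros e; symmetry; apply Hw|definability].
Qed.

Lemma witnessed_monotone p a b b' :
  ordinal b' -> subset b b' -> witnessed p a b -> witnessed p a b'.
Proof.
  intros Ob' Hb H v Hv e He Hx; destruct (H v Hv e He Hx) as (x & Hx1 & Hx2).
  exists x; split; [|exact Hx2]; eapply in_level_monotone; eassumption.
Qed.

Lemma witnessed_exists p a : ordinal a -> exists b, ordinal b /\ witnessed p a b.
Proof.
  intros Oa; destruct (level_exists a Oa) as [v Hv].
  destruct (witnessed_iff p) as (n & q & Hw & Hq).
  destruct (forall_bounded_collection n 0 q v
    (fun i => match i with O => inr v | 1 => inl 0 | _ => inr v end) eq_refl)
    as (b & Ob & Hb).
  - intros b b' Ob Ob' Hb f Hf H; apply Hq; intros Hx.
    pose proof (proj1 (Hq _ _) H) as H1; clear H; rename H1 into H.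
    destruct (H Hx) as (x & Hx1 & Hx2); exists x; split; [|exact Hx2].
    simpl in *; eapply in_level_monotone; eassumption.
  - intros f Hf; destruct (classic (exists x, holds (scons x f) p)) as [[x Hx]|Hn].
    + destruct (every_set_in_level x) as (b & Ob & Hb); exists b; split; [exact Ob|].
      apply Hq; intros _; exists x; auto.
    + exists a; split; [exact Oa|]; apply Hq; tauto.
  - exists b; split; [exact Ob|]; apply Hw; intros v' Hv' _.
    rewrite (level_unique a v' v Hv' Hv); revert Hb; apply holds_ext.
    intros [|[|i]]; reflexivity.
Qed.

Lemma witnessed_list_definable (L : list formula) :
  Definable2 any (fun a b : V => forall p, In p L -> witnessed p a b).
Proof.
  intros s t Hs Ht; induction L as [|p L IH].
  - apply definable_iff_pred with (fun _ => True); [simpl; tauto|apply definable_const].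
  - apply definable_iff_pred with (fun e => witnessed p (s e) (t e) /\
      forall p', In p' L -> witnessed p' (s e) (t e)).
    + intros e; simpl; split; [intros [H H'] p' [<-|Hp]; auto|auto].
    + apply definable_and; [apply witnessed_definable; assumption|exact IH].
Qed.

Lemma witnessed_list_exists (L : list formula) a :
  ordinal a -> exists b, ordinal b /\ forall p, In p L -> witnessed p a b.
Proof.
  intros Oa; induction L as [|p L (b & Ob & Hb)].
  - exists a; split; [exact Oa|]; simpl; tauto.
  - destruct (witnessed_exists p a Oa) as (c & Oc & Hc).
    destruct (ordinal_trichotomy b c Ob Oc) as [H|[H|H]].
    + exists c; split; [exact Oc|]; intros p' [<-|Hp]; [exact Hc|].
      apply (witnessed_monotone p' a b c); auto; exact (proj1 Oc b H).
    + subst c; exists b; split; [exact Ob|]; intros p' [<-|Hp]; auto.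
    + exists b; split; [exact Ob|]; intros p' [<-|Hp]; [|auto].
      apply (witnessed_monotone p a c b); auto; exact (proj1 Ob c H).
Qed.

(** Iterate omega times the step from an ordinal c to the least ordinal above it whose
    level contains witnesses for all tuples from level c.  A finite tuple from the level
    of the supremum lies in some stage, and its witness in the next one. *)
Theorem reflection (L : list formula) a :
  ordinal a -> exists b, ordinal b /\ a ∈ b /\
    forall v, level b v -> forall p, In p L -> witness_closed v p.
Proof.
  intros Oa; destruct (@omega_exists V HZF) as [w Hw].
  pose proof (witnessed_list_definable L) as DL.
  set (W := fun a b : V => forall p, In p L -> witnessed p a b) in DL.
  set (P := fun s b : V => a ∈ b /\ forall c, c ∈ s -> ordinal c -> c ∈ b /\ W c b).
  assert (HP : Definable2 any P) by (unfold P; definability).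
  set (G := fun _ s b : V => ordinal b /\ P s b /\ forall b', b' ∈ b -> ~ P s b').
  assert (HG : Definable3 any G) by (unfold G; definability).
  assert (Gf : forall z s v v', z ∈ w -> G z s v -> G z s v' -> v = v').
  { intros z s v v' _ (O1 & P1 & L1) (O2 & P2 & L2).
    apply (least_ordinal_unique (P s)); auto. }
  assert (Gt : forall z s, z ∈ w -> exists v, G z s v).
  { intros n s _.
    destruct (least_ordinal (P s)) as (b & Ob & Pb & Lb); [ |exists b; unfold G; auto].
    destruct (ordinal_collection (fun c b => ordinal c -> c ∈ b /\ W c b) s)
      as (c & Oc & Hc).
    { intros x Hx; destruct (classic (ordinal x)) as [Ox|Nx]; [|exists a; tauto].
      destruct (witnessed_list_exists L x Ox) as (b & Ob & Hb).
      destruct (succ_exists x) as [x' Hx'].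
      pose proof (ordinal_succ _ _ Ox Hx') as Ox'.
      destruct (ordinal_trichotomy b x' Ob Ox') as [H|H].
      - exists x'; split; [exact Ox'|]; intros _; split; [apply Hx'; auto|].
        intros p Hp; apply (witnessed_monotone p x b x'); auto.
        exact (proj1 Ox' b H).
      - exists b; split; [exact Ob|]; intros _; split; [|exact Hb].
        assert (Hxx : x ∈ x') by (apply Hx'; auto).
        destruct H as [->|H]; [exact Hxx|eapply ordinal_trans; eassumption]. }
    assert (Hbig : forall d, ordinal d -> c ∈ d \/ c = d -> a ∈ d -> P s d).
    { intros d Od Hcd Had; split; [exact Had|]; intros x Hx Ox.
      destruct (Hc x Hx) as (b & Hb & Ob & Hxb); destruct (Hxb Ox) as [Hxb1 Hxb2].
      assert (Hbd : b ∈ d)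
        by (destruct Hcd as [H| <-]; [eapply ordinal_trans; eassumption|exact Hb]).
      split; [eapply ordinal_trans; eassumption|].
      intros p Hp; apply (witnessed_monotone p x b d); auto.
      exact (proj1 Od b Hbd). }
    destruct (ordinal_trichotomy a c Oa Oc) as [H|H].
    - exists c; split; [exact Oc|]; apply Hbig; auto.
    - destruct (succ_exists a) as [a' Ha'].
      pose proof (ordinal_succ _ _ Oa Ha') as Oa'.
      exists a'; split; [exact Oa'|]; apply Hbig; [exact Oa'| |apply Ha'; auto].
      left; apply Ha'; destruct H; auto. }
  destruct (recursion w mem G (mem_well_founded w) Gf Gt)
    as (r & Dr & _ & Hun & Hval & Heq).
  assert (Hr : forall m n b c, m ∈ w -> m ∈ n -> r m b -> r n c ->
    b ∈ c /\ W b c).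
  { intros m n b c Hm Hmn Hb Hc.
    destruct (Heq n c Hc) as (s & Hs & _ & (_ & HPs) & _).
    apply HPs; [apply Hs; eauto|]; destruct (Heq m b Hb) as (_ & _ & Ob & _); exact Ob. }
  assert (Hord : forall n b, r n b -> ordinal b)
    by (intros n b Hb; destruct (Heq n b Hb) as (_ & _ & Ob & _); exact Ob).
  assert (Hsucc : forall n, n ∈ w -> exists n', n' ∈ w /\ n ∈ n').
  { intros n Hn; destruct (succ_exists n) as [n' Hn']; exists n'.
    split; [|apply Hn'; auto]; apply Hw; apply Hw in Hn; eapply natural_succ; eauto. }
  destruct (replacement r w) as [s Hs]; [intros; eapply Hun; eassumption|].
  destruct (union_exists s) as [b Hb].
  assert (Ob : ordinal b).
  { apply (ordinal_union s b); [|exact Hb]; intros x Hx.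
    apply Hs in Hx as (n & _ & Hx); eapply Hord; eassumption. }
  exists b; split; [exact Ob|]; split.
  { destruct (numeral_exists 0) as [o Ho].
    assert (Ho' : o ∈ w) by (apply Hw, natural_zero, Ho).
    destruct (Hval o Ho') as [c Hc]; apply Hb; exists c; split; [apply Hs; eauto|].
    destruct (Heq o c Hc) as (_ & _ & _ & (Ha & _) & _); exact Ha. }
  intros v Hv p Hp e He [x Hx].
  destruct (holds_finite_support p) as [n Hn].
  assert (Hlev : forall y, y ∈ v -> exists m c, m ∈ w /\ r m c /\ in_level c y).
  { intros y Hy; apply (level_mem b v Hv) in Hy as (c & u & Hc & Hu & Hy).
    apply Hb in Hc as (d & Hd & Hc); apply Hs in Hd as (m & Hm & Hd).
    exists m, d; split; [exact Hm|]; split; [exact Hd|].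
    destruct (level_exists d (Hord m d Hd)) as [u' Hu']; exists u'.
    split; [exact Hu'|]; apply (level_mem d u' Hu'); eauto. }
  assert (Hfin : forall k : nat, exists m c, m ∈ w /\ r m c /\
    forall i, i < k -> in_level c (e i)).
  { induction k as [|k (m & c & Hm & Hc & IH)].
    - destruct (Hlev (e 0) (He 0)) as (m & c & Hm & Hc & _).
      exists m, c; split; [exact Hm|]; split; [exact Hc|]; lia.
    - destruct (Hlev (e k) (He k)) as (m' & c' & Hm' & Hc' & Hk).
      pose proof (Hord _ _ Hc) as Oc; pose proof (Hord _ _ Hc') as Oc'.
      destruct (ordinal_trichotomy c c' Oc Oc') as [H|H].
      + exists m', c'; split; [exact Hm'|]; split; [exact Hc'|]; intros i Hi.
        destruct (Nat.eq_dec i k) as [->|Hik]; [exact Hk|].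
        apply (in_level_monotone c c'); auto; [exact (proj1 Oc' c H)|apply IH; lia].
      + exists m, c; split; [exact Hm|]; split; [exact Hc|]; intros i Hi.
        destruct (Nat.eq_dec i k) as [->|Hik]; [|apply IH; lia].
        destruct H as [->|H]; [exact Hk|].
        apply (in_level_monotone c' c); auto; exact (proj1 Oc c' H). }
  destruct (Hfin (S n)) as (m & c & Hm & Hc & Hlow).
  destruct (Hsucc m Hm) as (m' & Hm' & Hmm'), (Hval m' Hm') as [c' Hc'].
  destruct (Hr m m' c c' Hm Hmm' Hc Hc') as [_ HW].
  destruct (level_exists c (Hord m c Hc)) as [u Hu].
  (* the finitely many entries that matter are in a common stage; the others are
     replaced by the entry 0 *)
  set (e' := fun i => if le_lt_dec (S n) i then e 0 else e i).
  assert (E : forall y, holds (scons y e) p <-> holds (scons y e') p).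
  { intros y; apply Hn; intros [|i] Hi; simpl; [reflexivity|]; unfold e'.
    destruct (le_lt_dec (S n) i); [lia|reflexivity]. }
  destruct (HW p Hp u Hu e') as (y & (u' & Hu' & Hy) & Hy').
  - intros i; unfold e'; destruct (le_lt_dec (S n) i) as [_|Hi].
    + destruct (Hlow 0) as (u' & Hu' & H0); [lia|].
      rewrite (level_unique c u u' Hu Hu'); exact H0.
    + destruct (Hlow i) as (u' & Hu' & H0); [lia|].
      rewrite (level_unique c u u' Hu Hu'); exact H0.
  - exists x; apply E, Hx.
  - exists y; split; [|apply E, Hy'].
    apply (level_monotone c' b u' v Hu' Hv); [|exact Hy].
    intros z Hz; apply Hb; exists c'; split; [apply Hs; eauto|exact Hz].
Qed.

End Reflection.

(** * Coded formulas and internal satisfaction *)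

Section CodingNotions.
Context {V : structure} (C : V -> Prop).
#[export] Instance numeral_definable n : Definable1 C (is_numeral n).
Proof. induction n; simpl; definability. Qed.
#[export] Instance tagged_definable n : Definable3 C (is_tagged n).
Proof. unfold is_tagged; definability. Qed.
#[export] Instance code_mem_definable : Definable3 C code_mem.
Proof. unfold code_mem; definability. Qed.
#[export] Instance code_eq_definable : Definable3 C code_eq.
Proof. unfold code_eq; definability. Qed.
#[export] Instance code_not_definable : Definable2 C code_not.
Proof. unfold code_not; definability. Qed.
#[export] Instance code_and_definable : Definable3 C code_and.
Proof. unfold code_and; definability. Qed.
#[export] Instance code_ex_definable : Definable3 C code_ex.
Proof. unfold code_ex; definability. Qed.
#[export] Instance is_assignment_definable : Definable2 C is_assignment.
Proof. unfold is_assignment; definability. Qed.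
#[export] Instance is_formula_code_definable : Definable1 C is_formula_code.
Proof. unfold is_formula_code, formula_closed; definability. Qed.
#[export] Instance is_satisfaction_definable : Definable2 C is_satisfaction.
Proof. unfold is_satisfaction; definability. Qed.
#[export] Instance is_elementary_embedding_definable : Definable3 C is_elementary_embedding.
Proof. unfold is_elementary_embedding, is_image_assignment, satisfies; definability. Qed.
#[export] Instance is_critical_point_definable : Definable2 C is_critical_point.
Proof. unfold is_critical_point; definability. Qed.
End CodingNotions.

Section Codes.
Context {V : structure} {HZF : ZF V}.

Lemma tagged_exists n (a b : V) : exists c, is_tagged n a b c.
Proof.
  destruct (numeral_exists n) as [t Ht], (pair_exists a b) as [q Hq].
  destruct (pair_exists t q) as [c Hc]; exists c, t, q; auto.
Qed.

Lemma tagged_unique n (a b c d : V) : is_tagged n a b c -> is_tagged n a b d -> c = d.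
Proof.
  intros (t & q & Ht & Hq & Hc) (t' & q' & Ht' & Hq' & Hd).
  rewrite (numeral_unique n _ _ Ht Ht'), (pair_unique _ _ _ _ Hq Hq') in Hc.
  eapply pair_unique; eassumption.
Qed.

Lemma tagged_injective m n (a b a' b' c : V) :
  is_tagged m a b c -> is_tagged n a' b' c -> m = n /\ a = a' /\ b = b'.
Proof.
  intros (t & q & Ht & Hq & Hc) (t' & q' & Ht' & Hq' & Hd).
  destruct (pair_injective _ _ _ _ _ Hc Hd) as [-> ->].
  destruct (pair_injective _ _ _ _ _ Hq Hq') as [-> ->].
  split; [|auto]; eapply numeral_injective; eassumption.
Qed.

(** A level containing omega and closed under the coding operations contains all codes.
    Reflecting the formulas that define these operations yields such a level, because
    their values are unique. *)
Lemma formula_codes_exist : exists F : V, forall c, c ∈ F <-> is_formula_code c.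
Proof.
  destruct (@omega_exists V HZF) as [w Hw].
  assert (D : forall n, exists p, forall e : nat -> V,
    is_tagged n (e 1) (e 2) (e 0) <-> holds e p).
  { intros n; apply lightface; definability. }
  destruct (D 0) as [p0 H0], (D 1) as [p1 H1], (D 2) as [p2 H2],
    (D 3) as [p3 H3], (D 4) as [p4 H4].
  destruct (reflection (p0 :: p1 :: p2 :: p3 :: p4 :: nil) w (omega_ordinal w Hw))
    as (b & Ob & Hwb & Hr).
  destruct (level_exists b Ob) as [v Hv]; specialize (Hr v Hv).
  assert (Hnat : forall i, is_natural i -> i ∈ v).
  { intros i Hi; apply (in_level_self b i v Ob); [|exact Hv].
    eapply ordinal_trans; [exact Ob| |exact Hwb]; apply Hw, Hi. }
  assert (Hc : forall n p, In p (p0 :: p1 :: p2 :: p3 :: p4 :: nil) ->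
    (forall e : nat -> V, is_tagged n (e 1) (e 2) (e 0) <-> holds e p) ->
    forall x y c, x ∈ v -> y ∈ v -> is_tagged n x y c -> c ∈ v).
  { intros n p Hp He x y c Hx Hy Hc.
    destruct (Hr p Hp (scons x (fun _ => y))) as (d & Hd & Hd').
    - intros [|k]; simpl; assumption.
    - exists c; apply He; exact Hc.
    - apply He in Hd'; simpl in Hd'; rewrite (tagged_unique _ _ _ _ _ Hc Hd'); exact Hd. }
  destruct (separation is_formula_code v) as [F HF].
  exists F; intros c; rewrite HF; split; [tauto|]; intros Hcode; split; [|exact Hcode].
  apply Hcode; split; [|split; [|split; [|split]]].
  - intros i j d Hi Hj; apply (Hc 0 p0); simpl; auto.
  - intros i j d Hi Hj; apply (Hc 1 p1); simpl; auto.
  - intros p d Hp; apply (Hc 2 p2); simpl; auto 6.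
  - intros p q d Hp Hq; apply (Hc 3 p3); simpl; auto 6.
  - intros i p d Hi Hp; apply (Hc 4 p4); simpl; auto 6.
Qed.

Lemma formula_codes_closed (F : V) :
  (forall c, c ∈ F <-> is_formula_code c) -> formula_closed F.
Proof.
  intros HF; split; [|split; [|split; [|split]]].
  - intros i j c Hi Hj Hc; apply HF; intros F' HF'; pose proof HF' as (H & _); eauto.
  - intros i j c Hi Hj Hc; apply HF; intros F' HF'; pose proof HF' as (_ & H & _); eauto.
  - intros p c Hp Hc; apply HF; intros F' HF'; pose proof HF' as (_ & _ & H & _).
    apply (H p c); [|exact Hc]; exact (proj1 (HF p) Hp F' HF').
  - intros p q c Hp Hq Hc; apply HF; intros F' HF'.
    pose proof HF' as (_ & _ & _ & H & _).
    apply (H p q c); [exact (proj1 (HF p) Hp F' HF')|exact (proj1 (HF q) Hq F' HF')|exact Hc].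
  - intros i p c Hi Hp Hc; apply HF; intros F' HF'.
    pose proof HF' as (_ & _ & _ & _ & H).
    apply (H i p c); [exact Hi|exact (proj1 (HF p) Hp F' HF')|exact Hc].
Qed.

Definition immediate_subcode (p c : V) : Prop :=
  code_not p c \/ (exists q, code_and p q c \/ code_and q p c) \/
  exists i, code_ex i p c.

#[export] Instance immediate_subcode_definable : Definable2 any immediate_subcode.
Proof. unfold immediate_subcode; definability. Qed.

Ltac clash :=
  unfold code_mem, code_eq, code_not, code_and, code_ex in *;
  match goal with
  | A : is_tagged ?m _ _ ?c, B : is_tagged ?n _ _ ?c |- _ =>
      destruct (tagged_injective _ _ _ _ _ _ _ A B) as (?E & _); discriminate E
  end.
Ltac same :=
  unfold code_mem, code_eq, code_not, code_and, code_ex in *;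
  match goal with
  | A : is_tagged ?m _ _ ?c, B : is_tagged ?m _ _ ?c |- _ =>
      destruct (tagged_injective _ _ _ _ _ _ _ A B) as (_ & ?E & ?E'); clear B; subst
  end.

Ltac body_cases :=
  intros [(i' & j' & _ & _ & Hc' & H)|[(i' & j' & _ & _ & Hc' & H)|[(p' & Hc' & H)|
    [(p' & q' & Hc' & H)|(i' & p' & _ & Hc' & H)]]]]; try clash.

Lemma immediate_subcode_well_founded (F : V) :
  (forall c, c ∈ F <-> is_formula_code c) -> well_founded_on F immediate_subcode.
Proof.
  intros HF s Hs [c Hc]; apply NNPP; intros Hn.
  destruct (separation (fun c => c ∉ s) F) as [F' HF'].
  pose proof (formula_codes_closed F HF) as (C0 & C1 & C2 & C3 & C4).
  assert (Hmin : forall c, c ∈ F -> (forall y, immediate_subcode y c -> y ∉ s) -> c ∈ F').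
  { intros d HdF Hd; apply HF'; split; [exact HdF|]; intros Hds; apply Hn; exists d.
    split; [exact Hds|]; intros y Hy Hyd; apply (Hd y Hyd Hy). }
  assert (HcF : c ∈ F').
  { apply (proj1 (HF c) (Hs c Hc)); split; [|split; [|split; [|split]]]; intros;
      repeat match goal with H : _ ∈ F' |- _ => apply HF' in H as [? ?] end;
      (apply Hmin; [eauto|]); intros y [H'|[[q' [H'|H']]|[k H']]];
      try clash; same; assumption. }
  apply HF' in HcF as [_ HcF]; auto.
Qed.

(** Recursion on codes, the value at c being the set of satisfying assignments.  The
    values at immediate subcodes come as a set s, without labels.  This suffices:
    for a negation s has one element, a conjunction is the intersection of the members of
    s, and a quantifier has one member to project. *)
Lemma satisfaction_exists (A : V) : exists T, is_satisfaction A T.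
Proof.
  destruct formula_codes_exist as [F HF].
  pose proof (formula_codes_closed F HF) as (C0 & C1 & C2 & C3 & C4).
  destruct (@omega_exists V HZF) as [w Hw].
  destruct (funspace_exists w A) as [S HS].
  assert (HSA : forall s, s ∈ S <-> is_assignment A s).
  { intros s; rewrite (HS s); split.
    - intros H; exists w; auto.
    - intros (w' & Hw' & H); replace w with w'; [exact H|].
      apply ext; intros i; rewrite (Hw i); apply Hw'. }
  set (body := fun c s x : V =>
    (exists i j, is_natural i /\ is_natural j /\ code_mem i j c /\
       exists a b, related x i a /\ related x j b /\ a ∈ b) \/
    (exists i j, is_natural i /\ is_natural j /\ code_eq i j c /\
       exists a, related x i a /\ related x j a) \/
    (exists p, code_not p c /\ forall z, z ∈ s -> x ∉ z) \/
    (exists p q, code_and p q c /\ forall z, z ∈ s -> x ∈ z) \/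
    (exists i p, is_natural i /\ code_ex i p c /\ exists z a t, z ∈ s /\
       a ∈ A /\ is_assignment A t /\ is_update x i a t /\ t ∈ z)).
  assert (Hbody : Definable3 any body) by (unfold body; definability).
  set (G := fun c s v : V => forall x, x ∈ v <-> x ∈ S /\ body c s x).
  assert (HG : Definable3 any G) by (unfold G; definability).
  assert (Gf : forall z s v v', z ∈ F -> G z s v -> G z s v' -> v = v').
  { intros z s v v' _ H H'; apply ext; intros u; rewrite (H u), (H' u); tauto. }
  assert (Gt : forall z s, z ∈ F -> exists v, G z s v).
  { intros z s _; apply (separation (body z s) S); definability. }
  destruct (recursion F immediate_subcode G (immediate_subcode_well_founded F HF) Gf Gt)
    as (r & Dr & Hdom & Hun & Hval & Heq).
  destruct (product_exists F S) as [P HP].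
  destruct (separation (fun p => exists c x v, is_pair c x p /\ r c v /\ x ∈ v) P)
    as [T HT].
  assert (HTr : forall c x v, r c v -> (related T c x <-> x ∈ v)).
  { intros c x v Hv; split.
    - intros (p & Hp & HpT); apply HT in HpT as (_ & c' & x' & v' & Hp' & Hv' & Hx).
      destruct (pair_injective _ _ _ _ _ Hp Hp') as [-> ->].
      rewrite (Hun _ _ _ Hv Hv'); exact Hx.
    - intros Hx; destruct (pair_exists c x) as [p Hp]; exists p; split; [exact Hp|].
      apply HT; split; [|eauto 6]; apply HP; exists c, x; split; [|split; [|exact Hp]].
      + exact (Hdom c v Hv).
      + destruct (Heq c v Hv) as (s & _ & HGs); apply HGs in Hx; tauto. }
  assert (HTc : forall c x, c ∈ F -> x ∈ S -> exists s,
    (forall u, u ∈ s <-> exists y, y ∈ F /\ immediate_subcode y c /\ r y u) /\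
    (related T c x <-> body c s x)).
  { intros c x Hc Hx; destruct (Hval c Hc) as [v Hv], (Heq c v Hv) as (s & Hs & HGs).
    exists s; split; [exact Hs|]; rewrite (HTr c x v Hv), (HGs x); tauto. }
  exists T; intros x Hx; apply HSA in Hx; split; [|split; [|split; [|split]]].
  - intros i j c Hi Hj Hc.
    destruct (HTc c x) as (s & Hs & HTs); [eauto|exact Hx|]; rewrite HTs; split.
    + body_cases.
      same; exact H.
    + intros H; left; exists i, j; auto.
  - intros i j c Hi Hj Hc.
    destruct (HTc c x) as (s & Hs & HTs); [eauto|exact Hx|]; rewrite HTs; split.
    + body_cases.
      same; exact H.
    + intros H; right; left; exists i, j; auto.
  - intros p c Hp Hc; apply HF in Hp; destruct (Hval p Hp) as [u Hu].
    destruct (HTc c x) as (s & Hs & HTs); [eauto|exact Hx|].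
    rewrite HTs, (HTr p x u Hu); split.
    + body_cases.
      apply H, Hs; exists p; split; [exact Hp|split; [|exact Hu]]; left; exact Hc.
    + intros H; right; right; left; exists p; split; [exact Hc|].
      intros z Hz; apply Hs in Hz as (y & Hy & Hyc & Hyz).
      assert (y = p) as ->.
      { destruct Hyc as [H'|[[q [H'|H']]|[k H']]]; try clash; same; reflexivity. }
      rewrite (Hun _ _ _ Hyz Hu); exact H.
  - intros p q c Hp Hq Hc; apply HF in Hp, Hq.
    destruct (Hval p Hp) as [u Hu], (Hval q Hq) as [v Hv].
    destruct (HTc c x) as (s & Hs & HTs); [eauto|exact Hx|].
    rewrite HTs, (HTr p x u Hu), (HTr q x v Hv); split.
    + body_cases.
      split; apply H, Hs.
      * exists p; split; [exact Hp|split; [|exact Hu]]; right; left; exists q; auto.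
      * exists q; split; [exact Hq|split; [|exact Hv]]; right; left; exists p; auto.
    + intros [H H']; right; right; right; left; exists p, q; split; [exact Hc|].
      intros z Hz; apply Hs in Hz as (y & Hy & Hyc & Hyz).
      assert (y = p \/ y = q) as [-> | ->].
      { destruct Hyc as [Hd|[[d [Hd|Hd]]|[k Hd]]]; try clash; same; auto. }
      * rewrite (Hun _ _ _ Hyz Hu); exact H.
      * rewrite (Hun _ _ _ Hyz Hv); exact H'.
  - intros i p c Hi Hp Hc; apply HF in Hp; destruct (Hval p Hp) as [u Hu].
    destruct (HTc c x) as (s & Hs & HTs); [eauto|exact Hx|].
    rewrite HTs; split.
    + body_cases.
      destruct H as (z & a & t & Hz & Ha & Ht & Hxt & Htz).
      apply Hs in Hz as (y & Hy & Hyc & Hyz).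
      assert (y = p) as ->.
      { destruct Hyc as [H'|[[q [H'|H']]|[k H']]]; try clash.
        destruct (tagged_injective _ _ _ _ _ _ _ Hc H') as (_ & _ & ->); reflexivity. }
      destruct (tagged_injective _ _ _ _ _ _ _ Hc Hc') as (_ & <- & _).
      exists a, t; repeat (split; [assumption|]); apply (HTr p t z Hyz), Htz.
    + intros (a & t & Ha & Ht & Hxt & Htp); right; right; right; right.
      exists i, p; split; [exact Hi|]; split; [exact Hc|]; exists u, a, t.
      split; [apply Hs; exists p; split; [exact Hp|]; split; [|exact Hu];
        right; right; exists i; exact Hc|].
      repeat (split; [assumption|]); apply (HTr p t u Hu), Htp.
Qed.

(** The formulas for which the Tarski-Vaught criterion is used when evaluating p. *)
Fixpoint matrices (p : formula) : list formula :=
  match p with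
  | FMem _ _ | FEq _ _ => nil
  | FNot q => matrices q
  | FAnd q q' => matrices q ++ matrices q'
  | FEx q => q :: matrices q
  end.

(** Codes use named variables: r gives the names of the free de Bruijn indices, all of
    them below n, and the quantifiers inside take the names n, n + 1 and so on. *)
Fixpoint coded (p : formula) (r : nat -> nat) (n : nat) (c : V) : Prop :=
  match p with
  | FMem i j => exists x y, is_numeral (r i) x /\ is_numeral (r j) y /\ code_mem x y c
  | FEq i j => exists x y, is_numeral (r i) x /\ is_numeral (r j) y /\ code_eq x y c
  | FNot q => exists d, coded q r n d /\ code_not d c
  | FAnd q q' => exists d d', coded q r n d /\ coded q' r n d' /\ code_and d d' c
  | FEx q => exists x d, is_numeral n x /\ coded q (scons n r) (S n) d /\ code_ex x d c
  end.

Lemma coded_exists p : forall r n, exists c, coded p r n c.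
Proof.
  induction p as [i j|i j|q IH|q IH q' IH'|q IH]; intros r n; simpl.
  - destruct (numeral_exists (r i)) as [x Hx], (numeral_exists (r j)) as [y Hy].
    destruct (tagged_exists 0 x y) as [c Hc]; exists c, x, y; auto.
  - destruct (numeral_exists (r i)) as [x Hx], (numeral_exists (r j)) as [y Hy].
    destruct (tagged_exists 1 x y) as [c Hc]; exists c, x, y; auto.
  - destruct (IH r n) as [d Hd], (tagged_exists 2 d d) as [c Hc]; exists c, d; auto.
  - destruct (IH r n) as [d Hd], (IH' r n) as [d' Hd'].
    destruct (tagged_exists 3 d d') as [c Hc]; exists c, d, d'; auto.
  - destruct (numeral_exists n) as [x Hx], (IH (scons n r) (S n)) as [d Hd].
    destruct (tagged_exists 4 x d) as [c Hc]; exists c, x, d; auto.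
Qed.

Lemma coded_formula_code p : forall r n c, coded p r n c -> is_formula_code c.
Proof.
  induction p as [i j|i j|q IH|q IH q' IH'|q IH]; intros r n c; simpl.
  - intros (x & y & Hx & Hy & Hc) F (H & _).
    apply (H x y); [exact (numeral_natural _ _ Hx)|exact (numeral_natural _ _ Hy)|exact Hc].
  - intros (x & y & Hx & Hy & Hc) F (_ & H & _).
    apply (H x y); [exact (numeral_natural _ _ Hx)|exact (numeral_natural _ _ Hy)|exact Hc].
  - intros (d & Hd & Hc) F HF; pose proof HF as (_ & _ & H & _).
    apply (H d); [apply (IH r n d Hd F HF)|exact Hc].
  - intros (d & d' & Hd & Hd' & Hc) F HF; pose proof HF as (_ & _ & _ & H & _).
    apply (H d d'); [apply (IH r n d Hd F HF)|apply (IH' r n d' Hd' F HF)|exact Hc].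
  - intros (x & d & Hx & Hd & Hc) F HF; pose proof HF as (_ & _ & _ & _ & H).
    apply (H x d); [exact (numeral_natural _ _ Hx)|apply (IH _ _ d Hd F HF)|exact Hc].
Qed.

Lemma assignment_unique (A s i a b : V) :
  is_assignment A s -> related s i a -> related s i b -> a = b.
Proof. intros (w & _ & Hs); eapply function_unique; exact Hs. Qed.

Lemma assignment_mem (A s i a : V) : is_assignment A s -> related s i a -> a ∈ A.
Proof. intros (w & _ & Hs) H; apply (function_values _ _ _ _ _ Hs H). Qed.

Lemma update_exists (A s i a : V) :
  is_assignment A s -> is_natural i -> a ∈ A ->
  exists t, is_assignment A t /\ is_update s i a t.
Proof.
  intros Hs Hi Ha; pose proof Hs as (w & Hw & Hf).
  destruct (function_exists (fun k b => k = i /\ b = a \/ k <> i /\ related s k b) w A)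
    as (t & Ht & Htr).
  - intros k b b' _ [[-> ->]|[Hk Hb]] [[Hk' Hb']|[Hk' Hb']]; try tauto; auto.
    eapply assignment_unique; eassumption.
  - intros k Hk; destruct (classic (k = i)) as [->|Hki]; [exists a; auto|].
    destruct (function_total _ _ _ _ Hf Hk) as (b & Hb & Hkb); exists b; auto.
  - exists t; split; [exists w; auto|]; split.
    + apply Htr; split; [apply Hw|]; auto.
    + intros k b Hki; rewrite Htr; split; [tauto|]; intros H.
      split; [|auto]; apply (function_values _ _ _ _ _ Hf H).
Qed.

Lemma assignment_exists (A : V) (e : nat -> V) n :
  (forall i, e i ∈ A) ->
  exists s, is_assignment A s /\
    forall i x, i < n -> is_numeral i x -> related s x (e i).
Proof.
  intros He; induction n as [|n (s & Hs & Hse)].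
  - destruct (@omega_exists V HZF) as [w Hw].
    destruct (function_exists (fun k b => b = e 0) w A) as (s & Hs & _).
    + intros x y z _ -> ->; reflexivity.
    + intros x _; eauto.
    + exists s; split; [exists w; auto|]; lia.
  - destruct (numeral_exists n) as [k Hk].
    destruct (update_exists A s k (e n)) as (t & Ht & Htk & Hto); auto.
    { exact (numeral_natural _ _ Hk). }
    exists t; split; [exact Ht|]; intros i x Hi Hx.
    destruct (Nat.eq_dec i n) as [->|Hin].
    + rewrite (numeral_unique n x k Hx Hk); exact Htk.
    + apply Hto; [|apply Hse; [lia|exact Hx]].
      intros ->; apply Hin, (numeral_injective i n k); auto.
Qed.

(** Internal satisfaction in A agrees with truth in the whole structure, as the witness
    property for the matrices of p replaces relativization to A. *)
Lemma satisfaction_holds (A T : V) (p : formula) :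
  is_satisfaction A T ->
  (forall q, In q (matrices p) -> witness_closed A q) ->
  forall r n c s (e : nat -> V),
    coded p r n c -> is_assignment A s -> (forall i, r i < n) ->
    (forall i x, is_numeral (r i) x -> related s x (e i)) ->
    (related T c s <-> holds e p).
Proof.
  intros HT; induction p as [i j|i j|q IH|q IH q' IH'|q IH];
    intros Hw r n c s e Hc Hs Hr He; simpl in Hc, Hw |- *;
    destruct (HT s Hs) as (T0 & T1 & T2 & T3 & T4).
  - destruct Hc as (x & y & Hx & Hy & Hc).
    rewrite (T0 x y c (numeral_natural _ _ Hx) (numeral_natural _ _ Hy) Hc).
    pose proof (He _ _ Hx) as Hex; pose proof (He _ _ Hy) as Hey.
    split; [|exists (e i), (e j); auto].
    intros (a & b & Ha & Hb & Hab).
    rewrite (assignment_unique A s x (e i) a), (assignment_unique A s y (e j) b); auto.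
  - destruct Hc as (x & y & Hx & Hy & Hc).
    rewrite (T1 x y c (numeral_natural _ _ Hx) (numeral_natural _ _ Hy) Hc).
    pose proof (He _ _ Hx) as Hex; pose proof (He _ _ Hy) as Hey.
    split.
    + intros (a & Ha & Hb).
      rewrite (assignment_unique A s x (e i) a), (assignment_unique A s y (e j) a); auto.
    + intros H; exists (e i); split; [exact Hex|]; rewrite H; exact Hey.
  - destruct Hc as (d & Hd & Hc).
    rewrite (T2 d c (coded_formula_code _ _ _ _ Hd) Hc), (IH Hw r n d s e Hd Hs Hr He); tauto.
  - destruct Hc as (d & d' & Hd & Hd' & Hc).
    rewrite (T3 d d' c (coded_formula_code _ _ _ _ Hd) (coded_formula_code _ _ _ _ Hd') Hc).
    rewrite (IH (fun q H => Hw q (in_or_app _ _ _ (or_introl H))) r n d s e); auto.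
    rewrite (IH' (fun q H => Hw q (in_or_app _ _ _ (or_intror H))) r n d' s e); auto.
    tauto.
  - destruct Hc as (x & d & Hx & Hd & Hc).
    rewrite (T4 x d c (numeral_natural _ _ Hx) (coded_formula_code _ _ _ _ Hd) Hc).
    assert (HeA : forall i, e i ∈ A).
    { intros i; destruct (numeral_exists (r i)) as [y Hy].
      eapply assignment_mem; [exact Hs|apply (He i y Hy)]. }
    assert (Hstep : forall a t, is_assignment A t -> is_update s x a t ->
      (related T d t <-> holds (scons a e) q)).
    { intros a t Ht [Htx Hto]; apply (IH (fun q' H => Hw q' (or_intror H))
        (scons n r) (S n) d t (scons a e)); auto.
      - intros [|i]; simpl; [lia|]; specialize (Hr i); lia.
      - intros [|i] y; simpl.
        + intros Hy; rewrite (numeral_unique n y x Hy Hx); exact Htx.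
        + intros Hy; apply Hto; [|auto]; intros ->; specialize (Hr i).
          pose proof (numeral_injective _ _ _ Hx Hy); lia. }
    split.
    + intros (a & t & Ha & Ht & Hst & HTt); exists a; apply (Hstep a t); auto.
    + intros Hex; destruct (Hw q (or_introl eq_refl) e HeA Hex) as (a & Ha & Hh).
      destruct (update_exists A s x a) as (t & Ht & Hst);
        [exact Hs|exact (numeral_natural _ _ Hx)|exact Ha|].
      exists a, t; repeat (split; [assumption|]); apply (Hstep a t); auto.
Qed.

Lemma elementary_embedding_holds (A j : V) (p : formula) :
  is_elementary_embedding j A A ->
  (forall q, In q (matrices p) -> witness_closed A q) ->
  forall e e' : nat -> V, (forall n, related j (e n) (e' n)) ->
  (holds e p <-> holds e' p).
Proof.
  intros [Hj Hel] Hw e e' He.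
  destruct (@holds_finite_support V p) as [n Hn].
  (* variables from n on are irrelevant; naming them 0 keeps all names below S n *)
  set (r := fun i => if le_lt_dec n i then 0 else i).
  destruct (coded_exists p r (S n)) as [c Hc].
  destruct (assignment_exists A e (S n)) as (s & Hs & Hse).
  { intros i; apply (function_values _ _ _ _ _ Hj (He i)). }
  pose proof Hs as (w & Hww & Hsf).
  destruct (compose_exists _ _ _ _ _ Hsf Hj) as (t & Htf & Htr).
  assert (Ht : is_assignment A t) by (exists w; auto).
  assert (Himg : is_image_assignment j s t).
  { intros i a b Ha Hb; apply Htr in Hb as (a' & Ha' & Hb).
    rewrite (assignment_unique A s i a a'); auto. }
  destruct (satisfaction_exists A) as [T HT].
  assert (Hr : forall i, r i < S n) by (intros i; unfold r; destruct (le_lt_dec n i); lia).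
  assert (K : forall s (e : nat -> V), is_assignment A s ->
    (forall i x, i < S n -> is_numeral i x -> related s x (e i)) ->
    (satisfies A c s <-> holds e p)).
  { intros s0 e0 Hs0 He0.
    assert (E : holds (fun i => e0 (r i)) p <-> holds e0 p).
    { apply Hn; intros i Hi; unfold r; destruct (le_lt_dec n i); [lia|reflexivity]. }
    rewrite <- E; split.
    - intros (T' & HT' & HTc).
      apply (satisfaction_holds A T' p HT' Hw r (S n) c s0); auto.
    - intros Hh; exists T; split; [exact HT|].
      apply (satisfaction_holds A T p HT Hw r (S n) c s0 (fun i => e0 (r i))); auto. }
  rewrite <- (K s e Hs Hse), <- (K t e' Ht).
  - apply Hel; auto; eapply coded_formula_code; eassumption.
  - intros i x Hi Hx; apply Htr; exists (e i); auto.
Qed.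

(** What is kept of rank Berkeley cardinals: the bound below critical points is
    dropped, and the property passes from lambda to every larger ordinal.  So the ordinal
    gamma of the theorem has it, and lambda can be forgotten. *)
Definition has_embeddings (g : V) : Prop :=
  forall eta, is_ordinal eta -> g ∈ eta -> exists v j k,
    is_rank_initial_segment eta v /\ is_elementary_embedding j v v /\
    is_critical_point j k /\ k ∈ g.

Theorem transfer (L : list formula) (g x : V) :
  ordinal g -> has_embeddings g ->
  exists A j k, transitive A /\ x ∈ A /\ is_function j A A /\
    is_critical_point j k /\ k ∈ g /\
    forall p, In p L -> witness_closed A p /\
      forall e e' : nat -> V, (forall n, related j (e n) (e' n)) ->
        (holds e p <-> holds e' p).
Proof.
  intros Og Hg; destruct (every_set_in_level x) as (a & Oa & Ha).
  destruct (upair_exists a g) as [s Hs], (ordinal_bound s) as (b & Ob & Hb).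
  { intros y Hy; apply Hs in Hy as [-> | ->]; assumption. }
  destruct (reflection (L ++ flat_map matrices L) b Ob) as (eta & Oeta & Hbe & Hr).
  assert (Hae : a ∈ eta) by (eapply ordinal_trans; [exact Oeta|apply Hb, Hs; auto|exact Hbe]).
  assert (Hge : g ∈ eta) by (eapply ordinal_trans; [exact Oeta|apply Hb, Hs; auto|exact Hbe]).
  destruct (Hg eta) as (A & j & k & HA & Hj & Hk & Hkg); [apply is_ordinal_iff, Oeta|exact Hge|].
  exists A, j, k; split; [eapply level_transitive; exact HA|].
  split.
  { destruct Ha as (v & Hv & Hx); eapply level_monotone; [exact Hv|exact HA| |exact Hx].
    exact (proj1 Oeta a Hae). }
  split; [apply Hj|]; split; [exact Hk|]; split; [exact Hkg|].
  intros p Hp; split; [apply (Hr A HA), in_or_app; auto|].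
  apply (elementary_embedding_holds A j p Hj); intros q Hq.
  apply (Hr A HA), in_or_app; right; apply in_flat_map; eauto.
Qed.

End Codes.

(** * Ultrafilters and their ultrapowers *)

Definition ae {V : structure} (U : V) (P : V -> Prop) : Prop :=
  exists u, u ∈ U /\ forall a, a ∈ u -> P a.

(** Stated for sets of functions instead of sets of classes, well-foundedness can be
    used without forming ultrapowers. *)
Definition wf_ultrafilter {V : structure} (X U : V) : Prop :=
  is_ultrafilter X U /\
  forall g T, ordinal g -> nonempty T -> (forall f, f ∈ T -> is_function f X g) ->
    exists f, f ∈ T /\ forall f', f' ∈ T -> ~ memU X U f' f.

Definition ultrafilter_family {V : structure} (X E : V) : Prop :=
  (exists Y, is_function E X Y) /\ forall a D, related E a D -> wf_ultrafilter X D.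

Definition is_limit {V : structure} (X W E U : V) : Prop :=
  forall A, A ∈ U <-> subset A X /\ ae W (fun a => exists D, related E a D /\ A ∈ D).

(** Below, X is an ordinal, so that a in D says that D concentrates on ordinals less
    than a. *)
Definition ketonen {V : structure} (X U W : V) : Prop :=
  exists E, ultrafilter_family X E /\
    ae W (fun a => exists D, related E a D /\ a ∈ D) /\ is_limit X W E U.

(* A predicate argument may contain bound variables, which no instance covers; such
   notions are unfolded. *)
Ltac unfold_binding_notion ::=
  progress unfold ae, collapse, recursive_value, attempt.

#[export] Instance wf_ultrafilter_definable {V : structure} C :
  Definable2 C (@wf_ultrafilter V).
Proof. unfold wf_ultrafilter; definability. Qed.
#[export] Instance ultrafilter_family_definable {V : structure} C :
  Definable2 C (@ultrafilter_family V).
Proof. unfold ultrafilter_family; definability. Qed.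
#[export] Instance is_limit_definable {V : structure} C :
  Definable4 C (@is_limit V).
Proof. unfold is_limit; definability. Qed.
#[export] Instance ketonen_definable {V : structure} C :
  Definable3 C (@ketonen V).
Proof. unfold ketonen; definability. Qed.

Section AlmostEverywhere.
Context {V : structure} {HZF : ZF V} (X U : V) (HU : is_ultrafilter X U).

Lemma ae_mono (P Q : V -> Prop) : (forall a, a ∈ X -> P a -> Q a) -> ae U P -> ae U Q.
Proof.
  intros H (u & Hu & Hp); exists u; split; [exact Hu|]; intros a Ha.
  apply H; [apply (proj1 HU u Hu a Ha)|auto].
Qed.

Lemma ae_all (P : V -> Prop) : (forall a, a ∈ X -> P a) -> ae U P.
Proof. intros H; exists X; split; [apply HU|exact H]. Qed.

Lemma ae_and (P Q : V -> Prop) : ae U P -> ae U Q -> ae U (fun a => P a /\ Q a).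
Proof.
  intros (u & Hu & HP) (v & Hv & HQ).
  destruct (separation (fun x => x ∈ v) u) as [w Hw].
  exists w; split; [|intros a Ha; apply Hw in Ha as [Ha Ha']; auto].
  destruct HU as (_ & _ & _ & _ & H & _); apply (H u v w Hu Hv Hw).
Qed.

Lemma ae_exists (P : V -> Prop) : ae U P -> exists a, a ∈ X /\ P a.
Proof.
  intros (u & Hu & HP); destruct HU as (H1 & _ & H2 & _).
  destruct (H2 u Hu) as [a Ha]; exists a; split; [apply (H1 u Hu a Ha)|auto].
Qed.

Lemma ae_contradiction (P Q : V -> Prop) :
  ae U P -> ae U Q -> (forall a, a ∈ X -> P a -> Q a -> False) -> False.
Proof.
  intros HP HQ H; destruct (ae_exists _ (ae_and _ _ HP HQ)) as (a & Ha & H1 & H2); eauto.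
Qed.

Lemma ae_dichotomy (P : V -> Prop) {HP : Definable1 any P} : ae U P \/ ae U (fun a => ~ P a).
Proof.
  destruct (separation P X) as [a Ha].
  destruct (separation (fun x => ~ P x) X) as [b Hb].
  destruct HU as (_ & _ & _ & _ & _ & H).
  destruct (H a b) as [H'|H'].
  - intros x Hx; apply Ha, Hx.
  - intros x; rewrite Hb, Ha; tauto.
  - left; exists a; split; [exact H'|]; intros x Hx; apply Ha, Hx.
  - right; exists b; split; [exact H'|]; intros x Hx; apply Hb, Hx.
Qed.

Lemma ae_mem A : subset A X -> (A ∈ U <-> ae U (fun a => a ∈ A)).
Proof.
  intros HA; split.
  - intros H; exists A; auto.
  - intros (u & Hu & Hp); destruct HU as (_ & _ & _ & H & _); eauto.
Qed.

Lemma ae_set (P : V -> Prop) {HP : Definable1 any P} :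
  ae U P -> exists u, u ∈ U /\ forall x, x ∈ u <-> x ∈ X /\ P x.
Proof.
  intros H; destruct (separation P X) as [u Hu]; exists u; split; [|exact Hu].
  apply ae_mem; [intros x Hx; apply Hu, Hx|].
  apply (ae_mono P); [|exact H]; intros a Ha HPa; apply Hu; auto.
Qed.

Lemma memU_ae f g :
  memU X U f g <-> ae U (fun x => exists a b, related f x a /\ related g x b /\ a ∈ b).
Proof.
  split.
  - intros (u & Hu & H); exists u; split; [exact Hu|]; intros x Hx; apply H, Hx.
  - apply ae_set; definability.
Qed.

Lemma eqU_ae f g :
  eqU X U f g <-> ae U (fun x => exists a, related f x a /\ related g x a).
Proof.
  split.
  - intros (u & Hu & H); exists u; split; [exact Hu|]; intros x Hx; apply H, Hx.
  - apply ae_set; definability.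
Qed.

Context (g : V).
Implicit Types f h k : V.

Lemma eqU_refl f : is_function f X g -> eqU X U f f.
Proof.
  intros Hf; apply eqU_ae, ae_all; intros x Hx.
  destruct (function_total _ _ _ _ Hf Hx) as (y & _ & Hy); eauto.
Qed.

Lemma eqU_sym f h : eqU X U f h -> eqU X U h f.
Proof.
  rewrite !eqU_ae; apply ae_mono; intros x _ (a & Ha & Hb); eauto.
Qed.

Lemma eqU_trans f h k :
  is_function h X g -> eqU X U f h -> eqU X U h k -> eqU X U f k.
Proof.
  intros Hh; rewrite !eqU_ae; intros H1 H2.
  eapply ae_mono; [|exact (ae_and _ _ H1 H2)]; cbv beta.
  intros x _ [(a & Ha & Hb) (b & Hc & Hd)].
  rewrite (function_unique _ _ _ _ _ _ Hh Hb Hc) in Ha; eauto.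
Qed.

Lemma memU_eqU f f' h h' :
  is_function f X g -> is_function h X g ->
  eqU X U f f' -> eqU X U h h' -> memU X U f h -> memU X U f' h'.
Proof.
  intros Hf Hh; rewrite !eqU_ae, !memU_ae; intros H1 H2 H3.
  eapply ae_mono; [|exact (ae_and _ _ H1 (ae_and _ _ H2 H3))]; cbv beta.
  intros x _ ((a & Ha & Ha') & (b & Hb & Hb') & (c & d & Hc & Hd & Hcd)).
  rewrite (function_unique _ _ _ _ _ _ Hf Hc Ha), (function_unique _ _ _ _ _ _ Hh Hd Hb)
    in Hcd; eauto.
Qed.

Lemma memU_irrefl f : is_function f X g -> ~ memU X U f f.
Proof.
  intros Hf H; apply memU_ae, ae_exists in H as (x & _ & a & b & Ha & Hb & Hab).
  rewrite (function_unique _ _ _ _ _ _ Hf Ha Hb) in Hab; apply (not_mem_self b Hab).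
Qed.

Lemma memU_trans f h k :
  ordinal g -> is_function f X g -> is_function h X g -> is_function k X g ->
  memU X U f h -> memU X U h k -> memU X U f k.
Proof.
  intros Og Hf Hh Hk; rewrite !memU_ae; intros H1 H2.
  eapply ae_mono; [|exact (ae_and _ _ H1 H2)]; cbv beta.
  intros x _ [(a & b & Ha & Hb & Hab) (b' & c & Hb' & Hc & Hbc)].
  rewrite (function_unique _ _ _ _ _ _ Hh Hb Hb') in Hab.
  exists a, c; split; [exact Ha|]; split; [exact Hc|].
  apply (ordinal_trans c b' a); [|exact Hab|exact Hbc].
  apply (ordinal_mem g); [exact Og|]; apply (function_values _ _ _ _ _ Hk Hc).
Qed.

Lemma memU_trichotomy f h :
  ordinal g -> is_function f X g -> is_function h X g ->
  memU X U f h \/ eqU X U f h \/ memU X U h f.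
Proof.
  intros Og Hf Hh; rewrite !memU_ae, eqU_ae.
  destruct (ae_dichotomy (fun x => exists a b, related f x a /\ related h x b /\ a ∈ b))
    as [H1|H1]; [auto|].
  destruct (ae_dichotomy (fun x => exists a, related f x a /\ related h x a))
    as [H2|H2]; [auto|].
  right; right; eapply ae_mono; [|exact (ae_and _ _ H1 H2)]; cbv beta.
  intros x Hx [N1 N2].
  destruct (function_total _ _ _ _ Hf Hx) as (a & Ha & Hxa).
  destruct (function_total _ _ _ _ Hh Hx) as (b & Hb & Hxb).
  exists b, a; split; [exact Hxb|]; split; [exact Hxa|].
  destruct (ordinal_trichotomy a b) as [H|[H|H]]; [| |destruct N1|destruct N2|exact H].
  - eapply ordinal_mem; eassumption.
  - eapply ordinal_mem; eassumption.
  - eauto.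
  - subst b; eauto.
Qed.

End AlmostEverywhere.

Section Ultrapowers.
Context {V : structure} {HZF : ZF V}.

Lemma class_exists (X U g f : V) : exists c, is_classU X U g f c.
Proof.
  destruct (funspace_exists X g) as [F HF].
  destruct (separation (fun h => eqU X U f h) F) as [c Hc].
  exists c; intros h; rewrite Hc, (HF h); tauto.
Qed.

Lemma class_unique (X U g f c d : V) :
  is_classU X U g f c -> is_classU X U g f d -> c = d.
Proof. intros H H'; apply ext; intros h; rewrite (H h), (H' h); tauto. Qed.

Lemma ultrapower_exists (X U g : V) : exists Q, is_ultrapower X U g Q.
Proof.
  destruct (funspace_exists X g) as [F HF].
  destruct (replacement (is_classU X U g) F) as [Q HQ].
  - intros f c d _; apply class_unique.
  - exists Q; intros c; rewrite HQ; split; intros (f & Hf & Hc); exists f;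
      (split; [apply HF, Hf|exact Hc]).
Qed.

Lemma well_founded_wf_ultrafilter (X U : V) :
  well_founded_ultrafilter X U -> wf_ultrafilter X U.
Proof.
  intros [HU Hwf]; split; [exact HU|]; intros g T Og [f0 Hf0] HT.
  destruct (ultrapower_exists X U g) as [Q HQ].
  destruct (Hwf g Q) as (_ & _ & _ & Hmin); [apply is_ordinal_iff, Og|exact HQ|].
  destruct (separation (fun c => exists f, f ∈ T /\ is_classU X U g f c) Q) as [s Hs].
  assert (HsT : forall f c, f ∈ T -> is_classU X U g f c -> c ∈ s).
  { intros f c Hf Hc; apply Hs; split; [apply HQ|]; eauto. }
  destruct (Hmin s) as (m & Hm & Hm').
  { intros c Hc; apply Hs, Hc. }
  { destruct (class_exists X U g f0) as [c Hc]; exists c; eauto. }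
  apply Hs in Hm as [_ (f & Hf & Hfm)]; exists f; split; [exact Hf|].
  intros f' Hf' Hmem; destruct (class_exists X U g f') as [c Hc].
  pose proof (HT f Hf) as Ff; pose proof (HT f' Hf') as Ff'.
  destruct (classic (c = m)) as [->|Hcm].
  - assert (E : eqU X U f f') by (apply Hfm, Hc; split; [|eapply eqU_refl]; eassumption).
    apply (memU_irrefl X U HU g f Ff).
    apply (memU_eqU X U HU g f' f f f); auto; [eapply eqU_sym; eassumption|].
    eapply eqU_refl; eassumption.
  - destruct (Hm' c) as (h & h' & Hh & Hh' & Hhh); [eauto|exact Hcm|].
    apply Hfm in Hh as [Fh Hh]; apply Hc in Hh' as [Fh' Hh'].
    apply (memU_irrefl X U HU g f Ff).
    apply (memU_trans X U HU g f f' f); auto.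
    apply (memU_eqU X U HU g h f h' f'); auto; eapply eqU_sym; eassumption.
Qed.

Lemma memU_well_founded (X U g T : V) :
  wf_ultrafilter X U -> ordinal g -> (forall f, f ∈ T -> is_function f X g) ->
  well_founded_on T (memU X U).
Proof. intros [_ H] Og HT s Hs Hn; apply (H g s Og Hn); auto. Qed.

(** Well-foundedness for functions a |-> rho t a that are only defined, uniformly in an
    index t: this is how it gets used without choice. *)
Lemma minimal_index (X U T : V) (rho : V -> V -> V -> Prop) {Hrho : Definable3 any rho} :
  wf_ultrafilter X U -> nonempty T ->
  (forall t a, t ∈ T -> a ∈ X -> exists v, ordinal v /\ rho t a v) ->
  (forall t a v v', t ∈ T -> a ∈ X -> rho t a v -> rho t a v' -> v = v') ->
  exists t, t ∈ T /\ forall t', t' ∈ T ->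
    ~ ae U (fun a => exists v v', rho t' a v /\ rho t a v' /\ v ∈ v').
Proof.
  intros [HU Hwf] [t0 Ht0] Hex Hun.
  destruct (product_exists T X) as [P HP].
  destruct (replacement (fun p v => exists t a, is_pair t a p /\ rho t a v) P) as [R HR].
  { intros p v v' Hp (t & a & Hta & Hv) (t' & a' & Hta' & Hv').
    destruct (pair_injective _ _ _ _ _ Hta Hta') as [<- <-].
    apply HP in Hp as (t' & a' & Ht & Ha & Hp).
    destruct (pair_injective _ _ _ _ _ Hta Hp) as [<- <-]; eauto. }
  assert (HRv : forall t a v, t ∈ T -> a ∈ X -> rho t a v -> v ∈ R).
  { intros t a v Ht Ha Hv; destruct (pair_exists t a) as [p Hp]; apply HR; exists p.
    split; [apply HP|]; eauto 6. }
  destruct (ordinal_bound R) as (g & Og & Hg).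
  { intros v Hv; apply HR in Hv as (p & Hp & t & a & Hta & Hv).
    apply HP in Hp as (t' & a' & Ht & Ha & Hp).
    destruct (pair_injective _ _ _ _ _ Hta Hp) as [<- <-].
    destruct (Hex t a Ht Ha) as (w & Ow & Hw); rewrite (Hun t a v w); auto. }
  assert (Hfun : forall t, t ∈ T -> exists f, is_function f X g /\
    forall a v, related f a v <-> a ∈ X /\ rho t a v).
  { intros t Ht; apply (function_exists (rho t)).
    - intros a v v' Ha; eauto.
    - intros a Ha; destruct (Hex t a Ht Ha) as (v & _ & Hv); exists v.
      split; [apply Hg|]; eauto. }
  destruct (funspace_exists X g) as [F HF].
  destruct (separation (fun f => exists t, t ∈ T /\
    forall a v, related f a v <-> a ∈ X /\ rho t a v) F) as [S HS].
  destruct (Hwf g S Og) as (f & Hf & Hmin).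
  { destruct (Hfun t0 Ht0) as (f & Hf & Hfr); exists f; apply HS; split; [apply HF, Hf|].
    eauto. }
  { intros f Hf; apply HF, HS, Hf. }
  apply HS in Hf as [Hf (t & Ht & Hft)]; exists t; split; [exact Ht|].
  intros t' Ht' Hae; destruct (Hfun t' Ht') as (f' & Hf' & Hft').
  apply (Hmin f'); [apply HS; split; [apply HF, Hf'|eauto]|].
  apply memU_ae; [exact HU|]; revert Hae; apply (ae_mono X U HU).
  intros a Ha (v & v' & Hv & Hv' & Hvv); exists v, v'; split; [apply Hft'; auto|].
  split; [apply Hft; auto|exact Hvv].
Qed.

End Ultrapowers.

(** * Limits of ultrafilters *)

Section Limits.
Context {V : structure} {HZF : ZF V} (X : V).

Lemma family_value (E a : V) :
  ultrafilter_family X E -> a ∈ X -> exists D, related E a D /\ wf_ultrafilter X D.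
Proof.
  intros [[Y HE] H] Ha; destruct (function_total _ _ _ _ HE Ha) as (D & _ & HD); eauto.
Qed.

Lemma family_unique (E a D D' : V) :
  ultrafilter_family X E -> related E a D -> related E a D' -> D = D'.
Proof. intros [[Y HE] H]; eapply function_unique; exact HE. Qed.

Lemma limit_exists (W E : V) : exists U, is_limit X W E U.
Proof.
  destruct (power_exists X) as [P HP].
  destruct (separation (fun A => ae W (fun a => exists D, related E a D /\ A ∈ D)) P)
    as [U HU].
  exists U; intros A; rewrite HU, HP; tauto.
Qed.

Lemma limit_unique (W E U U' : V) : is_limit X W E U -> is_limit X W E U' -> U = U'.
Proof. intros H H'; apply ext; intros A; rewrite (H A), (H' A); tauto. Qed.

Context (W E U : V) (HW : wf_ultrafilter X W) (HE : ultrafilter_family X E)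
  (HU : is_limit X W E U).

Lemma limit_ultrafilter : is_ultrafilter X U.
Proof.
  destruct HW as [HW' _].
  split; [|split; [|split; [|split; [|split]]]].
  - intros A HA; apply HU, HA.
  - apply HU; split; [intros x Hx; exact Hx|]; apply (ae_all X W HW'); intros a Ha.
    destruct (family_value E a HE Ha) as (D & HD & [HD' _]); exists D.
    split; [exact HD|apply HD'].
  - intros A HA; apply HU in HA as [_ HA].
    apply (ae_exists X W HW') in HA as (a & _ & D & HD & HAD).
    destruct HE as [_ H]; destruct (H a D HD) as ((_ & _ & Hn & _) & _); auto.
  - intros A B HA HAB HB; apply HU in HA as [_ HA]; apply HU; split; [exact HB|].
    revert HA; apply (ae_mono X W HW'); intros a _ (D & HD & HAD); exists D.
    split; [exact HD|]; destruct HE as [_ H].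
    destruct (H a D HD) as ((_ & _ & _ & Hu & _) & _); eauto.
  - intros A B C HA HB HC; apply HU in HA as [HAX HA], HB as [_ HB]; apply HU.
    split; [intros x Hx; apply HAX, HC, Hx|].
    eapply (ae_mono X W HW'); [|exact (ae_and X W HW' _ _ HA HB)]; cbv beta.
    intros a _ [(D & HD & HAD) (D' & HD' & HBD)]; exists D; split; [exact HD|].
    rewrite <- (family_unique E a D D' HE HD HD') in HBD.
    destruct HE as [_ H]; destruct (H a D HD) as ((_ & _ & _ & _ & Hi & _) & _); eauto.
  - intros A B HA HB.
    destruct (ae_dichotomy X W HW' (fun a => exists D, related E a D /\ A ∈ D)) as [H|H].
    + left; apply HU; auto.
    + right; apply HU; split; [intros x Hx; apply HB, Hx|].
      revert H; apply (ae_mono X W HW'); intros a Ha Hn.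
      destruct (family_value E a HE Ha) as (D & HD & [HD' _]); exists D.
      split; [exact HD|]; destruct HD' as (_ & _ & _ & _ & _ & Hc).
      destruct (Hc A B HA HB) as [H|H]; [destruct Hn; eauto|exact H].
Qed.

Lemma ae_limit (P : V -> Prop) {HP : Definable1 any P} :
  (ae U P <-> ae W (fun a => exists D, related E a D /\ ae D P)).
Proof.
  destruct (separation P X) as [A HA].
  assert (HAX : subset A X) by (intros x Hx; apply HA, Hx).
  pose proof limit_ultrafilter as HU'; destruct HW as [HW' _].
  assert (H1 : ae U P <-> A ∈ U).
  { rewrite (ae_mem X U HU' A HAX).
    split; apply (ae_mono X U HU'); intros a Ha; rewrite (HA a); tauto. }
  rewrite H1, (HU A); split.
  - intros [_ H]; revert H; apply (ae_mono X W HW'); intros a _ (D & HD & HAD).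
    exists D; split; [exact HD|]; exists A; split; [exact HAD|].
    intros x Hx; apply HA, Hx.
  - intros H; split; [exact HAX|]; revert H; apply (ae_mono X W HW').
    intros a _ (D & HD & HPD); exists D; split; [exact HD|].
    destruct HE as [_ H]; destruct (H a D HD) as [HD' _].
    apply (ae_mem X D HD' A HAX); revert HPD; apply (ae_mono X D HD').
    intros x Hx HPx; apply HA; auto.
Qed.

(** Send f to the function a |-> rank of f modulo E(a).  This is strictly monotone from
    the order modulo U to that modulo W, and ranks are canonical, so no representatives
    have to be chosen. *)
Lemma limit_wf_ultrafilter : wf_ultrafilter X U.
Proof.
  pose proof limit_ultrafilter as HU'; split; [exact HU'|].
  intros g T Og HTn HT; pose proof HW as [HW' _].
  assert (K1 : forall D, wf_ultrafilter X D -> well_founded_on T (memU X D)).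
  { intros D HD; apply (memU_well_founded X D g); auto. }
  destruct (minimal_index X W T
    (fun f a v => exists D, related E a D /\ collapse T (memU X D) f v))
    as (f & Hf & Hmin).
  - exact HW.
  - exact HTn.
  - intros f a Hf Ha; destruct (family_value E a HE Ha) as (D & HD & HDw).
    destruct (collapse_exists T (memU X D) (K1 D HDw) f Hf) as [v Hv].
    exists v; split; [|eauto].
    apply (collapse_ordinal T (memU X D) (K1 D HDw)) in Hv; [exact Hv|].
    intros x y z Hx Hy Hz; apply (memU_trans X D (proj1 HDw) g); auto.
  - intros f a v v' Hf Ha (D & HD & Hv) (D' & HD' & Hv').
    rewrite <- (family_unique E a D D' HE HD HD') in Hv'.
    destruct HE as [_ H]; specialize (H a D HD).
    eapply (collapse_unique T (memU X D)); eauto.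
  - exists f; split; [exact Hf|]; intros f' Hf' Hmem; apply (Hmin f' Hf').
    apply (memU_ae X U HU') in Hmem; apply ae_limit in Hmem; [|definability].
    revert Hmem; apply (ae_mono X W HW'); intros a Ha (D & HD & HDm).
    destruct HE as [_ H]; pose proof (H a D HD) as HDw.
    apply (memU_ae X D (proj1 HDw)) in HDm.
    destruct (collapse_exists T (memU X D) (K1 D HDw) f Hf) as [v Hv].
    destruct (collapse_exists T (memU X D) (K1 D HDw) f' Hf')
      as [v' Hv'].
    exists v', v; split; [eauto|]; split; [eauto|].
    eapply (collapse_strict T (memU X D)); eauto.
Qed.

End Limits.

(** * The Ketonen order *)

Section Ketonen.
Context {V : structure} {HZF : ZF V} (X : V) (OX : ordinal X).

Lemma function_retarget (f a b c : V) :
  is_function f a b -> (forall x y, related f x y -> y ∈ c) -> is_function f a c.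
Proof.
  intros Hf H; pose proof Hf as (H1 & H2 & H3); split; [|split]; auto.
  intros p Hp; destruct (H1 p Hp) as (x & y & Hx & _ & Hp').
  exists x, y; split; [exact Hx|]; split; [|exact Hp']; apply (H x y); exists p; auto.
Qed.

Lemma family_limits_exist (E E' : V) :
  ultrafilter_family X E -> ultrafilter_family X E' ->
  exists E'', ultrafilter_family X E'' /\
    forall a D'', related E'' a D'' <->
      a ∈ X /\ exists D, related E a D /\ is_limit X D E' D''.
Proof.
  intros HE HE'.
  assert (Hf : forall a y z, a ∈ X -> (exists D, related E a D /\ is_limit X D E' y) ->
    (exists D, related E a D /\ is_limit X D E' z) -> y = z).
  { intros a D1 D2 _ (D & HD & H1) (D' & HD' & H2).
    rewrite (family_unique X E a D' D HE HD' HD) in H2; eapply limit_unique; eassumption. }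
  destruct (replacement (fun a D'' => exists D, related E a D /\ is_limit X D E' D'') X)
    as [Y HY]; [exact Hf|].
  destruct (function_exists (fun a D'' => exists D, related E a D /\ is_limit X D E' D'') X Y)
    as (E'' & HE'' & Hr); [exact Hf| |].
  { intros a Ha; destruct (family_value X E a HE Ha) as (D & HD & _).
    destruct (limit_exists X D E') as [D'' HD'']; exists D''; split; [apply HY|]; eauto. }
  exists E''; split; [|exact Hr]; split; [eauto|].
  intros a D'' Ha; apply Hr in Ha as (_ & D & HD & HD''); destruct HE as [_ HE].
  apply (limit_wf_ultrafilter X D E' D''); eauto.
Qed.

(** If U is the W-limit of E and U' the U-limit of E', then U' is the W-limit of the
    family E'' of the E(a)-limits of E'.  Moreover E''(a) is below E(a) in the Ketonen
    order, by the same family E', and concentrates on a: for E(a)-almost all b we have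
    b in a, and E'(b) concentrates on b. *)
Lemma ketonen_compose (W U U' E E' E'' : V) :
  wf_ultrafilter X W -> ultrafilter_family X E -> ultrafilter_family X E' ->
  is_limit X W E U -> is_limit X U E' U' ->
  ae W (fun a => exists D, related E a D /\ a ∈ D) ->
  ae U (fun a => exists D, related E' a D /\ a ∈ D) ->
  (forall a D'', related E'' a D'' <->
      a ∈ X /\ exists D, related E a D /\ is_limit X D E' D'') ->
  is_limit X W E'' U' /\
  ae W (fun a => exists D D'', related E a D /\ related E'' a D'' /\
    a ∈ D /\ a ∈ D'' /\ ketonen X D'' D).
Proof.
  intros HW HE HE' HU HU' HaE HaE' HE''; pose proof HW as [HW' _]; split.
  - intros A; rewrite (HU' A).
    rewrite (ae_limit X W E U HW HE HU (fun b => exists D, related E' b D /\ A ∈ D)).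
    split; intros [HA H]; (split; [exact HA|]); revert H; apply (ae_mono X W HW');
      intros a Ha.
    + intros (D & HD & H); destruct (limit_exists X D E') as [D'' HD'']; exists D''.
      split; [apply HE''; eauto|]; apply HD''; auto.
    + intros (D'' & HD'' & H); apply HE'' in HD'' as (_ & D & HD & Hl); exists D.
      split; [exact HD|]; apply Hl, H.
  - rewrite (ae_limit X W E U HW HE HU (fun b => exists D, related E' b D /\ b ∈ D)) in HaE'.
    eapply (ae_mono X W HW'); [|exact (ae_and X W HW' _ _ HaE HaE')]; cbv beta.
    intros a Ha [(D & HD & HaD) (D1 & HD1 & HaeD)].
    rewrite <- (family_unique X E a D D1 HE HD HD1) in HaeD; clear D1 HD1.
    destruct (limit_exists X D E') as [D'' HD''].
    exists D, D''; split; [exact HD|]; split; [apply HE''; eauto|].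
    split; [exact HaD|]; split; [|exists E'; auto].
    apply HD''; assert (HaX : subset a X) by exact (proj1 OX a Ha).
    split; [exact HaX|].
    destruct HE as [_ HE]; destruct (HE a D HD) as [HDu _].
    apply (ae_mem X D HDu a HaX) in HaD.
    eapply (ae_mono X D HDu); [|exact (ae_and X D HDu _ _ HaD HaeD)]; cbv beta.
    intros b Hb [Hba (D' & HD' & HbD')]; exists D'; split; [exact HD'|].
    destruct HE' as [_ HE']; destruct (HE' b D' HD') as ((_ & _ & _ & Hup & _) & _).
    apply (Hup b a HbD'); [|exact HaX].
    exact (proj1 (ordinal_mem _ _ OX Ha) b Hba).
Qed.

Lemma ketonen_trans (U U' W : V) :
  wf_ultrafilter X W -> ketonen X U' U -> ketonen X U W -> ketonen X U' W.
Proof.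
  intros HW (E' & HE' & Ha' & HU') (E & HE & Ha & HU).
  destruct (family_limits_exist E E' HE HE') as (E'' & HE'' & Hr).
  destruct (ketonen_compose W U U' E E' E'') as [H1 H2]; auto.
  exists E''; split; [exact HE''|]; split; [|exact H1].
  revert H2; apply (ae_mono X W (proj1 HW)).
  intros a _ (D & D'' & _ & HD'' & _ & Ha'' & _); eauto.
Qed.

Definition has_minimal (s : V) : Prop :=
  exists U, U ∈ s /\ forall U', U' ∈ s -> ~ ketonen X U' U.

#[export] Instance has_minimal_definable : Definable1 any has_minimal.
Proof. unfold has_minimal; definability. Qed.

(** Let alpha be least such that an ultrafilter W concentrating on alpha belongs to a set
    S without minimal element.  On the set K of the ultrafilters that concentrate on some
    b < alpha the order is well-founded, hence ranked by ordinals.  Consider the families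
    E whose W-limit is in S.  As W concentrates on alpha, the E(a) are in K for W-almost
    all a.  Take E such that a |-> rank of E(a) is minimal modulo W.  The limit of E is in
    S and has something below it in S; by ketonen_compose this gives another family with
    strictly smaller ranks. *)
Theorem ketonen_well_founded (s : V) :
  nonempty s -> (forall U, U ∈ s -> wf_ultrafilter X U) -> has_minimal s.
Proof.
  set (P := fun alpha : V => exists s W, alpha ∈ W /\ W ∈ s /\
    (forall U, U ∈ s -> wf_ultrafilter X U) /\ ~ has_minimal s).
  assert (HP : Definable1 any P) by (unfold P; definability).
  intros [W0 HW0] Hs0; apply NNPP; intros Hn0.
  destruct (least_ordinal P) as (alpha & Oa & (S & W & HaW & HWS & HS & HSn) & Hmin).
  { exists X; split; [exact OX|]; exists s, W0; split; [apply (Hs0 W0 HW0)|auto]. }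
  clear s W0 HW0 Hs0 Hn0.
  pose proof (HS W HWS) as HWw; pose proof HWw as [HWu _].
  destruct (power_exists X) as [X1 HX1], (power_exists X1) as [X2 HX2].
  assert (HX2u : forall D, wf_ultrafilter X D -> D ∈ X2).
  { intros D [HD _]; apply HX2; intros A HA; apply HX1; apply HD, HA. }
  destruct (separation (fun D => wf_ultrafilter X D /\ exists b, b ∈ alpha /\ b ∈ D) X2)
    as [K HK].
  assert (HKwf : well_founded_on K (ketonen X)).
  { intros t Ht [D HD]; apply NNPP; intros Hn.
    destruct (proj1 (HK D) (Ht D HD)) as (_ & HDw & b & Hb & HbD).
    apply (Hmin b Hb); exists t, D; split; [exact HbD|]; split; [exact HD|].
    split; [|exact Hn]; intros D' HD'; apply HK, Ht, HD'. }
  assert (Ktr : forall x y z, x ∈ K -> y ∈ K -> z ∈ K ->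
    ketonen X x y -> ketonen X y z -> ketonen X x z).
  { intros x y z _ _ Hz; apply ketonen_trans; apply HK, Hz. }
  destruct (funspace_exists X X2) as [F HF].
  destruct (separation (fun E => ultrafilter_family X E /\
    ae W (fun a => exists D, related E a D /\ a ∈ D) /\
    exists U, U ∈ S /\ is_limit X W E U) F) as [T HT].
  assert (HTi : forall E U, ultrafilter_family X E ->
    ae W (fun a => exists D, related E a D /\ a ∈ D) -> U ∈ S -> is_limit X W E U -> E ∈ T).
  { intros E U HE HaE HUS HU; apply HT; split; [|eauto].
    apply HF; destruct HE as [[Y HE] HE']; apply (function_retarget E X Y X2 HE); eauto. }
  assert (Hpred : forall U, U ∈ S -> exists U', U' ∈ S /\ ketonen X U' U).
  { intros U HU; apply NNPP; intros H; apply HSn; exists U; split; [exact HU|].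
    intros U' HU' HK'; apply H; eauto. }
  (* the rank of E(a), with the default value 0 on the W-null set where E(a) is not in K *)
  set (rho := fun E a v : V => (exists D, related E a D /\ collapse K (ketonen X) D v) \/
    (~ exists D, related E a D /\ D ∈ K) /\ ~ nonempty v).
  assert (Hrho : Definable3 any rho) by (unfold rho; definability).
  destruct (minimal_index X W T rho) as (E & HET & HEmin).
  - exact HWw.
  - destruct (Hpred W HWS) as (U & HU & E & HE & HaE & HEU); exists E; eauto.
  - intros E a HE Ha; apply HT in HE as (_ & HE & _).
    destruct (family_value X E a HE Ha) as (D & HD & HDw).
    destruct (classic (D ∈ K)) as [HDK|HDK].
    + destruct (collapse_exists K (ketonen X) HKwf D HDK) as [v Hv].
      exists v; split; [exact (collapse_ordinal K (ketonen X) HKwf Ktr D v Hv)|left; eauto].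
    + destruct (numeral_exists 0) as [v Hv]; exists v; split.
      * apply natural_ordinal, natural_zero, Hv.
      * right; split; [|exact Hv]; intros (D' & HD' & HDK').
        rewrite (family_unique X E a D' D HE HD' HD) in HDK'; auto.
  - intros E a v v' HE Ha; apply HT in HE as (_ & HE & _).
    intros [(D & HD & Hv)|[Hv1 Hv2]] [(D' & HD' & Hv')|[Hv1' Hv2']].
    + rewrite (family_unique X E a D' D HE HD' HD) in Hv'.
      exact (collapse_unique K (ketonen X) HKwf D v v' Hv Hv').
    + destruct Hv1'; exists D; split; [exact HD|eapply collapse_domain; exact Hv].
    + destruct Hv1; exists D'; split; [exact HD'|eapply collapse_domain; exact Hv'].
    + apply empty_unique; assumption.
  - apply HT in HET as (_ & HE & HaE & U & HUS & HU).
    destruct (Hpred U HUS) as (U' & HU'S & E' & HE' & HaE' & HU').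
    destruct (family_limits_exist E E' HE HE') as (E'' & HE'' & Hr).
    destruct (ketonen_compose W U U' E E' E'') as [H1 H2]; auto.
    apply (HEmin E'').
    { apply (HTi E'' U'); auto; revert H2; apply (ae_mono X W HWu).
      intros a _ (D & D'' & _ & HD'' & _ & Ha'' & _); eauto. }
    assert (HaX : subset alpha X) by (apply HWu, HaW).
    apply (ae_mem X W HWu alpha HaX) in HaW.
    eapply (ae_mono X W HWu); [|exact (ae_and X W HWu _ _ HaW H2)]; cbv beta.
    intros a Ha [Haa (D & D'' & HD & HD'' & HaD & HaD'' & HK'')].
    assert (HDK : D ∈ K).
    { destruct HE as [_ HE]; pose proof (HE a D HD); apply HK; eauto 6. }
    assert (HDK'' : D'' ∈ K).
    { destruct HE'' as [_ HE'']; pose proof (HE'' a D'' HD''); apply HK; eauto 6. }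
    destruct (collapse_exists K (ketonen X) HKwf D HDK) as [v Hv].
    destruct (collapse_exists K (ketonen X) HKwf D'' HDK'') as [v'' Hv''].
    exists v'', v; split; [left; eauto|]; split; [left; eauto|].
    exact (collapse_strict K (ketonen X) HKwf D'' D v'' v HK'' Hv'' Hv).
Qed.

End Ketonen.

(** * Elementary embeddings in the whole structure *)

Definition preserves {V : structure} (j : V) (P : (nat -> V) -> Prop) : Prop :=
  forall e e' : nat -> V, (forall n, related j (e n) (e' n)) -> (P e <-> P e').

Definition reflects_witness {V : structure} (A : V) (P : (nat -> V) -> Prop) : Prop :=
  forall e : nat -> V, (forall n, e n ∈ A) ->
    (exists a, P (scons a e)) -> exists a, a ∈ A /\ P (scons a e).

Section Preservation.
Context {V : structure} {HZF : ZF V}.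

Lemma formulas_exist (Ps : list ((nat -> V) -> Prop)) :
  Forall (definable none) Ps ->
  exists L, Forall2 (fun P p => forall e, P e <-> holds e p) Ps L.
Proof.
  induction 1 as [|P Ps HP _ [L HL]]; [exists nil; constructor|].
  apply lightface in HP as [p Hp]; exists (p :: L); constructor; assumption.
Qed.

(** Properties are given as predicates on environments, which spares naming formulas
    when the lemma is used. *)
Lemma preserving_embedding (Ps : list ((nat -> V) -> Prop)) (g x : V) :
  Forall (definable none) Ps -> ordinal g -> has_embeddings g ->
  exists A j k, transitive A /\ x ∈ A /\ is_function j A A /\
    is_critical_point j k /\ k ∈ g /\
    Forall (fun P => preserves j P /\ reflects_witness A P) Ps.
Proof.
  intros HPs Og Hg; destruct (formulas_exist Ps HPs) as [L HL].
  destruct (transfer L g x Og Hg) as (A & j & k & HA & Hx & Hj & Hk & Hkg & H).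
  exists A, j, k; repeat (split; [assumption|]); clear HPs.
  revert H; induction HL as [|P p Ps L HP HL IH]; intros H; constructor.
  - destruct (H p (or_introl eq_refl)) as [Hw Hp]; split.
    + intros e e' He; rewrite !HP; apply Hp, He.
    + intros e He [a Ha]; apply HP in Ha; destruct (Hw e He (ex_intro _ a Ha)) as (b & Hb & Hh).
      exists b; split; [exact Hb|]; apply HP, Hh.
  - apply IH; intros q Hq; apply H; right; exact Hq.
Qed.

Context (j : V).

Lemma preserves_1 (R : V -> Prop) :
  preserves j (fun e => R (e 0)) -> forall x x', related j x x' -> (R x <-> R x').
Proof. intros H x x' Hx; apply (H (fun _ => x) (fun _ => x')); auto. Qed.

Lemma preserves_2 (R : V -> V -> Prop) :
  preserves j (fun e => R (e 0) (e 1)) ->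
  forall x y x' y', related j x x' -> related j y y' -> (R x y <-> R x' y').
Proof.
  intros H x y x' y' Hx Hy; apply (H (scons x (fun _ => y)) (scons x' (fun _ => y'))).
  intros [|n]; assumption.
Qed.

Lemma preserves_3 (R : V -> V -> V -> Prop) :
  preserves j (fun e => R (e 0) (e 1) (e 2)) ->
  forall x y z x' y' z', related j x x' -> related j y y' -> related j z z' ->
    (R x y z <-> R x' y' z').
Proof.
  intros H x y z x' y' z' Hx Hy Hz.
  apply (H (scons x (scons y (fun _ => z))) (scons x' (scons y' (fun _ => z')))).
  intros [|[|n]]; assumption.
Qed.

Lemma preserves_4 (R : V -> V -> V -> V -> Prop) :
  preserves j (fun e => R (e 0) (e 1) (e 2) (e 3)) ->
  forall x y z w x' y' z' w',
    related j x x' -> related j y y' -> related j z z' -> related j w w' ->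
    (R x y z w <-> R x' y' z' w').
Proof.
  intros H x y z w x' y' z' w' Hx Hy Hz Hw.
  apply (H (scons x (scons y (scons z (fun _ => w))))
    (scons x' (scons y' (scons z' (fun _ => w'))))).
  intros [|[|[|n]]]; assumption.
Qed.

Lemma preserves_5 (R : V -> V -> V -> V -> V -> Prop) :
  preserves j (fun e => R (e 0) (e 1) (e 2) (e 3) (e 4)) ->
  forall x y z w t x' y' z' w' t',
    related j x x' -> related j y y' -> related j z z' -> related j w w' ->
    related j t t' -> (R x y z w t <-> R x' y' z' w' t').
Proof.
  intros H x y z w t x' y' z' w' t' Hx Hy Hz Hw Ht.
  apply (H (scons x (scons y (scons z (scons w (fun _ => t)))))
    (scons x' (scons y' (scons z' (scons w' (fun _ => t')))))).
  intros [|[|[|[|n]]]]; assumption.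
Qed.

End Preservation.

(** * Ultrafilters derived from an embedding *)

Definition ordinal_valued {V : structure} (f X : V) : Prop :=
  exists g, ordinal g /\ is_function f X g.

Definition is_meet {V : structure} (c a b : V) : Prop :=
  forall x, x ∈ c <-> x ∈ a /\ x ∈ b.
Definition is_difference {V : structure} (c a b : V) : Prop :=
  forall x, x ∈ c <-> x ∈ a /\ x ∉ b.
Definition is_strictly_below {V : structure} (u X f h : V) : Prop :=
  forall x, x ∈ u <-> x ∈ X /\ exists a b, related f x a /\ related h x b /\ a ∈ b.

Definition descending {V : structure} (T X U : V) : Prop :=
  exists g, ordinal g /\ nonempty T /\ (forall f, f ∈ T -> is_function f X g) /\
    forall f, f ∈ T -> exists f', f' ∈ T /\ memU X U f' f.

Section DerivedUltrafilters.
Context {V : structure} {HZF : ZF V} (A j X : V).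
Context (HA : transitive A) (Hj : is_function j A A).
Context (OX : ordinal X) (HXX : related j X X).
Context (HPX : forall B, subset B X -> B ∈ A).
Context (p_mem : preserves j (fun e => e 0 ∈ e 1))
  (p_subset : preserves j (fun e => subset (e 0) (e 1)))
  (p_nonempty : preserves j (fun e => nonempty (e 0)))
  (p_meet : preserves j (fun e => is_meet (e 0) (e 1) (e 2)))
  (p_difference : preserves j (fun e => is_difference (e 0) (e 1) (e 2)))
  (p_ordinal_valued : preserves j (fun e => ordinal_valued (e 0) (e 1)))
  (p_below : preserves j (fun e => is_strictly_below (e 0) (e 1) (e 2) (e 3)))
  (p_descending : reflects_witness A (fun e => descending (e 0) (e 1) (e 2))).

Lemma embedding_value x : x ∈ A -> exists x', x' ∈ A /\ related j x x'.
Proof. intros Hx; exact (function_total _ _ _ _ Hj Hx). Qed.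

Lemma embedding_unique x y z : related j x y -> related j x z -> y = z.
Proof. apply (function_unique _ _ _ _ _ _ Hj). Qed.

(** If j moved x down to x', it would move x' down as well; so the least such x is
    absurd. *)
Lemma embedding_increasing x x' : ordinal x -> related j x x' -> x' ∉ x.
Proof.
  intros Ox Hx Hn.
  destruct (least_ordinal (fun x => exists x', related j x x' /\ x' ∈ x))
    as (y & Oy & (y' & Hy & Hyy) & Hmin); [eauto|].
  assert (HyA : y ∈ A) by apply (function_values _ _ _ _ _ Hj Hy).
  destruct (embedding_value y') as (y'' & _ & Hy''); [exact (HA y HyA y' Hyy)|].
  apply (Hmin y' Hyy); exists y''; split; [exact Hy''|].
  apply (preserves_2 j _ p_mem y' y y'' y'); auto.
Qed.

Definition is_derived (a D : V) : Prop :=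
  forall B, B ∈ D <-> subset B X /\ exists B', related j B B' /\ a ∈ B'.

Lemma derived_exists a : exists D, is_derived a D.
Proof.
  destruct (power_exists X) as [P HP].
  destruct (separation (fun B => exists B', related j B B' /\ a ∈ B') P) as [D HD].
  exists D; intros B; rewrite HD, HP; tauto.
Qed.

Lemma derived_ultrafilter a D : a ∈ X -> is_derived a D -> is_ultrafilter X D.
Proof.
  intros Ha HD; split; [|split; [|split; [|split; [|split]]]].
  - intros B HB; apply HD, HB.
  - apply HD; split; [intros x Hx; exact Hx|eauto].
  - intros B HB; apply HD in HB as (HB & B' & HBB & HaB).
    apply (preserves_1 j _ p_nonempty B B' HBB); exists a; exact HaB.
  - intros B C HB HBC HC; apply HD in HB as (HB & B' & HBB & HaB); apply HD.
    split; [exact HC|]; destruct (embedding_value C (HPX C HC)) as (C' & _ & HCC).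
    exists C'; split; [exact HCC|].
    apply (proj1 (preserves_2 j _ p_subset B C B' C' HBB HCC) HBC), HaB.
  - intros B C M HB HC HM; apply HD in HB as (HB & B' & HBB & HaB).
    apply HD in HC as (HC & C' & HCC & HaC); apply HD.
    assert (HMX : subset M X) by (intros x Hx; apply HB, HM, Hx).
    split; [exact HMX|]; destruct (embedding_value M (HPX M HMX)) as (M' & _ & HMM).
    exists M'; split; [exact HMM|].
    apply (proj1 (preserves_3 j _ p_meet M B C M' B' C' HMM HBB HCC) HM); auto.
  - intros B C HB HC.
    assert (HCX : subset C X) by (intros x Hx; apply HC, Hx).
    destruct (embedding_value B (HPX B HB)) as (B' & _ & HBB).
    destruct (embedding_value C (HPX C HCX)) as (C' & _ & HCC).
    pose proof (proj1 (preserves_3 j _ p_difference C X B C' X B' HCC HXX HBB) HC) as HC'.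
    destruct (classic (a ∈ B')) as [H|H].
    + left; apply HD; eauto.
    + right; apply HD; split; [exact HCX|]; exists C'; split; [exact HCC|].
      apply HC'; auto.
Qed.

(** The function f |-> j(f)(a) is strictly monotone into the ordinals on functions f in the
    domain of j.  A set T violating well-foundedness may involve large ordinals, but some
    such T is in the domain of j, by reflection. *)
Lemma derived_wf_ultrafilter a D :
  a ∈ X -> D ∈ A -> is_derived a D -> wf_ultrafilter X D.
Proof.
  intros Ha HDA HD; split; [apply (derived_ultrafilter a D Ha HD)|].
  intros g T Og HTn HT; apply NNPP; intros Hn.
  assert (Hdesc : exists T, descending T X D).
  { exists T, g; repeat (split; [assumption|]); intros f Hf; apply NNPP; intros Hf'.
    apply Hn; exists f; split; [exact Hf|]; intros f' Hf1 Hf2; apply Hf'; eauto. }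
  clear g T Og HTn HT Hn.
  destruct (p_descending (scons X (fun _ => D))) as (T & HTA & g & Og & [f0 Hf0] & HT & Hmin).
  { intros [|n]; [apply (function_values _ _ _ _ _ Hj HXX)|exact HDA]. }
  { exact Hdesc. }
  simpl in HT, Hmin.
  assert (Hval : forall f, f ∈ T -> exists f' y, related j f f' /\ related f' a y /\ ordinal y).
  { intros f Hf; destruct (embedding_value f (HA T HTA f Hf)) as (f' & _ & Hff).
    destruct (proj1 (preserves_2 j _ p_ordinal_valued f X f' X Hff HXX))
      as (g' & Og' & Hf'); [exists g; auto|].
    destruct (function_total _ _ _ _ Hf' Ha) as (y & Hy & Hay); exists f', y.
    split; [exact Hff|]; split; [exact Hay|]; eapply ordinal_mem; eassumption. }
  destruct (least_ordinal (fun y => exists f f', f ∈ T /\ related j f f' /\ related f' a y))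
    as (y & Oy & (f & f' & Hf & Hff & Hay) & Hy).
  { destruct (Hval f0 Hf0) as (f' & y & H1 & H2 & Oy); exists y; split; [exact Oy|]; eauto 6. }
  destruct (Hmin f Hf) as (h & Hh & u & Hu & Hux).
  apply HD in Hu as (HuX & u' & Huu & Hau).
  destruct (Hval h Hh) as (h' & z & Hhh & Haz & _).
  pose proof (proj1 (preserves_4 j _ p_below u X h f u' X h' f' Huu HXX Hhh Hff) Hux) as Hbelow.
  apply Hbelow in Hau as (_ & z1 & y1 & Hz1 & Hy1 & Hlt).
  destruct (proj1 (preserves_2 j _ p_ordinal_valued f X f' X Hff HXX)) as (g1 & _ & Hf1);
    [exists g; auto|].
  rewrite (function_unique _ _ _ _ _ _ Hf1 Hy1 Hay) in Hlt.
  apply (Hy z1 Hlt); eauto 6.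
Qed.

Context (HPPX : forall D, (forall B, B ∈ D -> subset B X) -> D ∈ A).
Context (U W : V) (HUW : related j U W) (HW : wf_ultrafilter X W).
Context (HU : is_ultrafilter X U).

Lemma embedding_power B B' : subset B X -> related j B B' -> subset B' X.
Proof.
  intros HB HBB; apply (preserves_2 j _ p_subset B X B' X HBB HXX), HB.
Qed.

(** The family of the derived ultrafilters D(a) has W-limit U, because a in j(B) holds for
    W-almost all a exactly when j(B) is in W = j(U), that is when B is in U. *)
Lemma ketonen_image :
  ae W (fun a => exists a', related j a a' /\ a ∈ a') -> ketonen X U W.
Proof.
  intros Hae; pose proof HW as [HWu _].
  assert (Hf : forall a D D', a ∈ X -> is_derived a D -> is_derived a D' -> D = D').
  { intros a D D' _ HD HD'; apply ext; intros B; rewrite (HD B), (HD' B); tauto. }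
  assert (Hdef : Definable2 any is_derived) by (unfold is_derived; definability).
  destruct (replacement is_derived X Hf) as [Y HY].
  destruct (function_exists is_derived X Y Hf) as (E & HE & HEr).
  { intros a Ha; destruct (derived_exists a) as [D HD]; exists D; split; [apply HY|]; eauto. }
  exists E; split; [split; [eauto|]|split].
  - intros a D HaD; apply HEr in HaD as [Ha HD]; apply (derived_wf_ultrafilter a D Ha); auto.
    apply HPPX; intros B HB; apply HD, HB.
  - revert Hae; apply (ae_mono X W HWu); intros a Ha (a' & Haa & Ha').
    destruct (derived_exists a) as [D HD]; exists D; split; [apply HEr; auto|].
    apply HD; split; [exact (proj1 OX a Ha)|eauto].
  - intros B; split.
    + intros HB; assert (HBX : subset B X) by apply (proj1 HU B HB).
      split; [exact HBX|]; destruct (embedding_value B (HPX B HBX)) as (B' & _ & HBB).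
      apply (preserves_2 j _ p_mem B U B' W HBB HUW) in HB.
      apply (ae_mem X W HWu B' (embedding_power B B' HBX HBB)) in HB.
      revert HB; apply (ae_mono X W HWu); intros a Ha HaB.
      destruct (derived_exists a) as [D HD]; exists D; split; [apply HEr; auto|].
      apply HD; eauto.
    + intros [HBX HB]; destruct (embedding_value B (HPX B HBX)) as (B' & _ & HBB).
      apply (preserves_2 j _ p_mem B U B' W HBB HUW).
      apply (ae_mem X W HWu B' (embedding_power B B' HBX HBB)).
      revert HB; apply (ae_mono X W HWu); intros a Ha (D & HaD & HBD).
      apply HEr in HaD as [_ HD]; apply HD in HBD as (_ & B1 & HB1 & HaB).
      rewrite (embedding_unique B B' B1 HBB HB1); exact HaB.
Qed.

(** By ketonen_image W-almost all points a satisfy that a is not in j(a), hence are fixed.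
    On fixed points B and j(B) agree, so B is in W exactly when j(B) is, which means
    exactly when B is in U. *)
Lemma fixed_ultrafilter :
  ~ ketonen X U W -> U = W /\ ae W (fun a => related j a a).
Proof.
  intros Hk; pose proof HW as [HWu _].
  assert (Hfix : ae W (fun a => related j a a)).
  { destruct (ae_dichotomy X W HWu (fun a => exists a', related j a a' /\ a ∈ a'))
      as [H|H]; [destruct (Hk (ketonen_image H))|].
    assert (HXA : X ∈ A) by apply (function_values _ _ _ _ _ Hj HXX).
    revert H; apply (ae_mono X W HWu); intros a Ha Hn.
    destruct (embedding_value a (HA X HXA a Ha)) as (a' & _ & Haa).
    assert (Ha' : a' ∈ X) by (apply (preserves_2 j _ p_mem a X a' X Haa HXX), Ha).
    pose proof (ordinal_mem _ _ OX Ha) as Oa; pose proof (ordinal_mem _ _ OX Ha') as Oa'.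
    destruct (ordinal_trichotomy a a' Oa Oa') as [H|[H|H]].
    - destruct Hn; eauto.
    - rewrite <- H in Haa; exact Haa.
    - destruct (embedding_increasing a a' Oa Haa H). }
  assert (E : forall B, subset B X -> (B ∈ U <-> B ∈ W)).
  { intros B HBX; destruct (embedding_value B (HPX B HBX)) as (B' & _ & HBB).
    rewrite (preserves_2 j _ p_mem B U B' W HBB HUW), (ae_mem X W HWu B HBX),
      (ae_mem X W HWu B' (embedding_power B B' HBX HBB)).
    split; intros H; (eapply (ae_mono X W HWu); [|exact (ae_and X W HWu _ _ Hfix H)]);
      cbv beta; intros a _ [Haa HaB]; apply (preserves_2 j _ p_mem a B a B' Haa HBB), HaB. }
  split; [|exact Hfix]; apply ext; intros B; split; intros HB; apply E; auto.
  - apply (proj1 HU B HB).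
  - apply (proj1 HWu B HB).
Qed.

End DerivedUltrafilters.

(** * Generators *)

Definition ae_compose {V : structure} (U f h c : V) : Prop :=
  ae U (fun x => exists y z, related c x y /\ related h y z /\ related f x z).

Definition generator {V : structure} (g X U b : V) : Prop :=
  is_function b X g /\
  forall c h, is_function c X g -> is_function h g g -> memU X U c b -> ~ ae_compose U b h c.

(** The set G is quantified here so that the rank is a property of g, X, U and b alone,
    which j can be applied to. *)
Definition generator_rank {V : structure} (g X U b v : V) : Prop :=
  exists G, (forall c, c ∈ G <-> generator g X U c) /\ collapse G (memU X U) b v.

#[export] Instance ae_compose_definable {V : structure} C :
  Definable4 C (@ae_compose V).
Proof. unfold ae_compose; definability. Qed.
#[export] Instance generator_definable {V : structure} C :
  Definable4 C (@generator V).
Proof. unfold generator; definability. Qed.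
#[export] Instance generator_rank_definable {V : structure} C :
  Definable5 C (@generator_rank V).
Proof. unfold generator_rank; definability. Qed.

Section Generators.
Context {V : structure} {HZF : ZF V} (g X U : V).
Context (Og : ordinal g) (HU : wf_ultrafilter X U).

Lemma identity_exists : exists i, is_function i g g /\ forall x, x ∈ g -> related i x x.
Proof.
  destruct (function_exists (fun x y => y = x) g g) as (i & Hi & Hr).
  - intros x y z _ -> ->; reflexivity.
  - intros x Hx; eauto.
  - exists i; split; [exact Hi|]; intros x Hx; apply Hr; auto.
Qed.

Lemma ae_compose_trans f h c h' d :
  is_function c X g -> is_function h g g -> is_function h' g g ->
  ae_compose U f h c -> ae_compose U c h' d ->
  exists k, is_function k g g /\ ae_compose U f k d.
Proof.
  intros Hc Hh Hh' H1 H2; destruct (compose_exists _ _ _ _ _ Hh' Hh) as (k & Hk & Hr).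
  exists k; split; [exact Hk|]; destruct HU as [HUu _].
  eapply (ae_mono X U HUu); [|exact (ae_and X U HUu _ _ H1 H2)]; cbv beta.
  intros x _ [(y & z & Hy & Hyz & Hz) (y' & z' & Hy' & Hyz' & Hz')].
  rewrite (function_unique _ _ _ _ _ _ Hc Hy Hz') in Hyz.
  exists y', z; split; [exact Hy'|]; split; [apply Hr; eauto|exact Hz].
Qed.

Lemma generators_generate f :
  is_function f X g ->
  exists b h, generator g X U b /\ is_function h g g /\ ae_compose U f h b.
Proof.
  intros Hf; destruct HU as [HUu Hwf].
  destruct (funspace_exists X g) as [F HF].
  destruct (separation (fun c => exists h, is_function h g g /\ ae_compose U f h c) F)
    as [T HT].
  destruct (Hwf g T Og) as (b & Hb & Hmin).
  - destruct identity_exists as (i & Hi & Hid); exists f; apply HT; split; [apply HF, Hf|].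
    exists i; split; [exact Hi|]; apply (ae_all X U HUu); intros x Hx.
    destruct (function_total _ _ _ _ Hf Hx) as (y & Hy & Hxy); exists y, y; auto.
  - intros c Hc; apply HF, HT, Hc.
  - apply HT in Hb as [Hb (h & Hh & Hfb)]; apply HF in Hb.
    exists b, h; split; [split; [exact Hb|]|auto].
    intros c h' Hc Hh' Hcb Hbc.
    destruct (ae_compose_trans f h b h' c) as (k & Hk & Hfk); auto.
    apply (Hmin c); [apply HT; split; [apply HF, Hc|eauto]|exact Hcb].
Qed.

Context (G : V) (HG : forall c, c ∈ G <-> generator g X U c).

Lemma generators_function c : c ∈ G -> is_function c X g.
Proof. intros H; apply HG, H. Qed.

Lemma generators_well_founded : well_founded_on G (memU X U).
Proof. apply (memU_well_founded X U g); auto using generators_function. Qed.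

Lemma generator_rank_iff b v : generator_rank g X U b v <-> collapse G (memU X U) b v.
Proof.
  split; [|intros H; exists G; auto].
  intros (G' & HG' & H); replace G with G'; [exact H|].
  apply ext; intros c; rewrite HG; apply HG'.
Qed.

Lemma generator_rank_ordinal b v : collapse G (memU X U) b v -> ordinal v.
Proof.
  apply (collapse_ordinal G (memU X U) generators_well_founded).
  intros x y z Hx Hy Hz; apply (memU_trans X U (proj1 HU) g); auto using generators_function.
Qed.

Lemma generator_rank_injective b c v :
  collapse G (memU X U) b v -> collapse G (memU X U) c v -> eqU X U b c.
Proof.
  intros Hb Hc.
  pose proof (generators_function b (collapse_domain _ _ _ _ Hb)) as Fb.
  pose proof (generators_function c (collapse_domain _ _ _ _ Hc)) as Fc.
  destruct (memU_trichotomy X U (proj1 HU) g b c Og Fb Fc) as [H|[H|H]]; [|exact H|].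
  - destruct (not_mem_self v).
    eapply (collapse_strict G (memU X U)); eauto using generators_well_founded.
  - destruct (not_mem_self v).
    eapply (collapse_strict G (memU X U)); eauto using generators_well_founded.
Qed.

Lemma generator_rank_eqU b c u v :
  eqU X U b c -> collapse G (memU X U) b u -> collapse G (memU X U) c v -> u = v.
Proof.
  intros H Hb Hc.
  pose proof (generators_function b (collapse_domain _ _ _ _ Hb)) as Fb.
  pose proof (generators_function c (collapse_domain _ _ _ _ Hc)) as Fc.
  pose proof (proj1 HU) as HUu.
  pose proof generators_well_founded as Hwf.
  apply ext; intros w.
  rewrite (collapse_mem G (memU X U) Hwf b u w Hb).
  rewrite (collapse_mem G (memU X U) Hwf c v w Hc).
  split; intros (y & Hy & Hlt & Hw); exists y; (split; [exact Hy|]; split; [|exact Hw]).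
  - pose proof (generators_function y Hy).
    apply (memU_eqU X U HUu g y y b c); auto; eapply eqU_refl; eassumption.
  - pose proof (generators_function y Hy).
    apply (memU_eqU X U HUu g y y c b); auto; [eapply eqU_refl|eapply eqU_sym]; eassumption.
Qed.

End Generators.

(** A surjection onto the ultrapower in terms of functions instead of classes: S is
    single-valued modulo U only. *)
Definition enumerates {V : structure} (g X U S : V) : Prop :=
  (forall h f, related S h f -> is_function h g g /\ is_function f X g) /\
  (forall h f f', related S h f -> related S h f' -> eqU X U f f') /\
  (forall f, is_function f X g -> exists h, related S h f).

Definition counterexample {V : structure} (g X U : V) : Prop :=
  wf_ultrafilter X U /\ ~ exists S, enumerates g X U S.

(** * Generators under an embedding that fixes the ultrafilter *)

Section FixedGenerators.
Context {V : structure} {HZF : ZF V} (A j k g X U : V).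
Context (HA : transitive A) (Hj : is_function j A A).
Context (Hk : is_critical_point j k) (Hkg : k ∈ g).
Context (Og : ordinal g) (HU : wf_ultrafilter X U).
Context (Hgg : related j g g) (HXX : related j X X) (HUU : related j U U).
Context (Hfix : ae U (fun a => related j a a)).
Context (HFA : forall f, is_function f X g -> f ∈ A).
Context (HRA : forall b v, generator_rank g X U b v -> v ∈ A).
Context (p_mem : preserves j (fun e => e 0 ∈ e 1))
  (p_related : preserves j (fun e => related (e 0) (e 1) (e 2)))
  (p_generator : preserves j (fun e => generator (e 0) (e 1) (e 2) (e 3)))
  (p_rank : preserves j (fun e => generator_rank (e 0) (e 1) (e 2) (e 3) (e 4))).

Lemma restriction_exists :
  exists jg, is_function jg g g /\ forall x y, related jg x y <-> x ∈ g /\ related j x y.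
Proof.
  apply (function_exists (related j)).
  - intros x y z _; apply (function_unique _ _ _ _ _ _ Hj).
  - intros x Hx.
    assert (HgA : g ∈ A) by apply (function_values _ _ _ _ _ Hj Hgg).
    destruct (function_total _ _ _ _ Hj (HA g HgA x Hx)) as (y & _ & Hy); exists y.
    split; [|exact Hy]; apply (preserves_2 j _ p_mem x g y g Hy Hgg), Hx.
Qed.

(** At a fixed point a, j(f)(a) = j(f)(j(a)) = j(f(a)). *)
Lemma image_value f f' jg :
  is_function f X g -> related j f f' ->
  (forall x y, related jg x y <-> x ∈ g /\ related j x y) -> ae_compose U f' jg f.
Proof.
  intros Hf Hff Hjg; revert Hfix; apply (ae_mono X U (proj1 HU)); intros a Ha Haa.
  destruct (function_total _ _ _ _ Hf Ha) as (y & Hy & Hay).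
  assert (HgA : g ∈ A) by apply (function_values _ _ _ _ _ Hj Hgg).
  destruct (function_total _ _ _ _ Hj (HA g HgA y Hy)) as (z & _ & Hz).
  exists y, z; split; [exact Hay|]; split; [apply Hjg; auto|].
  apply (preserves_3 j _ p_related f a y f' a z Hff Haa Hz), Hay.
Qed.

Lemma generator_fixed b b' :
  generator g X U b -> related j b b' -> generator g X U b' /\ eqU X U b b'.
Proof.
  intros Hb Hbb.
  assert (Hb' : generator g X U b')
    by (apply (preserves_4 j _ p_generator g X U b g X U b'); assumption).
  split; [exact Hb'|]; pose proof (proj1 HU) as HUu.
  destruct restriction_exists as (jg & Hjg & Hr).
  pose proof (image_value b b' jg (proj1 Hb) Hbb Hr) as Hc.
  destruct (memU_trichotomy X U HUu g b b' Og (proj1 Hb) (proj1 Hb')) as [H|[H|H]].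
  - destruct (proj2 Hb' b jg (proj1 Hb) Hjg H Hc).
  - exact H.
  - apply (memU_ae X U HUu) in H.
    destruct (ae_contradiction X U HUu _ _ H Hc).
    intros a _ (z & y & Hz & Hy & Hzy) (y1 & z1 & Hy1 & Hyz & Hz1).
    rewrite (function_unique _ _ _ _ _ _ (proj1 Hb) Hy Hy1) in Hzy.
    rewrite (function_unique _ _ _ _ _ _ (proj1 Hb') Hz Hz1) in Hzy.
    apply Hr in Hyz as [Hyg Hyz].
    apply (embedding_increasing A j HA Hj p_mem y1 z1); auto.
    eapply ordinal_mem; eassumption.
Qed.

(** By elementarity j(v) is the rank of j(b), and j(b) =_U b has the same rank as b. *)
Lemma generator_rank_fixed b v : generator_rank g X U b v -> related j v v.
Proof.
  intros Hv; pose proof Hv as (G & HG & Hc).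
  assert (Hb : generator g X U b) by (apply HG; eapply collapse_domain; exact Hc).
  destruct (function_total _ _ _ _ Hj (HFA b (proj1 Hb))) as (b' & _ & Hbb).
  destruct (function_total _ _ _ _ Hj (HRA b v Hv)) as (v' & _ & Hvv).
  destruct (generator_fixed b b' Hb Hbb) as [Hb' He].
  apply (preserves_5 j _ p_rank g X U b v g X U b' v') in Hv; auto.
  apply (generator_rank_iff g X U G HG) in Hv.
  rewrite <- (generator_rank_eqU g X U Og HU G HG b b' v v' He Hc Hv) in Hvv; exact Hvv.
Qed.

(** Were v at least k, then k itself would be the rank of a generator, as the ranks form
    an initial segment; but k is not fixed. *)
Lemma generator_rank_below_critical b v : generator_rank g X U b v -> v ∈ k.
Proof.
  intros Hv; destruct Hk as (Ok & (y & Hky & Hyk) & _); apply is_ordinal_iff in Ok.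
  assert (Hkk : ~ related j k k).
  { intros H; apply Hyk, (function_unique _ _ _ _ _ _ Hj Hky H). }
  pose proof Hv as (G & HG & Hc).
  pose proof (generator_rank_ordinal g X U Og HU G HG b v Hc) as Ov.
  destruct (ordinal_trichotomy v k Ov Ok) as [H|[->|H]]; [exact H| |].
  - destruct (Hkk (generator_rank_fixed b k Hv)).
  - pose proof (generators_well_founded g X U Og HU G HG) as Hwf.
    apply (collapse_mem G (memU X U) Hwf b v k Hc)
      in H as (c & _ & _ & Hck).
    destruct Hkk; apply (generator_rank_fixed c k); exists G; auto.
Qed.

Lemma critical_not_in_range x : x ∈ g -> ~ related j x k.
Proof.
  intros Hx H; destruct Hk as (Ok & (y & Hky & Hyk) & Hlow); apply is_ordinal_iff in Ok.
  pose proof (ordinal_mem _ _ Og Hx) as Ox.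
  destruct (ordinal_trichotomy x k Ox Ok) as [H'|[->|H']].
  - rewrite (function_unique _ _ _ _ _ _ Hj H (Hlow x H')) in H'.
    apply (not_mem_self x H').
  - apply Hyk, (function_unique _ _ _ _ _ _ Hj Hky H).
  - exact (embedding_increasing A j HA Hj p_mem x k Ox H H').
Qed.

Lemma embedding_injective x x' y :
  x ∈ g -> x' ∈ g -> related j x y -> related j x' y -> x = x'.
Proof.
  intros Hx Hx' H H'.
  destruct (ordinal_trichotomy x x') as [E|[E|E]]; [| |destruct (not_mem_self y)|exact E|
    destruct (not_mem_self y)].
  - eapply ordinal_mem; eassumption.
  - eapply ordinal_mem; eassumption.
  - apply (preserves_2 j _ p_mem x x' y y H H'), E.
  - apply (preserves_2 j _ p_mem x' x y y H' H), E.
Qed.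

Lemma enumeration_exists : exists S, enumerates g X U S.
Proof.
  destruct restriction_exists as (jg & Hjg & Hjr); pose proof (proj1 HU) as HUu.
  destruct (funspace_exists g g) as [H HH], (funspace_exists X g) as [F HF].
  set (phi := fun h f : V => is_function h g g /\ is_function f X g /\
    exists v b, related h k v /\ generator_rank g X U b v /\
      ae U (fun a => exists y z w, related b a y /\ related jg y z /\ related h z w /\
        related f a w)).
  assert (Hphi : Definable2 any phi) by (unfold phi; definability).
  destruct (product_exists H F) as [P HP].
  destruct (separation (fun p => exists h f, is_pair h f p /\ phi h f) P) as [S HS].
  assert (HSr : forall h f, related S h f <-> phi h f).
  { intros h f; split.
    - intros (p & Hp & HpS); apply HS in HpS as (_ & h' & f' & Hp' & Hf).
      destruct (pair_injective _ _ _ _ _ Hp Hp') as [-> ->]; exact Hf.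
    - intros Hf; destruct (pair_exists h f) as [p Hp]; exists p; split; [exact Hp|].
      apply HS; split; [|eauto]; apply HP; exists h, f.
      split; [apply HH, Hf|]; split; [apply HF, Hf|exact Hp]. }
  exists S; split; [|split].
  - intros h f Hf; apply HSr in Hf as (H1 & H2 & _); auto.
  - intros h f f' Hf Hf'; apply HSr in Hf as (Hh & Hf & v & b & Hv & Hb & Hae).
    apply HSr in Hf' as (_ & Hf' & v' & b' & Hv' & Hb' & Hae').
    rewrite <- (function_unique _ _ _ _ _ _ Hh Hv Hv') in Hb'.
    pose proof Hb as (G & HG & Hc); apply (generator_rank_iff g X U G HG) in Hb'.
    pose proof (generator_rank_injective g X U Og HU G HG b b' v Hc Hb') as He.
    pose proof (generators_function g X U G HG b (collapse_domain _ _ _ _ Hc)) as Fb.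
    pose proof (generators_function g X U G HG b' (collapse_domain _ _ _ _ Hb')) as Fb'.
    apply (eqU_ae X U HUu) in He; apply (eqU_ae X U HUu).
    eapply (ae_mono X U HUu); [|exact (ae_and X U HUu _ _ He (ae_and X U HUu _ _ Hae Hae'))].
    cbv beta; intros a _ ((y0 & Hy0 & Hy0') & (y & z & w & Hy & Hz & Hw & Hfw) &
      (y' & z' & w' & Hy' & Hz' & Hw' & Hfw')).
    rewrite (function_unique _ _ _ _ _ _ Fb Hy Hy0) in Hz.
    rewrite (function_unique _ _ _ _ _ _ Fb' Hy' Hy0') in Hz'.
    rewrite (function_unique _ _ _ _ _ _ Hjg Hz Hz') in Hw.
    rewrite (function_unique _ _ _ _ _ _ Hh Hw Hw') in Hfw; eauto.
  - intros f Hf.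
    destruct (generators_generate g X U Og HU f Hf) as (b & h0 & Hb & Hh0 & Hae).
    destruct (separation (generator g X U) F) as [G HG0].
    assert (HG : forall c, c ∈ G <-> generator g X U c).
    { intros c; rewrite HG0; split; [tauto|]; intros Hc; split; [apply HF, Hc|exact Hc]. }
    destruct (collapse_exists G (memU X U)
      (generators_well_founded g X U Og HU G HG) b) as [v Hv]; [apply HG, Hb|].
    assert (Hr : generator_rank g X U b v) by (exists G; auto).
    pose proof (generator_rank_below_critical b v Hr) as Hvk.
    assert (Hvg : v ∈ g) by (eapply ordinal_trans; eassumption).
    (* h codes h0 on the range of j, and the rank v elsewhere, in particular at k *)
    destruct (function_exists (fun y z => (exists x, x ∈ g /\ related j x y /\ related h0 x z) \/
      (~ exists x, x ∈ g /\ related j x y) /\ z = v) g g) as (h & Hh & Hhr).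
    + intros y z z' _ [(x & Hx & Hxy & Hz)|[Hn ->]] [(x' & Hx' & Hxy' & Hz')|[Hn' ->]].
      * rewrite (embedding_injective x x' y Hx Hx' Hxy Hxy') in Hz.
        exact (function_unique _ _ _ _ _ _ Hh0 Hz Hz').
      * destruct Hn'; eauto.
      * destruct Hn; eauto.
      * reflexivity.
    + intros y Hy; destruct (classic (exists x, x ∈ g /\ related j x y)) as [(x & Hx & Hxy)|Hn].
      * destruct (function_total _ _ _ _ Hh0 Hx) as (z & Hz & Hxz); exists z; split; [exact Hz|].
        left; eauto.
      * exists v; split; [exact Hvg|]; right; auto.
    + exists h; apply HSr; split; [exact Hh|]; split; [exact Hf|].
      exists v, b; split; [|split; [exact Hr|]].
      * apply Hhr; split; [exact Hkg|]; right; split; [|reflexivity].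
        intros (x & Hx & Hxk); exact (critical_not_in_range x Hx Hxk).
      * revert Hae; apply (ae_mono X U HUu); intros a _ (y & w & Hy & Hw & Hfw).
        assert (Hyg : y ∈ g) by apply (function_values _ _ _ _ _ Hh0 Hw).
        destruct (function_total _ _ _ _ Hjg Hyg) as (z & Hzg & Hz).
        exists y, z, w; split; [exact Hy|]; split; [exact Hz|]; split; [|exact Hfw].
        apply Hhr; split; [exact Hzg|]; left; exists y; split; [exact Hyg|].
        split; [apply Hjr, Hz|exact Hw].
Qed.

End FixedGenerators.

(** * The minimal counterexample *)

Definition bad_ordinal {V : structure} (g : V) : Prop :=
  ordinal g /\ has_embeddings g /\ exists X U, ordinal X /\ counterexample g X U.
Definition least_bad_ordinal {V : structure} (g : V) : Prop :=
  bad_ordinal g /\ forall g', g' ∈ g -> ~ bad_ordinal g'.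
Definition least_bad_index {V : structure} (g X : V) : Prop :=
  (ordinal X /\ exists U, counterexample g X U) /\
  forall X', X' ∈ X -> ~ exists U, counterexample g X' U.
Definition minimal_counterexample {V : structure} (g X U : V) : Prop :=
  counterexample g X U /\ forall U', counterexample g X U' -> ~ ketonen X U' U.

#[export] Instance counterexample_definable {V : structure} C :
  Definable3 C (@counterexample V).
Proof. unfold counterexample, enumerates; definability. Qed.
#[export] Instance bad_ordinal_definable {V : structure} C :
  Definable1 C (@bad_ordinal V).
Proof. unfold bad_ordinal, has_embeddings; definability. Qed.

Section Main.
Context {V : structure} {HZF : ZF V}.

Lemma finite_set_exists (l : list V) : exists s, forall y, In y l -> y ∈ s.
Proof.
  induction l as [|x l [s Hs]].
  - destruct (numeral_exists (V := V) 0) as [s _]; exists s; simpl; tauto.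
  - destruct (upair_exists x x) as [p Hp], (union2_exists s p) as [t Ht].
    exists t; intros y [<-|Hy]; apply Ht; [right; apply Hp; auto|auto].
Qed.

(** The list of formulas contains the definitions of gamma, X and the minimality of U,
    so that j fixes the first two and keeps the third; the others are those used by the
    arguments on derived ultrafilters and on generators. *)
Theorem no_bad_ordinal (g : V) : ~ bad_ordinal g.
Proof.
  intros Hbad.
  destruct (least_ordinal bad_ordinal) as (g0 & Og & Hg0 & Lg0);
    [exists g; split; [apply Hbad|exact Hbad]|].
  clear g Hbad; rename g0 into g.
  destruct (least_ordinal (fun X => exists U, counterexample g X U))
    as (X & OX & HX & LX).
  { destruct Hg0 as (_ & _ & X & U & OX & HU); eauto. }
  destruct (power_exists X) as [PX HPX], (power_exists PX) as [PPX HPPX].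
  destruct (separation (counterexample g X) PPX) as [s Hs].
  assert (Hs' : forall U, counterexample g X U -> U ∈ s).
  { intros U HU; apply Hs; split; [|exact HU]; apply HPPX; intros B HB; apply HPX.
    destruct HU as [[HU _] _]; apply (proj1 HU B HB). }
  destruct (ketonen_well_founded X OX s) as (U & HU & HUmin).
  { destruct HX as [U HU]; exists U; auto. }
  { intros U HU; apply Hs in HU as (_ & HU & _); exact HU. }
  apply Hs in HU as [_ HU]; pose proof HU as [HUw HUn].
  destruct (funspace_exists X g) as [F HF].
  destruct (separation (generator g X U) F) as [G HG0].
  assert (HG : forall c, c ∈ G <-> generator g X U c).
  { intros c; rewrite HG0; split; [tauto|]; intros Hc; split; [apply HF, Hc|exact Hc]. }
  pose proof (generators_well_founded g X U Og HUw G HG) as HGwf.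
  destruct (replacement (collapse G (memU X U)) G) as [R HR].
  { intros b v v' _; apply (collapse_unique G (memU X U) HGwf). }
  destruct (finite_set_exists (g :: X :: U :: PX :: PPX :: F :: R :: nil)) as [S HS].
  destruct (preserving_embedding (
    (fun e => e 0 ∈ e 1) ::
    (fun e => subset (e 0) (e 1)) ::
    (fun e => nonempty (e 0)) ::
    (fun e => is_meet (e 0) (e 1) (e 2)) ::
    (fun e => is_difference (e 0) (e 1) (e 2)) ::
    (fun e => ordinal_valued (e 0) (e 1)) ::
    (fun e => is_strictly_below (e 0) (e 1) (e 2) (e 3)) ::
    (fun e => descending (e 0) (e 1) (e 2)) ::
    (fun e => related (e 0) (e 1) (e 2)) ::
    (fun e => generator (e 0) (e 1) (e 2) (e 3)) ::
    (fun e => generator_rank (e 0) (e 1) (e 2) (e 3) (e 4)) ::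
    (fun e => least_bad_ordinal (e 0)) ::
    (fun e => least_bad_index (e 0) (e 1)) ::
    (fun e => minimal_counterexample (e 0) (e 1) (e 2)) :: nil) g S)
    as (A & j & k & HA & HSA & Hj & Hk & Hkg & Hpres).
  { unfold is_meet, is_difference, ordinal_valued, is_strictly_below, descending,
      least_bad_ordinal, least_bad_index, minimal_counterexample.
    repeat (apply Forall_cons; [definability|]); apply Forall_nil. }
  { exact Og. }
  { apply Hg0. }
  assert (HinA : forall y, In y (g :: X :: U :: PX :: PPX :: F :: R :: nil) -> y ∈ A)
    by (intros y Hy; apply (HA S HSA), HS, Hy).
  do 14 rewrite Forall_cons_iff in Hpres.
  destruct Hpres as ([p_mem _] & [p_subset _] & [p_nonempty _] & [p_meet _] &
    [p_difference _] & [p_ordinal_valued _] & [p_below _] & [_ p_descending] &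
    [p_related _] & [p_generator _] & [p_rank _] & [p_ordinal _] &
    [p_index _] & [p_minimal _] & _).
  assert (Hvalue : forall x, x ∈ A -> exists x', related j x x').
  { intros x Hx; destruct (function_total _ _ _ _ Hj Hx) as (y & _ & Hy); eauto. }
  assert (Hgg : related j g g).
  { destruct (Hvalue g) as [g' Hg']; [apply HinA; simpl; auto|].
    assert (H : least_bad_ordinal g') by (apply (preserves_1 j _ p_ordinal g g' Hg'); split; auto).
    destruct H as [H1 H2].
    rewrite (least_ordinal_unique bad_ordinal g g') at 2; auto; apply H1. }
  assert (HXX : related j X X).
  { destruct (Hvalue X) as [X' HX']; [apply HinA; simpl; auto|].
    assert (H : least_bad_index g X')
      by (apply (preserves_2 j _ p_index g X g X' Hgg HX'); split; auto).
    destruct H as [[H0 H1] H2].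
    rewrite (least_ordinal_unique (fun X => exists U, counterexample g X U) X X') at 2; auto. }
  assert (HUmin' : minimal_counterexample g X U).
  { split; [exact HU|]; intros U' HU'; apply HUmin, Hs', HU'. }
  destruct (Hvalue U) as [W HUW]; [apply HinA; simpl; auto|].
  pose proof HUmin' as HWmin.
  apply (preserves_3 j _ p_minimal g X U g X W Hgg HXX HUW) in HWmin.
  assert (HPXA : forall B, subset B X -> B ∈ A).
  { intros B HB; apply (HA PX); [apply HinA; simpl; auto|]; apply HPX, HB. }
  assert (HPPXA : forall D, (forall B, B ∈ D -> subset B X) -> D ∈ A).
  { intros D HD; apply (HA PPX); [apply HinA; simpl; auto 6|].
    apply HPPX; intros B HB; apply HPX, HD, HB. }
  destruct (fixed_ultrafilter A j X HA Hj OX HXX HPXA p_mem p_subset p_nonempty p_meet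
    p_difference p_ordinal_valued p_below p_descending HPPXA U W HUW
    (proj1 (proj1 HWmin)) (proj1 HUw) (proj2 HWmin U HU)) as [<- Hfix].
  apply HUn; apply (enumeration_exists A j k g X U HA Hj Hk Hkg Og HUw Hgg HXX HUW Hfix); auto.
  - intros f Hf; apply (HA F); [apply HinA; simpl; auto 8|]; apply HF, Hf.
  - intros b v Hv; apply (HA R); [apply HinA; simpl; auto 8|].
    apply (generator_rank_iff g X U G HG) in Hv; apply HR; exists b; split; [|exact Hv].
    eapply collapse_domain; exact Hv.
Qed.

Lemma rank_Berkeley_embeddings (lambda g : V) :
  rank_Berkeley lambda -> is_ordinal g -> lambda ∈ g -> has_embeddings g.
Proof.
  intros (Hc & [z Hz] & HB) Hg Hlg eta Heta Hge; apply is_ordinal_iff in Hg.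
  assert (Hle : lambda ∈ eta)
    by (apply is_ordinal_iff in Heta; eapply ordinal_trans; eassumption).
  destruct (HB eta z Heta Hle Hz) as (v & j & k & Hv & Hj & Hk & _ & Hkl).
  exists v, j, k; repeat (split; [assumption|]); eapply ordinal_trans; eassumption.
Qed.

Lemma enumerated_on_ordinals (g X U : V) :
  ordinal g -> has_embeddings g -> ordinal X -> wf_ultrafilter X U ->
  exists S, enumerates g X U S.
Proof.
  intros Og Hg OX HU; apply NNPP; intros Hn; apply (no_bad_ordinal g).
  split; [exact Og|]; split; [exact Hg|]; exists X, U; split; [exact OX|split; assumption].
Qed.

End Main.

(** * Transport along a bijection *)

Definition is_pullback {V : structure} (p f' f : V) : Prop :=
  forall x z, related f x z <-> exists y, related p x y /\ related f' y z.

#[export] Instance is_pullback_definable {V : structure} C :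
  Definable3 C (@is_pullback V).
Proof. unfold is_pullback; definability. Qed.

Section Transport.
Context {V : structure} {HZF : ZF V} (X Y p U : V).
Context (Hp : is_bijection p X Y) (HU : wf_ultrafilter X U).

Definition is_pushforward (U' : V) : Prop :=
  forall B, B ∈ U' <-> subset B Y /\ ae U (fun x => exists y, related p x y /\ y ∈ B).

Lemma pushforward_exists : exists U', is_pushforward U'.
Proof.
  destruct (power_exists Y) as [P HP].
  destruct (separation (fun B => ae U (fun x => exists y, related p x y /\ y ∈ B)) P)
    as [U' HU'].
  exists U'; intros B; rewrite HU', HP; tauto.
Qed.

Lemma bijection_value x : x ∈ X -> exists y, y ∈ Y /\ related p x y.
Proof. apply (function_total _ _ _ _ (proj1 (proj1 Hp))). Qed.

Lemma bijection_preimage y : y ∈ Y -> exists x, x ∈ X /\ related p x y.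
Proof. apply (proj2 (proj1 Hp)). Qed.

Lemma bijection_unique x y y' : related p x y -> related p x y' -> y = y'.
Proof. apply (function_unique _ _ _ _ _ _ (proj1 (proj1 Hp))). Qed.

Lemma bijection_injective x x' y : related p x y -> related p x' y -> x = x'.
Proof. apply (proj2 Hp). Qed.

Context (U' : V) (HU' : is_pushforward U').

Lemma pushforward_ultrafilter : is_ultrafilter Y U'.
Proof.
  pose proof (proj1 HU) as HUu.
  split; [|split; [|split; [|split; [|split]]]].
  - intros B HB; apply HU', HB.
  - apply HU'; split; [intros x Hx; exact Hx|]; apply (ae_all X U HUu); intros x Hx.
    destruct (bijection_value x Hx) as (y & Hy & Hxy); eauto.
  - intros B HB; apply HU' in HB as [_ HB].
    apply (ae_exists X U HUu) in HB as (x & _ & y & _ & Hy); exists y; exact Hy.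
  - intros B C HB HBC HC; apply HU' in HB as [_ HB]; apply HU'; split; [exact HC|].
    revert HB; apply (ae_mono X U HUu); intros x _ (y & Hxy & Hy); eauto.
  - intros B C D HB HC HD; apply HU' in HB as [HBY HB], HC as [_ HC]; apply HU'.
    split; [intros y Hy; apply HBY, HD, Hy|].
    eapply (ae_mono X U HUu); [|exact (ae_and X U HUu _ _ HB HC)]; cbv beta.
    intros x _ [(y & Hxy & Hy) (y' & Hxy' & Hy')]; exists y; split; [exact Hxy|].
    rewrite (bijection_unique x y' y Hxy' Hxy) in Hy'; apply HD; auto.
  - intros B C HB HC.
    destruct (ae_dichotomy X U HUu (fun x => exists y, related p x y /\ y ∈ B)) as [H|H].
    + left; apply HU'; auto.
    + right; apply HU'; split; [intros y Hy; apply HC, Hy|].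
      revert H; apply (ae_mono X U HUu); intros x Hx Hn.
      destruct (bijection_value x Hx) as (y & Hy & Hxy); exists y; split; [exact Hxy|].
      apply HC; split; [exact Hy|]; intros HyB; apply Hn; eauto.
Qed.

Lemma ae_pushforward (P : V -> Prop) {HP : Definable1 any P} :
  (ae U' P <-> ae U (fun x => exists y, related p x y /\ P y)).
Proof.
  destruct (separation P Y) as [B HB]; pose proof (proj1 HU) as HUu.
  assert (HBY : subset B Y) by (intros y Hy; apply HB, Hy).
  pose proof pushforward_ultrafilter as HUu'.
  assert (H1 : ae U' P <-> B ∈ U').
  { rewrite (ae_mem Y U' HUu' B HBY).
    split; apply (ae_mono Y U' HUu'); intros y Hy; rewrite (HB y); tauto. }
  rewrite H1, (HU' B); split.
  - intros [_ H]; revert H; apply (ae_mono X U HUu); intros x _ (y & Hxy & Hy).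
    exists y; split; [exact Hxy|apply HB, Hy].
  - intros H; split; [exact HBY|]; revert H; apply (ae_mono X U HUu).
    intros x Hx (y & Hxy & Hy); exists y; split; [exact Hxy|]; apply HB.
    split; [|exact Hy]; apply (function_values _ _ _ _ _ (proj1 (proj1 Hp)) Hxy).
Qed.

Lemma pullback_exists f' g :
  is_function f' Y g -> exists f, is_function f X g /\ is_pullback p f' f.
Proof. apply (compose_exists p f' X Y g (proj1 (proj1 Hp))). Qed.

Lemma pullback_inverse f g :
  is_function f X g -> exists f', is_function f' Y g /\ is_pullback p f' f.
Proof.
  intros Hf.
  destruct (function_exists (fun y z => exists x, related p x y /\ related f x z) Y g)
    as (f' & Hf' & Hr).
  - intros y z z' _ (x & Hx & Hz) (x' & Hx' & Hz').
    rewrite (bijection_injective x' x y Hx' Hx) in Hz'.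
    exact (function_unique _ _ _ _ _ _ Hf Hz Hz').
  - intros y Hy; destruct (bijection_preimage y Hy) as (x & Hx & Hxy).
    destruct (function_total _ _ _ _ Hf Hx) as (z & Hz & Hxz); eauto.
  - exists f'; split; [exact Hf'|]; intros x z; split.
    + intros Hz; destruct (function_values _ _ _ _ _ Hf Hz) as [Hx _].
      destruct (bijection_value x Hx) as (y & Hy & Hxy); exists y; split; [exact Hxy|].
      apply Hr; eauto.
    + intros (y & Hxy & Hz); apply Hr in Hz as (_ & x' & Hx' & Hz).
      rewrite (bijection_injective x x' y Hxy Hx'); exact Hz.
Qed.

Lemma pullback_memU f f' h h' g :
  is_function f' Y g -> is_function h' Y g -> is_pullback p f' f -> is_pullback p h' h ->
  (memU Y U' f' h' <-> memU X U f h).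
Proof.
  intros Ff' Fh' Hf Hh; pose proof (proj1 HU) as HUu.
  rewrite (memU_ae Y U' pushforward_ultrafilter), (memU_ae X U HUu), (ae_pushforward
    (fun x => exists a b, related f' x a /\ related h' x b /\ a ∈ b)).
  split; apply (ae_mono X U HUu); intros x Hx.
  - intros (y & Hxy & a & b & Ha & Hb & Hab); exists a, b.
    split; [apply Hf; eauto|]; split; [apply Hh; eauto|exact Hab].
  - intros (a & b & Ha & Hb & Hab); apply Hf in Ha as (y & Hxy & Ha).
    apply Hh in Hb as (y' & Hxy' & Hb); exists y; split; [exact Hxy|].
    rewrite (bijection_unique x y' y Hxy' Hxy) in Hb; eauto.
Qed.

Lemma pullback_eqU f f' h h' :
  is_pullback p f' f -> is_pullback p h' h -> eqU Y U' f' h' -> eqU X U f h.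
Proof.
  intros Hf Hh; pose proof (proj1 HU) as HUu.
  rewrite (eqU_ae Y U' pushforward_ultrafilter), (eqU_ae X U HUu), (ae_pushforward
    (fun x => exists a, related f' x a /\ related h' x a)).
  apply (ae_mono X U HUu); intros x Hx (y & Hxy & a & Ha & Hb); exists a.
  split; [apply Hf; eauto|apply Hh; eauto].
Qed.

Lemma pushforward_wf_ultrafilter : wf_ultrafilter Y U'.
Proof.
  split; [exact pushforward_ultrafilter|]; intros g T Og [f0 Hf0] HT.
  destruct (funspace_exists X g) as [F HF].
  destruct (separation (fun f => exists f', f' ∈ T /\ is_pullback p f' f) F) as [S HS].
  destruct (proj2 HU g S Og) as (f & Hf & Hmin).
  - destruct (pullback_exists f0 g (HT f0 Hf0)) as (f & Hf & Hff); exists f.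
    apply HS; split; [apply HF, Hf|eauto].
  - intros f Hf; apply HF, HS, Hf.
  - apply HS in Hf as [_ (f' & Hf' & Hff)]; exists f'; split; [exact Hf'|].
    intros h' Hh' Hlt; destruct (pullback_exists h' g (HT h' Hh')) as (h & Hh & Hhh).
    apply (Hmin h); [apply HS; split; [apply HF, Hh|eauto]|].
    apply (pullback_memU h h' f f' g); auto.
Qed.

Lemma enumerates_pullback g S' :
  enumerates g Y U' S' -> exists S, enumerates g X U S.
Proof.
  intros (H1 & H2 & H3).
  destruct (funspace_exists g g) as [H HH], (funspace_exists X g) as [F HF].
  destruct (product_exists H F) as [P HP].
  destruct (separation (fun q => exists h f f', is_pair h f q /\ related S' h f' /\
    is_pullback p f' f) P) as [S HS].
  assert (HSr : forall h f, is_function f X g ->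
    (related S h f <-> exists f', related S' h f' /\ is_pullback p f' f)).
  { intros h f Ff; split.
    - intros (q & Hq & HqS); apply HS in HqS as (_ & h1 & f1 & f' & Hq' & Hf).
      destruct (pair_injective _ _ _ _ _ Hq Hq') as [-> ->]; eauto.
    - intros (f' & Hf' & Hff); destruct (pair_exists h f) as [q Hq]; exists q.
      split; [exact Hq|]; apply HS; split; [|eauto 6]; apply HP; exists h, f.
      split; [apply HH; eapply H1; exact Hf'|]; split; [apply HF, Ff|exact Hq]. }
  assert (HSF : forall h f, related S h f -> is_function h g g /\ is_function f X g).
  { intros h f (q & Hq & HqS); apply HS in HqS as [HqP _].
    apply HP in HqP as (h1 & f1 & Hh & Hf & Hq').
    destruct (pair_injective _ _ _ _ _ Hq Hq') as [-> ->]; split; [apply HH|apply HF]; auto. }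
  exists S; split; [exact HSF|]; split.
  - intros h f f1 Hf Hf1; destruct (HSF h f Hf) as [_ Ff], (HSF h f1 Hf1) as [_ Ff1].
    apply (HSr h f Ff) in Hf as (f' & Hf' & Hff).
    apply (HSr h f1 Ff1) in Hf1 as (f1' & Hf1' & Hff1).
    apply (pullback_eqU f f' f1 f1'); eauto.
  - intros f Ff; destruct (pullback_inverse f g Ff) as (f' & Ff' & Hff).
    destruct (H3 f' Ff') as [h Hh]; exists h; apply HSr; eauto.
Qed.

End Transport.

(** * Order types and the theorem *)

Section OrderTypes.
Context {V : structure} {HZF : ZF V}.

Lemma well_orders_well_founded (R : V -> V -> Prop) (K : V) :
  well_orders R K -> well_founded_on K R.
Proof.
  intros (H1 & H2 & H3 & H4) s Hs Hn; destruct (H4 s Hs Hn) as (m & Hm & Hmin).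
  exists m; split; [exact Hm|]; intros y Hy Hym.
  destruct (classic (y = m)) as [->|Hne]; [apply (H1 m (Hs m Hm) Hym)|].
  apply (H1 m (Hs m Hm)), (H2 m y m); auto.
Qed.

Theorem order_type_exists (R : V -> V -> Prop) {HR : Definable2 any R} (K : V) :
  well_orders R K -> exists d, is_otp R K d.
Proof.
  intros Hw; pose proof (well_orders_well_founded R K Hw) as Hwf.
  pose proof Hw as (Hirr & Htr & Htri & _).
  assert (Hun : forall z v v', z ∈ K -> collapse K R z v -> collapse K R z v' -> v = v')
    by (intros z v v' _; apply (collapse_unique K R Hwf)).
  destruct (replacement (collapse K R) K Hun) as [d Hd].
  destruct (function_exists (collapse K R) K d Hun) as (h & Hh & Hr).
  { intros z Hz; destruct (collapse_exists K R Hwf z Hz) as [v Hv]; exists v.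
    split; [apply Hd|]; eauto. }
  assert (Hord : forall z v, collapse K R z v -> ordinal v).
  { apply (collapse_ordinal K R Hwf); intros x y z; apply Htr. }
  assert (Hlt : forall x y u v, R x y -> collapse K R x u -> collapse K R y v -> u ∈ v)
    by (intros x y u v; apply (collapse_strict K R Hwf)).
  exists d; split.
  - apply is_ordinal_iff; split.
    + intros v Hv u Hu; apply Hd in Hv as (z & Hz & Hv).
      apply (collapse_mem K R Hwf z v u Hv) in Hu as (y & Hy & _ & Hu); apply Hd; eauto.
    + intros v Hv; apply Hd in Hv as (z & _ & Hv); exact (proj1 (Hord z v Hv)).
  - exists h; split; [split; [split; [exact Hh|]|]|].
    + intros v Hv; apply Hd in Hv as (z & Hz & Hv); exists z; split; [exact Hz|apply Hr; auto].
    + intros x x' v Hx Hx'; apply Hr in Hx as [Hx Hxv], Hx' as [Hx' Hxv'].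
      destruct (Htri x x' Hx Hx') as [H|[H|H]]; [|exact H|]; destruct (not_mem_self v); eauto.
    + intros x y x' y' Hx Hy; apply Hr in Hx as [Hx Hxv], Hy as [Hy Hyv].
      split; [intros H; eapply Hlt; eassumption|]; intros H.
      destruct (Htri x y Hx Hy) as [H'|[->|H']]; [exact H'| |].
      * rewrite (Hun y x' y' Hy Hxv Hyv) in H; destruct (not_mem_self y' H).
      * destruct (not_mem_cycle x' y' H); eapply Hlt; eassumption.
Qed.

End OrderTypes.

Theorem theorem2 (V : structure) (HZF : ZF V)
    (lambda : V) (Hlambda : rank_Berkeley lambda)
    (gamma : V) (Hgamma : is_ordinal gamma) (Hgt : lambda ∈ gamma)
    (X r : V) (HX : well_orders (related r) X)
    (U : V) (HU : well_founded_ultrafilter X U) :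
  exists delta F s : V,
    is_jU X U gamma delta /\ is_funspace gamma gamma F /\ is_surjection s F delta.
Proof.
  pose proof (rank_Berkeley_embeddings lambda gamma Hlambda Hgamma Hgt) as Hemb.
  pose proof (proj1 (is_ordinal_iff gamma) Hgamma) as Og.
  pose proof (well_founded_wf_ultrafilter X U HU) as HUw.
  destruct (order_type_exists (related r) X) as (d & Od & p & Hp & _); [exact HX|].
  apply is_ordinal_iff in Od.
  destruct (pushforward_exists d p U) as [U' HU'].
  destruct (enumerated_on_ordinals gamma d U' Og Hemb Od) as [S' HS'].
  { apply (pushforward_wf_ultrafilter X d p U Hp HUw U' HU'). }
  destruct (enumerates_pullback X d p U Hp HUw U' HU' gamma S' HS') as (S & H1 & H2 & H3).
  destruct (ultrapower_exists X U gamma) as [Q HQ].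
  destruct (order_type_exists (class_memU X U) Q) as (delta & Od' & h & Hh & Hord).
  { apply (proj2 HU gamma Q Hgamma HQ). }
  destruct (funspace_exists gamma gamma) as [F HF].
  exists delta, F.
  pose proof (proj1 HUw) as HUu.
  set (image := fun k v : V => exists f c, related S k f /\ is_classU X U gamma f c /\ related h c v).
  assert (Himage : Definable2 any image) by (unfold image, is_classU; definability).
  assert (Hun : forall k v v', image k v -> image k v' -> v = v').
  { intros k v v' (f & c & Hf & Hc & Hv) (f' & c' & Hf' & Hc' & Hv').
    assert (c = c') as <-.
    { pose proof (H2 k f f' Hf Hf') as He; apply ext; intros q; rewrite (Hc q), (Hc' q).
      pose proof (proj2 (H1 _ _ Hf)) as Ff; pose proof (proj2 (H1 _ _ Hf')) as Ff'.
      split; intros [Hq Hq']; (split; [exact Hq|]).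
      - apply (eqU_trans X U HUu gamma f' f q Ff); [apply eqU_sym|]; assumption.
      - apply (eqU_trans X U HUu gamma f f' q Ff'); assumption. }
    exact (function_unique _ _ _ _ _ _ (proj1 (proj1 Hh)) Hv Hv'). }
  assert (Hall : forall v, v ∈ delta -> exists k, k ∈ F /\ image k v).
  { intros v Hv; destruct (proj2 (proj1 Hh) v Hv) as (c & Hc & Hcv).
    apply HQ in Hc as (f & Ff & Hc); destruct (H3 f Ff) as [k Hk]; exists k.
    split; [apply HF, (H1 k f Hk)|exists f, c; auto]. }
  destruct (function_exists (fun _ y => y = lambda) X gamma) as (f0 & Ff0 & _).
  { intros x y z _ -> ->; reflexivity. }
  { intros x _; exists lambda; auto. }
  destruct (class_exists X U gamma f0) as [c0 Hc0].
  destruct (function_total _ _ _ c0 (proj1 (proj1 Hh))) as (v0 & Hv0 & _).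
  { apply HQ; eauto. }
  (* functions outside the domain of the enumeration are sent to an arbitrary v0 *)
  destruct (function_exists (fun k v => image k v \/
    (~ exists v', image k v') /\ v = v0) F delta) as (s & Hs & Hsr).
  { intros k v v' _ [Hv|[Hn ->]] [Hv'|[Hn' ->]]; eauto; [destruct Hn'|destruct Hn]; eauto. }
  { intros k _; destruct (classic (exists v, image k v)) as [[v Hv]|Hn].
    - exists v; split; [|auto]; destruct Hv as (f & c & _ & _ & Hv).
      apply (function_values _ _ _ _ _ (proj1 (proj1 Hh)) Hv).
    - exists v0; auto. }
  exists s; split; [|split; [exact HF|split; [exact Hs|]]].
  - exists Q; split; [exact HQ|]; split; [exact Od'|]; exists h; auto.
  - intros v Hv; destruct (Hall v Hv) as (k & Hk & Hkv); exists k; split; [exact Hk|].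
    apply Hsr; auto.
Qed.
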